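(* Let $\mathbf{k}$ be a field of characteristic zero, let $(A,d,\mu)$ be a free commutative differential graded algebra over $\mathbf{k}$, and let $(M,\lambda,\rho,d_M)$ be a symmetric differential graded $A$-bimodule. There is an isomorphism $$\Gamma:H^{*-1}(\mathrm{Der}(A,M),d_B)\xrightarrow{\ \approx\ }\widetilde{H}arr^{\,*}_{c.d.g.a.}(A;M;3),$$ where $\mathrm{Der}(A,M)$ is the complex of derivations from $A$ to $M$, with $\mathrm{Der}^p(A,M)$ the set of all derivations of degree $p$ and $d_B(\theta)=(-1)^{|\theta|}\theta\circ d-d_M\circ\theta$, and the right-hand side is the restricted Harrison cohomology of $A$ with coefficients in $M$ truncated at degree $0$.
   Context: Conventions. All modules are non-negatively graded and connected (degree-$0$ part isomorphic to $\mathbf{k}$), differentials have degree $+1$, $\mathrm{Hom}^p_{\mathbf{k}}$ is the space of $\mathbf{k}$-linear maps raising degree by $p$, and the Koszul sign rule for internal degree is used, e.g. $(f\otimes g)(x\otimes y)=(-1)^{|g||x|}f(x)\otimes g(y)$. ''Free'' means that $(A,\mu)$ is a free graded commutative algebra. A differential graded (d.g.) $A$-bimodule is a graded module $M$ with degree-$0$ structure maps $\lambda:A\otimes M\to M$, $\rho:M\otimes A\to M$ satisfying $\lambda(\mu\otimes1)=\lambda(1\otimes\lambda)$, $\rho(1\otimes\mu)=\rho(\rho\otimes1)$ and the unit conditions, and a differential $d_M$ with $d_M\lambda=\lambda(d\otimes1+1\otimes d_M)$, $d_M\rho=\rho(d_M\otimes1+1\otimes d)$. It is symmetric if $\rho=\lambda\circ(1,2)$,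 where $(1,2)$ is the signed transposition. A derivation of degree $p$ is $\theta\in\mathrm{Hom}^p_{\mathbf{k}}(A,M)$ with $\theta\mu=\rho(\theta\otimes1)+\lambda(1\otimes\theta)$; the set of all of these is $\mathrm{Der}^p(A,M)$. Harrison cochains. For $m\ge1$, $Ch^{p,m}(A;M)$ is the space of $f\in\mathrm{Hom}^p_{\mathbf{k}}(A^{\otimes m},M)$ that are normalized ($f(a_1\otimes\cdots\otimes a_m)=0$ whenever some $|a_i|=0$) and that vanish on the image of $\sum_{\sigma}(-1)^{\sigma}\sigma$, the sum over all $(r,m-r)$-shuffles $\sigma\in S_m$, for each $r=1,\dots,m-1$; here $\sigma$ acts by $\sigma(x_1\otimes\cdots\otimes x_m)=\pm x_{\sigma^{-1}(1)}\otimes\cdots\otimes x_{\sigma^{-1}(m)}$ with Koszul sign, and $(-1)^\sigma$ is the sign of the permutation. For $f\in Ch^{p,m}(A;M)$ define $$d_B(f)=(-1)^pf\circ\Big(\sum_{i=0}^{m-1}1^{\otimes i}\otimes d\otimes1^{\otimes(m-1-i)}\Big)-d_M\circ f,$$ $$\partial_B(f)=\lambda(1\otimes f)-f\circ\Big(\sum_{i=0}^{m-1}(-1)^i1^{\otimes i}\otimes\mu\otimes1^{\otimes(m-1-i)}\Big)+(-1)^{m+1}\rho(f\otimes1),$$ and $D_B=d_B-(-1)^p\partial_B$. Put $\widetilde{C}h^n(A;M;3)=\bigoplus_{0\le p\le n-1}Ch^{p,n-p}(A;M)$. Then $\widetilde{H}arr^{\,n}_{c.d.g.a.}(A;M;3)$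 is the $n$-th cohomology of $\{\widetilde{C}h^{*}(A;M;3),D_B\}$. *)

(* Defs.v *)
(* Written with Mathematical Components and the classical layer of
   MathComp-Analysis (for the module structure on arbitrary functions). *)
From HB Require Import structures.
From mathcomp Require Import all_boot fingroup perm all_algebra generic_quotient.
From mathcomp Require Import boolp classical_sets functions cardinality fsbigop.

Set Implicit Arguments.
Unset Strict Implicit.
Unset Printing Implicit Defensive.

Import GRing.Theory.
Local Open Scope classical_set_scope.
Local Open Scope ring_scope.
Local Open Scope quotient_scope.

Record submodule (k : fieldType) (V : lmodType k) := Submodule {
  submod_set :> V -> Prop;
  submod0 : submod_set 0;
  submodP : forall (c : k) (x y : V),
    submod_set x -> submod_set y -> submod_set (c *: x + y)
}.

Section SubmodPred.
Variables (k : fieldType) (V : lmodType k) (S : submodule V).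

Definition submod_pred : {pred V} := fun x => `[< S x >].

Fact submod_pred_closed : submod_closed submod_pred.
Proof.
split=> [|c x y]; rewrite !unfold_in; first by apply/asboolP/submod0.
by move=> /asboolP Sx /asboolP Sy; apply/asboolP/submodP.
Qed.
HB.instance Definition _ :=
  GRing.isSubmodClosed.Build k V submod_pred submod_pred_closed.

End SubmodPred.

(* Z / (Z `&` B); in the uses below B is contained in Z. *)
Section Subquotient.
Variables (k : fieldType) (V : lmodType k) (Z B : submodule V).

Record subZ := SubZ { subZ_val :> V; subZ_prop : subZ_val \in submod_pred Z }.
HB.instance Definition _ := [isSub for subZ_val].
HB.instance Definition _ := [Choice of subZ by <:].
HB.instance Definition _ := [SubChoice_isSubZmodule of subZ by <:].
HB.instance Definition _ := [SubZmodule_isSubLmodule of subZ by <:].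

Definition inB : {pred subZ} := fun x => subZ_val x \in submod_pred B.

Fact inB_zmod : zmod_closed inB.
Proof.
split=> [|x y xB yB]; first exact: (rpred0 (submod_pred B)).
exact: (rpredB (xB : subZ_val x \in submod_pred B) yB).
Qed.
HB.instance Definition _ := GRing.isZmodClosed.Build subZ inB inB_zmod.

Definition subquot := @Quotient.quot subZ inB.
HB.instance Definition _ := GRing.Zmodule.on subquot.
HB.instance Definition _ := EqQuotient.on subquot.

Definition subquot_scale (c : k) := lift_op1 subquot (fun x => c *: x).

Fact pi_subquot_scale c :
  {morph \pi_subquot : x / c *: x >-> subquot_scale c x}.
Proof.
move=> x; unlock subquot_scale; apply/eqP.
rewrite -Quotient.idealrBE -scalerBr unfold_in /inB /= rpredZ //.
suff : x - repr (\pi_subquot x) \in inB by rewrite unfold_in.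
by rewrite Quotient.idealrBE reprK.
Qed.

Fact pi_subquotD : {morph \pi_subquot : x y / x + y}.
Proof. exact: (Quotient.pi_add (inB : zmodClosed subZ)). Qed.

Fact subquot_scaleA a b v :
  subquot_scale a (subquot_scale b v) = subquot_scale (a * b) v.
Proof. by rewrite -[v]reprK -!pi_subquot_scale scalerA. Qed.
Fact subquot_scale1 : left_id 1 subquot_scale.
Proof. by move=> v; rewrite -[v]reprK -pi_subquot_scale scale1r. Qed.
Fact subquot_scaleDr : right_distributive subquot_scale +%R.
Proof.
move=> a u v; rewrite -[u]reprK -[v]reprK -pi_subquotD -!pi_subquot_scale.
by rewrite scalerDr pi_subquotD.
Qed.
Fact subquot_scaleDl v : {morph subquot_scale^~ v : a b / a + b}.
Proof.
move=> a b; rewrite -[v]reprK -!pi_subquot_scale.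
by rewrite scalerDl pi_subquotD.
Qed.

HB.instance Definition _ := GRing.Zmodule_isLmodule.Build k subquot
  subquot_scaleA subquot_scale1 subquot_scaleDr subquot_scaleDl.

End Subquotient.

(* A non-negatively graded cochain complex whose terms are submodules of one
   ambient module. *)
Record complex (k : fieldType) := Complex {
  cx_amb : lmodType k;
  cx_part : nat -> submodule cx_amb;
  cx_diff : nat -> {linear cx_amb -> cx_amb}
}.

Section Cohomology.
Variables (k : fieldType) (C : complex k).

Fact zero_subproof (V : lmodType k) (c : k) (x y : V) :
  x = 0 -> y = 0 -> c *: x + y = 0.
Proof. by move=> -> ->; rewrite scaler0 addr0. Qed.
Definition zero_submod (V : lmodType k) : submodule V :=
  Submodule (submod_set := fun x => x = 0) erefl (@zero_subproof V).

Fact ker_subproof0 n : cx_part C n 0 /\ cx_diff C n 0 = 0.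
Proof. by split; [exact: submod0 | rewrite linear0]. Qed.
Fact ker_subproofP n (c : k) x y :
  cx_part C n x /\ cx_diff C n x = 0 -> cx_part C n y /\ cx_diff C n y = 0 ->
  cx_part C n (c *: x + y) /\ cx_diff C n (c *: x + y) = 0.
Proof.
move=> [Cx dx] [Cy dy]; split; first exact: submodP.
by rewrite linearP dx dy scaler0 addr0.
Qed.

Fact im_subproof0 n : exists2 y, cx_part C n y & 0 = cx_diff C n y.
Proof. by exists 0; [exact: submod0 | rewrite linear0]. Qed.
Fact im_subproofP n (c : k) x y :
  (exists2 z, cx_part C n z & x = cx_diff C n z) ->
  (exists2 z, cx_part C n z & y = cx_diff C n z) ->
  exists2 z, cx_part C n z & c *: x + y = cx_diff C n z.
Proof.
move=> [z1 C1 ->] [z2 C2 ->]; exists (c *: z1 + z2); first exact: submodP.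
by rewrite linearP.
Qed.

Definition cocycles (n : int) : submodule (cx_amb C) :=
  match n with
  | Posz m => Submodule (ker_subproof0 m) (@ker_subproofP m)
  | Negz _ => zero_submod (cx_amb C)
  end.

Definition coboundaries (n : int) : submodule (cx_amb C) :=
  match n with
  | Posz m.+1 => Submodule (im_subproof0 m) (@im_subproofP m)
  | _ => zero_submod (cx_amb C)
  end.

Definition cohomology (n : int) : lmodType k :=
  subquot (cocycles n) (coboundaries n).

End Cohomology.

(* A decomposition V = V_0 (+) V_1 (+) ..., given by the projections of V onto
   the summands. *)
Record grading (k : fieldType) (V : lmodType k) := Grading {
  gproj : nat -> {linear V -> V};
  gproj_orth : forall i j v,
    gproj i (gproj j v) = if i == j then gproj j v else 0;
  gproj_sum : forall v, exists N, v = \sum_(i < N) gproj i v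
}.

Section Graded.
Variable k : fieldType.

Definition homog (V : lmodType k) (g : grading V) (i : nat) (v : V) : Prop :=
  gproj g i v = v.

Definition has_degree (U V : lmodType k) (gU : grading U) (gV : grading V)
    (p : nat) (f : U -> V) : Prop :=
  forall i u, homog gU i u -> homog gV (p + i) (f u).

Definition connected_grading (V : lmodType k) (g : grading V) : Prop :=
  exists e, [/\ e != 0, homog g 0 e &
    forall v, homog g 0 v -> exists c : k, v = c *: e].

(* The linear extension of v |-> (-1)^(p |v|) v. *)
Definition ksign (V : lmodType k) (g : grading V) (p : nat) (v : V) : V :=
  \sum_(i \in [set: nat]) (-1) ^+ (p * i) *: gproj g i v.

Record is_gca (A : algType k) (g : grading A) : Prop := IsGca {
  gca_one : homog g 0 1;
  gca_mul : forall i j a b, homog g i a -> homog g j b -> homog g (i + j) (a * b);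
  gca_comm : forall i j a b, homog g i a -> homog g j b ->
    a * b = (-1) ^+ (i * j) *: (b * a)
}.

(* The universal property of the free graded commutative algebra on a family
   of homogeneous generators. *)
Definition free_gca (A : algType k) (gA : grading A) : Prop :=
  exists (I : Type) (deg : I -> nat) (x : I -> A),
    (forall i, homog gA (deg i) (x i)) /\
    forall (B : algType k) (gB : grading B), is_gca gB ->
    forall b : I -> B, (forall i, homog gB (deg i) (b i)) ->
    exists phi : {lrmorphism A -> B},
      [/\ has_degree gA gB 0 phi, forall i, phi (x i) = b i &
        forall psi : {lrmorphism A -> B}, has_degree gA gB 0 psi ->
          (forall i, psi (x i) = b i) -> psi =1 phi].

Record cdga := Cdga {
  cdga_alg :> algType k;
  cdga_gr : grading cdga_alg;
  cdga_d : {linear cdga_alg -> cdga_alg};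
  cdga_gca : is_gca cdga_gr;
  cdga_d_deg : has_degree cdga_gr cdga_gr 1 cdga_d;
  cdga_dd : forall a, cdga_d (cdga_d a) = 0;
  cdga_leibniz : forall i a b, homog cdga_gr i a ->
    cdga_d (a * b) = cdga_d a * b + (-1) ^+ i *: (a * cdga_d b)
}.

Record dgBimodule (A : cdga) := DgBimodule {
  bim_mod :> lmodType k;
  bim_gr : grading bim_mod;
  bim_d : {linear bim_mod -> bim_mod};
  lact : {bilinear A -> bim_mod -> bim_mod};
  ract : {bilinear bim_mod -> A -> bim_mod};
  lact_deg : forall i j a x, homog (cdga_gr A) i a -> homog bim_gr j x ->
    homog bim_gr (i + j) (lact a x);
  ract_deg : forall i j x a, homog bim_gr i x -> homog (cdga_gr A) j a ->
    homog bim_gr (i + j) (ract x a);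
  lact_mul : forall a b x, lact (a * b) x = lact a (lact b x);
  ract_mul : forall x a b, ract x (a * b) = ract (ract x a) b;
  lact_one : forall x, lact 1 x = x;
  ract_one : forall x, ract x 1 = x;
  bim_d_deg : has_degree bim_gr bim_gr 1 bim_d;
  bim_dd : forall x, bim_d (bim_d x) = 0;
  bim_d_lact : forall i a x, homog (cdga_gr A) i a ->
    bim_d (lact a x) = lact (cdga_d A a) x + (-1) ^+ i *: lact a (bim_d x);
  bim_d_ract : forall i x a, homog bim_gr i x ->
    bim_d (ract x a) = ract (bim_d x) a + (-1) ^+ i *: ract x (cdga_d A a)
}.

Definition symmetric_bimodule (A : cdga) (M : dgBimodule A) : Prop :=
  forall i j x a, homog (bim_gr M) i x -> homog (cdga_gr A) j a ->
    ract M x a = (-1) ^+ (i * j) *: lact M a x.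

End Graded.

Section Derivations.
Variables (k : fieldType) (A : cdga k) (M : dgBimodule A).

Record is_derivation (p : nat) (theta : A -> M) : Prop := IsDerivation {
  der_lin : linear theta;
  der_deg : has_degree (cdga_gr A) (bim_gr M) p theta;
  der_leibniz : forall i a b, homog (cdga_gr A) i a ->
    theta (a * b) = ract M (theta a) b + (-1) ^+ (p * i) *: lact M a (theta b)
}.

Fact der_subproof0 p : is_derivation p 0.
Proof.
split=> [c x y|i u _|i a b _] /=; rewrite ?fctE.
- by rewrite scaler0 addr0.
- by rewrite /homog linear0.
by rewrite linear0l linear0r scaler0 addr0.
Qed.
Fact der_subproofP p (c : k) t u :
  is_derivation p t -> is_derivation p u -> is_derivation p (c *: t + u).
Proof.
move=> [tl td tL] [ul ud uL]; split=> [e x y|i x hx|i a b ha] /=; rewrite !fctE.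
- by rewrite tl ul !scalerDr !scalerA (mulrC c) addrACA.
- by rewrite /homog linearP /= (td _ _ hx) (ud _ _ hx).
rewrite (tL _ _ _ ha) (uL _ _ _ ha) linearPl linearPr !scalerDr !scalerA.
by rewrite (mulrC c) addrACA.
Qed.
Definition Der (p : nat) : submodule (A -> M) :=
  Submodule (der_subproof0 p) (@der_subproofP p).

Definition der_d (p : nat) (theta : A -> M) : A -> M :=
  fun a => (-1) ^+ p *: theta (cdga_d A a) - bim_d M (theta a).

Fact der_d_linear p : linear (der_d p).
Proof.
move=> c t u; apply/funext => a; rewrite /der_d !fctE (linearP (bim_d M)) /= !scalerDr.
by rewrite (scalerN c) !scalerA (mulrC c) opprD addrACA.
Qed.
HB.instance Definition _ p :=
  GRing.isLinear.Build k (A -> M) (A -> M) *:%R (der_d p) (der_d_linear p).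

(* Only derivations of degree p >= 0 occur, so that the degree 0 cohomology is
   the space of all degree 0 cocycles. *)
Definition DerComplex : complex k := @Complex k _ Der der_d.

End Derivations.

Fact scale_comm (k : fieldType) (V : lmodType k) (a b : k) (v : V) :
  a *: (b *: v) = b *: (a *: v).
Proof. by rewrite !scalerA mulrC. Qed.
Fact scale_regroup (k : fieldType) (V : lmodType k) (a b : k) (u v x y : V) :
  a *: u + v - b *: (a *: x + y) = a *: (u - b *: x) + (v - b *: y).
Proof.
by rewrite !scalerDr scalerN (scale_comm b) opprD [LHS]addrACA.
Qed.

(* A map A^{(x) m} -> M is encoded as a function on seq A which is multilinear
   and vanishes on the sequences of length other than m. *)
Section Harrison.
Variables (k : fieldType) (A : cdga k) (M : dgBimodule A).

Definition homogs (ds : seq nat) (s : seq A) : Prop :=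
  size ds = size s /\
  forall i, (i < size s)%N -> homog (cdga_gr A) (nth 0%N ds i) s`_i.

Definition is_shuffle (m r : nat) (sigma : 'S_m) : bool :=
  [forall i : 'I_m, forall j : 'I_m,
    [&& (i < j)%N & (j < r)%N || (r <= i)%N] ==> (sigma i < sigma j)%N].

(* The Koszul sign of x_1 (x) ... (x) x_m |->
   x_{sigma^-1(1)} (x) ... (x) x_{sigma^-1(m)}, for |x_i| = ds_i. *)
Definition koszul (m : nat) (ds : seq nat) (sigma : 'S_m) : k :=
  \prod_(i < m) \prod_(j < m | (i < j)%N && (sigma j < sigma i)%N)
    (-1) ^+ (nth 0%N ds i * nth 0%N ds j).

Definition perm_act (m : nat) (sigma : 'S_m) (s : seq A) : seq A :=
  [seq s`_((sigma^-1)%g i) | i : 'I_m].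

Record is_Ch (p m : nat) (f : seq A -> M) : Prop := IsCh {
  Ch_supp : forall s, size s != m -> f s = 0;
  Ch_lin : forall s1 s2 (c : k) x y,
    f (s1 ++ (c *: x + y) :: s2) = c *: f (s1 ++ x :: s2) + f (s1 ++ y :: s2);
  Ch_deg : forall ds s, homogs ds s -> homog (bim_gr M) (p + sumn ds) (f s);
  Ch_norm : forall (s : seq A) a, a \in s -> homog (cdga_gr A) 0 a -> f s = 0;
  Ch_shuffle : forall r ds s, (0 < r < m)%N -> size s = m -> homogs ds s ->
    \sum_(sigma : 'S_m | is_shuffle r sigma)
      ((-1) ^+ odd_perm sigma * koszul ds sigma) *: f (perm_act sigma s) = 0
}.

Fact Ch_subproof0 p m : is_Ch p m 0.
Proof.
split=> // [*|*|*]; rewrite ?fctE.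
- by rewrite scaler0 addr0.
- by rewrite /homog linear0.
by apply: big1 => sigma _; rewrite scaler0.
Qed.
Fact Ch_subproofP p m (c : k) f g :
  is_Ch p m f -> is_Ch p m g -> is_Ch p m (c *: f + g).
Proof.
move=> [f1 f2 f3 f4 f5] [g1 g2 g3 g4 g5].
split=> [s hs|s1 s2 e x y|ds s hs|s a as_ ha|r ds s hr hm hs]; rewrite ?fctE.
- by rewrite f1 // g1 // scaler0 addr0.
- by rewrite f2 g2 !scalerDr !scalerA (mulrC c) addrACA.
- by rewrite /homog linearP /= f3 // g3.
- by rewrite (f4 _ _ as_ ha) (g4 _ _ as_ ha) scaler0 addr0.
under eq_bigr => sigma _ do rewrite scalerDr (scale_comm _ c).
by rewrite big_split /= -scaler_sumr f5 // g5 // scaler0 addr0.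
Qed.
Definition Ch (p m : nat) : submodule (seq A -> M) :=
  Submodule (Ch_subproof0 p m) (@Ch_subproofP p m).

(* ksign 1 is the sign of moving the degree 1 map d past x_1, ..., x_i. *)
Definition Ch_dB (p : nat) (f : seq A -> M) : seq A -> M := fun s =>
  (-1) ^+ p *:
    (\sum_(i < size s) f ([seq ksign (cdga_gr A) 1 a | a <- take i s]
                            ++ cdga_d A s`_i :: drop i.+1 s))
  - bim_d M (f s).

(* For f of arity m this vanishes off the sequences s of length m + 1, so
   (size s).-1 is m; ksign p is the sign in (1 (x) f)(a (x) x). *)
Definition Ch_delB (p : nat) (f : seq A -> M) : seq A -> M := fun s =>
  lact M (ksign (cdga_gr A) p s`_0) (f (behead s))
  - \sum_(i < (size s).-1)
      (-1) ^+ i *: f (take i s ++ (s`_i * s`_i.+1) :: drop i.+2 s)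
  + (-1) ^+ size s *: ract M (f (take (size s).-1 s)) (last 0 s).

(* An element of the direct sum of the Ch^{p, n-p}, 0 <= p <= n - 1, is the
   family f of its components, extended by 0 to p >= n. *)
Definition is_totCh (n : nat) (f : nat -> seq A -> M) : Prop :=
  forall p, if (p < n)%N then Ch p (n - p) (f p) else f p = 0.

Fact totCh_subproof0 n : is_totCh n 0.
Proof. by move=> p; case: ifP => // _; exact: submod0. Qed.
Fact totCh_subproofP n (c : k) f g :
  is_totCh n f -> is_totCh n g -> is_totCh n (c *: f + g).
Proof.
move=> fn gn p; move: (fn p) (gn p); case: ifP => _; first exact: submodP.
exact: zero_subproof.
Qed.
Definition totCh (n : nat) : submodule (nat -> seq A -> M) :=
  Submodule (totCh_subproof0 n) (@totCh_subproofP n).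

Definition Harr_D (f : nat -> seq A -> M) : nat -> seq A -> M := fun p =>
  (if p is q.+1 then Ch_dB q (f q) else 0) - (-1) ^+ p *: Ch_delB p (f p).

Fact Ch_dB_linear p : linear (Ch_dB p).
Proof.
move=> c f g; apply/funext => s; rewrite /Ch_dB !fctE (linearP (bim_d M)) /=.
rewrite big_split /= -scaler_sumr !scalerDr !scalerA (mulrC c) scalerN.
by rewrite opprD addrACA.
Qed.
Fact Ch_delB_linear p : linear (Ch_delB p).
Proof.
move=> c f g; apply/funext => s; rewrite /Ch_delB !fctE linearPl linearPr.
under eq_bigr => i _ do rewrite scalerDr (scale_comm _ c).
rewrite big_split /= -scaler_sumr !scalerDr !scalerA scalerN (mulrC c).
by rewrite opprD [X in X + _ = _]addrACA [LHS]addrACA.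
Qed.
Fact Harr_D_linear : linear Harr_D.
Proof.
move=> c f g; apply/funext => p.
pose P (h : nat -> seq A -> M) := if p is q.+1 then Ch_dB q (h q) else 0.
have PP : P (c *: f + g) = c *: P f + P g.
  by rewrite /P {P}; case: p => [|q]; [rewrite scaler0 addr0 | exact: Ch_dB_linear].
rewrite -[LHS]/(P (c *: f + g) - (-1) ^+ p *: Ch_delB p (c *: f p + g p)).
rewrite -[RHS]/(c *: (P f - (-1) ^+ p *: Ch_delB p (f p))
                + (P g - (-1) ^+ p *: Ch_delB p (g p))).
by rewrite PP Ch_delB_linear; exact: scale_regroup.
Qed.
HB.instance Definition _ :=
  GRing.isLinear.Build k (nat -> seq A -> M) (nat -> seq A -> M) *:%R
    Harr_D Harr_D_linear.

Definition HarrComplex : complex k := @Complex k _ totCh (fun=> Harr_D).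

Definition Harr (n : int) : lmodType k := cohomology HarrComplex n.

End Harrison.

(* Main.v *)
(* As [M] is symmetric, both end terms of the Harrison differential [del] are
   left actions, up to sign.  As [A] is free, the derivation
   [delta a = \sum_i deg x_i x_i (x) d_i a] into [V (x) A], [V] spanned by the
   generators, satisfies [mu delta = deg].  Marking a letter of a word, moving
   it to the front by the transpose of Dynkin's bracketing (which kills
   shuffles) and splitting it by [delta] gives an operator [H] on Harrison
   cochains such that, in arity at least 2, [del H + H del = - P], where
   [P f = deg . f - \sum_i deg x_i x_i . (f o d_i)] is triangular for the total
   degree of the arguments, hence invertible in characteristic 0, and commutes
   with [del].  So the [del]-cohomology is concentrated in arity 1, where the
   cocycles are the derivations, and a staircase argument along [p] concludes.
   The signs are those of words of homogeneous letters, from which cochains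
   extend by multilinearity. *)
Require Import Defs.
From HB Require Import structures.
From mathcomp Require Import all_boot fingroup perm all_algebra generic_quotient.
From mathcomp Require Import boolp classical_sets functions fsbigop cardinality.
From mathcomp Require Import ring zify.
Set Implicit Arguments.
Unset Strict Implicit.
Unset Printing Implicit Defensive.
Import GRing.Theory.
Local Open Scope ring_scope.

(** * Linear combinations in a module *)

(** Splitting a letter need not preserve the vanishing on shuffles. The transpose of Dynkin's
    bracketing restores it, because its output vanishes on shuffles whatever function it is fed. On
    Harrison cochains this costs nothing: a function that vanishes on shuffles does not see, up to
    sign, the displacement of the marked letter, so summing over the marks adds up the degrees of
    the letters. One then divides by the total degree; words of total degree 0 consist of scalars,
    and there normalization takes over. Freeness is given as a universal property, without a basis
    of monomials. The partial derivatives therefore come from a morphism into a square zero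
    extension, in which the relation between [delta] and the degree is imposed on the elements
    instead of being computed on monomials. The sign of 1 ⊗ f depends on the degree p of f. It is
    absorbed in a twisted action of the letters, so acyclicity is proved for an abstract action and
    used once for each p. *)

Section LinearCombination.
Variables (k : comNzRingType) (V : lmodType k).

(** Reified linear combinations over a list of atoms, for the tactic [lincomb]: they agree once
    their coefficients do, which leaves scalar goals for [ring]. *)
Inductive lcomb :=
  LVar of nat | LZero | LAdd of lcomb & lcomb | LOpp of lcomb | LScale of k & lcomb.

Fixpoint leval (env : seq V) e := match e with
  | LVar n => env`_n
  | LZero => 0
  | LAdd e1 e2 => leval env e1 + leval env e2
  | LOpp e1 => - leval env e1
  | LScale c e1 => c *: leval env e1
  end.

Fixpoint lcoef (i : nat) e : k := match e with
  | LVar n => if eqn n i then 1 else 0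
  | LZero => 0
  | LAdd e1 e2 => lcoef i e1 + lcoef i e2
  | LOpp e1 => - lcoef i e1
  | LScale c e1 => c * lcoef i e1
  end.

Lemma levalE env e : leval env e = \sum_(i < size env) lcoef i e *: env`_i.
Proof.
elim: e => [n||e1 IH1 e2 IH2|e IH|c e IH] /=.
- have [lt_n|le_n] := ltnP n (size env); last first.
    rewrite nth_default // big1 // => i _; rewrite ?eqnE; case: eqP => [E|_].
      by move: (ltn_ord i); rewrite -E ltnNge le_n.
    by rewrite scale0r.
  rewrite (bigD1 (Ordinal lt_n)) //= ?eqnE eqxx scale1r big1 ?addr0 // => i /eqP ni.
  rewrite ?eqnE; case: eqP => [E|_]; last by rewrite scale0r.
  by case: ni; apply: val_inj.
- by rewrite big1 // => i _; rewrite scale0r.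
- by rewrite IH1 IH2 -big_split; apply: eq_bigr => i _; rewrite scalerDl.
- by rewrite IH -sumrN; apply: eq_bigr => i _; rewrite scaleNr.
by rewrite IH scaler_sumr; apply: eq_bigr => i _; rewrite scalerA.
Qed.

Fixpoint coef_eqs (n : nat) e1 e2 : Prop :=
  if n is m.+1 then lcoef m e1 = lcoef m e2 /\ coef_eqs m e1 e2 else True.

Lemma lcomb_eq env e1 e2 :
  coef_eqs (size env) e1 e2 -> leval env e1 = leval env e2.
Proof.
move=> H; rewrite !levalE; apply: eq_bigr => i _; congr (_ *: _).
elim: (size env) i H => [[]//|n IHn] i [E H].
have [lt_i|] := ltnP i n; first exact: (IHn (Ordinal lt_i)).
move=> le_i; have -> : nat_of_ord i = n by apply/eqP; rewrite eqn_leq le_i -ltnS ltn_ord.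
exact: E.
Qed.
End LinearCombination.

(** Atoms are identified up to unification, so that convertible terms of different syntax share one
    coefficient. *)
Ltac lc_index t l := match l with
  | t :: _ => constr:(0%N)
  | ?h :: _ => let _ := match goal with _ => unify h t end in constr:(0%N)
  | _ :: ?l' => let n := lc_index t l' in constr:(S n) end.
Ltac lc_mem t l := match l with
  | t :: _ => constr:(true)
  | ?h :: _ => let _ := match goal with _ => unify h t end in constr:(true)
  | _ :: ?l' => lc_mem t l' | _ => constr:(false) end.
Ltac lc_atoms e l := match e with
  | ?a + ?b => let l1 := lc_atoms a l in lc_atoms b l1
  | - ?a => lc_atoms a l
  | _ *: ?a => lc_atoms a l
  | 0 => l
  | _ => match lc_mem e l with true => l | false => constr:(e :: l) end
  end.
Ltac lc_reify k e l := match e with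
  | ?a + ?b => let x := lc_reify k a l in let y := lc_reify k b l in
               constr:(LAdd x y)
  | - ?a => let x := lc_reify k a l in constr:(LOpp x)
  | ?c *: ?a => let x := lc_reify k a l in constr:(LScale c x)
  | 0 => constr:(LZero k)
  | _ => let n := lc_index e l in constr:(LVar k n)
  end.
(* Reduces an equality in a module to the equality of the coefficients. *)
Ltac lincomb := match goal with |- @eq ?V ?a ?b =>
  let k := match a with context [@GRing.scale ?k _ _ _] => k
           | _ => match b with context [@GRing.scale ?k _ _ _] => k end end in
  let l0 := constr:(@nil V) in
  let l1 := lc_atoms a l0 in let l := lc_atoms b l1 in
  let x := lc_reify k a l in let y := lc_reify k b l in
  apply: (@lcomb_eq _ _ l x y); cbn [coef_eqs size lcoef eqn];
  repeat (apply: conj; last by []) ; repeat split; try by ring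
  end.

(** * Signed shuffles and the Dynkin operator *)

Lemma opp_sign (R : pzRingType) n : - (-1) ^+ n = (-1) ^+ n.+1 :> R.
Proof. by rewrite exprS mulN1r. Qed.

(** Powers of -1 are compared through the parity of their exponents, by cases on the parity of each
    number that occurs. *)
Ltac sign_parity :=
  rewrite -?exprD ?opp_sign -?exprD -[LHS]signr_odd -[RHS]signr_odd ?(oddD, oddM, oddS) /=;
  repeat match goal with |- context [odd ?n] => case: (odd n) => /= end;
  rewrite ?(expr0, expr1, mulr1, mul1r, mulN1r, mulrN1, opprK) //.

Section Shuffle.
Variables (k : fieldType) (T : Type) (dg : T -> nat) (M : lmodType k).
Implicit Types (a b c : T) (x y z r : seq T) (F G : seq T -> M).

Definition wdg x := sumn (map dg x).

Lemma wdg_cons a x : wdg (a :: x) = (dg a + wdg x)%N. Proof. by []. Qed.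
Lemma wdg_nil : wdg [::] = 0%N. Proof. by []. Qed.
Lemma wdg_cat x y : wdg (x ++ y) = (wdg x + wdg y)%N.
Proof. by rewrite /wdg map_cat sumn_cat. Qed.
Lemma wdg_rcons x a : wdg (rcons x a) = (wdg x + dg a)%N.
Proof. by rewrite -cats1 wdg_cat /= wdg_cons addn0. Qed.
Lemma wdg_rev x : wdg (rev x) = wdg x.
Proof. by rewrite /wdg map_rev sumn_rev. Qed.
Definition wE := (wdg_rev, size_rev, wdg_cons, wdg_nil, wdg_cat, wdg_rcons, size_cat, size_rcons).

(** The signature of the block permutation that exchanges [x] and [y], times its Koszul sign. *)
Definition sg x y : k := (-1) ^+ (size x * size y + wdg x * wdg y).

Lemma sg_cons a x y : sg (a :: x) y = sg [:: a] y * sg x y.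
Proof. by rewrite /sg !wE /= -exprD; congr (_ ^+ _); ring. Qed.
Lemma sgC x y : sg x y = sg y x.
Proof. by rewrite /sg; congr (_ ^+ _); ring. Qed.
Lemma sg_catl x y z : sg (x ++ y) z = sg x z * sg y z.
Proof. by rewrite /sg !wE /= -exprD; congr (_ ^+ _); ring. Qed.
Lemma sg_catr x y z : sg z (x ++ y) = sg z x * sg z y.
Proof. by rewrite sgC sg_catl !(sgC z). Qed.
Lemma sg_consr a x y : sg y (a :: x) = sg y [:: a] * sg y x.
Proof. by rewrite sgC sg_cons !(sgC y). Qed.
Lemma sg_rcons a x y : sg (rcons x a) y = sg x y * sg [:: a] y.
Proof. by rewrite -cats1 sg_catl. Qed.
Lemma sg_rconsr a x y : sg y (rcons x a) = sg y x * sg y [:: a].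
Proof. by rewrite sgC sg_rcons !(sgC y). Qed.
Lemma sg0 x : sg [::] x = 1. Proof. by rewrite /sg !wE /= mul0n. Qed.
Lemma sg0r x : sg x [::] = 1. Proof. by rewrite sgC sg0. Qed.
Lemma sg11 a b : sg [:: a] [:: b] = - (-1) ^+ (dg a * dg b).
Proof. by rewrite /sg !wE /= !addn0 muln1 add1n exprS mulN1r. Qed.
Lemma sgN_size b x y : (size x).+1 = size y -> wdg x = wdg y ->
  sg [:: b] x = - sg [:: b] y.
Proof. by rewrite /sg /= !mul1n => <- ->; rewrite addSn exprS mulN1r opprK. Qed.
Lemma sgK x y : sg x y * sg x y = 1.
Proof. by rewrite /sg -expr2 sqrr_sign. Qed.

(* [sh x y F] is [F] applied, with signs, to the sum of all shuffles of [x]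
   and [y]; the sign of a transposition of adjacent letters [a], [b] is
   [sg [:: a] [:: b] = - (-1)^(|a| |b|)]. *)
Fixpoint sh x : seq T -> (seq T -> M) -> M :=
  match x with
  | [::] => fun y F => F y
  | a :: x' => fix shy y F {struct y} :=
      match y with
      | [::] => F x
      | b :: y' => sh x' y (fun z => F (a :: z))
                   + sg x [:: b] *: shy y' (fun z => F (b :: z))
      end
  end.

Lemma sh0l y F : sh [::] y F = F y. Proof. by []. Qed.
Lemma sh0r x F : sh x [::] F = F x. Proof. by case: x. Qed.
Lemma sh_cons a x b y F : sh (a :: x) (b :: y) F =
  sh x (b :: y) (fun z => F (a :: z))
  + sg (a :: x) [:: b] *: sh (a :: x) y (fun z => F (b :: z)).
Proof. by []. Qed.

(** Quantifying over all weights [phi] expresses that words have the same letters up to order, with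
    no decidable equality on [T]; size, degree and number of scalar letters are instances. *)
Definition wt (phi : T -> nat) x := sumn (map phi x).

Lemma sh_eq x y F G :
  (forall z, (forall phi, wt phi z = wt phi x + wt phi y)%N -> F z = G z) ->
  sh x y F = sh x y G.
Proof.
elim: x y F G => [|a x IHx] y F G; first by move=> H; rewrite !sh0l H.
elim: y F G => [|b y IHy] F G H.
  by rewrite !sh0r H // => phi; rewrite [X in (_ + X)%N]/wt /= addn0.
rewrite !sh_cons; congr (_ + _ *: _); [apply: IHx|apply: IHy] => z Hz; apply: H.
  by move=> phi; rewrite /wt /= -!/(wt _ _) Hz addnA.
by move=> phi; rewrite /wt /= -!/(wt _ _) Hz addnCA.
Qed.

Lemma sh_eq_size x y F G :
  (forall z, size z = (size x + size y)%N -> wdg z = (wdg x + wdg y)%N ->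
     F z = G z) ->
  sh x y F = sh x y G.
Proof.
move=> H; apply: sh_eq => z Hz; apply: H; last exact: Hz.
have sizeE (w : seq T) : size w = wt (fun=> 1%N) w.
  by rewrite /wt; elim: w => //= c w ->.
by rewrite !sizeE.
Qed.

Lemma sh_ext x y F G : F =1 G -> sh x y F = sh x y G.
Proof. by move=> H; apply: sh_eq => z _. Qed.

Lemma shD x y F G : sh x y (fun z => F z + G z) = sh x y F + sh x y G.
Proof.
elim: x y F G => [|a x IHx] y F G //.
elim: y F G => [|b y IHy] F G //.
by rewrite !sh_cons IHx IHy scalerDr addrACA.
Qed.

Lemma sh_0 x y : sh x y (fun=> 0) = 0.
Proof.
elim: x y => [|a x IHx] y //; elim: y => [|b y IHy] //.
by rewrite sh_cons IHx IHy scaler0 addr0.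
Qed.

Lemma sh_eq0 x y F :
  (forall z, (forall phi, sumn (map phi z) = sumn (map phi x) + sumn (map phi y))%N ->
     F z = 0) -> sh x y F = 0.
Proof. by move=> H; rewrite -(sh_0 x y); apply: sh_eq. Qed.

Lemma shZ x y (c : k) F : sh x y (fun z => c *: F z) = c *: sh x y F.
Proof.
elim: x y F => [|a x IHx] y F //.
elim: y F => [|b y IHy] F //.
by rewrite !sh_cons IHx IHy scalerDr !scalerA mulrC.
Qed.

Lemma shN x y F : sh x y (fun z => - F z) = - sh x y F.
Proof.
by rewrite -scaleN1r -shZ; apply: sh_ext => z; rewrite scaleN1r.
Qed.
Lemma shB x y F G : sh x y (fun z => F z - G z) = sh x y F - sh x y G.
Proof. by rewrite shD shN. Qed.

Lemma sh_lin x y (L : {linear M -> M}) F :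
  sh x y (fun z => L (F z)) = L (sh x y F).
Proof.
elim: x y F => [|a x IHx] y F //.
elim: y F => [|b y IHy] F //.
by rewrite !sh_cons IHx IHy linearD linearZ.
Qed.

Lemma sh_rcons x a y b F : sh (rcons x a) (rcons y b) F =
  sg [:: a] (rcons y b) *: sh x (rcons y b) (fun z => F (rcons z a))
  + sh (rcons x a) y (fun z => F (rcons z b)).
Proof.
elim: x y F => [|c x IHx] y F.
  elim: y F => [|d y IHy] F; first by rewrite /= addrC.
  rewrite !rcons_cons [LHS]sh_cons IHy !sh_cons !sh0l scalerDr.
  by rewrite addrCA scalerA -sg_consr.
elim: y F => [|d y IHy] F.
  rewrite !rcons_cons /= [LHS]sh_cons -[[:: b]]/(rcons [::] b) IHx !sh0r.
  rewrite scalerDr scalerA -!addrA; congr (_ + _).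
  by rewrite addrC; congr (_ *: _ + _); rewrite -rcons_cons sg_rcons mulrC.
rewrite !rcons_cons [LHS]sh_cons -rcons_cons IHx -rcons_cons IHy.
rewrite [sh (c :: x) (d :: _) _]sh_cons [sh (rcons (c :: x) a) (d :: y) _]sh_cons.
rewrite !scalerDr -!addrA; congr (_ + _); rewrite addrCA; congr (_ + _).
rewrite !scalerA; congr (_ *: _).
by rewrite sg_rcons rcons_cons (sg_consr d (rcons y b)); ring.
Qed.

Lemma sh_sum x y (I : Type) (s : seq I) (H : I -> seq T -> M) :
  sh x y (fun z => \sum_(i <- s) H i z) = \sum_(i <- s) sh x y (H i).
Proof.
elim: s => [|i s IHs].
  by rewrite big_nil -[RHS](sh_0 x y); apply: sh_ext => z; rewrite big_nil.
by rewrite big_cons -IHs -shD; apply: sh_ext => z; rewrite big_cons.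
Qed.

Lemma sg_eq x y x' y' : size x = size x' -> wdg x = wdg x' ->
  size y = size y' -> wdg y = wdg y' -> sg x y = sg x' y'.
Proof. by rewrite /sg => -> -> -> ->. Qed.

(** [r] holds, reversed, the letters already passed, so that [catrev r' (a :: y)] is the same word
    for every mark [a]. *)
Fixpoint mark_sum r x (P : seq T -> T -> seq T -> M) : M :=
  if x is a :: y then P r a y + mark_sum (a :: r) y P else 0.

Lemma mark_sum_eq r x P P' :
  (forall r' a y, catrev r' (a :: y) = catrev r x -> P r' a y = P' r' a y) ->
  mark_sum r x P = mark_sum r x P'.
Proof.
by elim: x r => //= a x IHx r H; rewrite H // IHx.
Qed.
Lemma mark_sum_eq0 r x P :
  (forall r' a y, catrev r' (a :: y) = catrev r x -> P r' a y = 0) -> mark_sum r x P = 0.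
Proof. by elim: x r => //= a x IHx r H; rewrite H // IHx // addr0. Qed.
Lemma mark_sumD r x P P' :
  mark_sum r x (fun s a y => P s a y + P' s a y) = mark_sum r x P + mark_sum r x P'.
Proof. by elim: x r => /= [|a x IHx] r; rewrite ?addr0 // IHx addrACA. Qed.
Lemma mark_sumZ r x (e : k) P : mark_sum r x (fun s a y => e *: P s a y) = e *: mark_sum r x P.
Proof. by elim: x r => /= [|a x IHx] r; rewrite ?scaler0 // IHx scalerDr. Qed.
Lemma mark_sum_lin r x (L : {linear M -> M}) P :
  mark_sum r x (fun s a y => L (P s a y)) = L (mark_sum r x P).
Proof. by elim: x r => /= [|a x IHx] r; rewrite ?linear0 // IHx linearD. Qed.
Lemma mark_sum_rcons r x c P :
  mark_sum r (rcons x c) P = mark_sum r x (fun s a y => P s a (rcons y c))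
                       + P (catrev x r) c [::].
Proof.
elim: x r => /= [|a x IHx] r; first by rewrite addr0 add0r.
by rewrite IHx addrA.
Qed.
Lemma mark_sum_shift r b x P :
  mark_sum (rcons r b) x P = mark_sum r x (fun s a y => P (rcons s b) a y).
Proof. by elim: x r => //= a x IHx r; rewrite -rcons_cons IHx. Qed.

Lemma mark_sum_cat r x y P :
  mark_sum r (x ++ y) P = mark_sum r x (fun s a z => P s a (z ++ y)) + mark_sum (catrev x r) y P.
Proof. by elim: x r => /= [|a x IHx] r; rewrite ?add0r // IHx addrA. Qed.
Lemma mark_sum_catl r s x P : mark_sum (r ++ s) x P = mark_sum r x (fun r' a y => P (r' ++ s) a y).
Proof. by elim: x r => //= a x IHx r; rewrite -cat_cons IHx. Qed.

(** The sign of reversing [r], with one more minus for each letter, as in the antipode of the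
    shuffle algebra. *)
Fixpoint rho r : k := if r is b :: r' then - sg [:: b] r' * rho r' else 1.

Lemma rho_rcons r b : rho (rcons r b) = - sg r [:: b] * rho r.
Proof.
elim: r => [|c r IHr] /=; first by rewrite sg0 sg0r.
by rewrite IHr sg_rconsr (sg_cons c r); ring.
Qed.

(* [dynkin G x] sums, over the ways of marking a letter [a] in [x = u a v], the
   signed shuffles of the reverse of [u] with [v], [G] being fed [a] and the
   shuffle: this is the transpose of the iterated bracket of Dynkin. *)
Definition dynkin (G : T -> seq T -> M) x : M :=
  mark_sum [::] x (fun r a y => (rho r * sg r [:: a]) *: sh r y (G a)).

Lemma dynkin_eq (G G' : T -> seq T -> M) x :
  (forall a z, (size z).+1 = size x -> (dg a + wdg z)%N = wdg x ->
     G a z = G' a z) -> dynkin G x = dynkin G' x.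
Proof.
move=> H; apply: mark_sum_eq => r a y E; congr (_ *: _).
apply: sh_eq_size => z Hs Hd; apply: H; rewrite ?Hs ?Hd.
  by move/(congr1 size): E; rewrite catrevE !wE /= addnS.
by move/(congr1 wdg): E; rewrite catrevE !wE /= addnCA.
Qed.
Lemma dynkinD (G G' : T -> seq T -> M) x :
  dynkin (fun a z => G a z + G' a z) x = dynkin G x + dynkin G' x.
Proof.
by rewrite -mark_sumD; apply: mark_sum_eq => r a y _; rewrite shD scalerDr.
Qed.
Lemma dynkin_lin (L : {linear M -> M}) (G : T -> seq T -> M) x :
  dynkin (fun a z => L (G a z)) x = L (dynkin G x).
Proof.
by rewrite -mark_sum_lin; apply: mark_sum_eq => r a y _; rewrite sh_lin linearZ.
Qed.
Lemma dynkinZ (e : k) (G : T -> seq T -> M) x :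
  dynkin (fun a z => e *: G a z) x = e *: dynkin G x.
Proof.
rewrite -mark_sumZ; apply: mark_sum_eq => r a y _.
by rewrite shZ !scalerA mulrC.
Qed.
Lemma dynkinB (G G' : T -> seq T -> M) x :
  dynkin (fun a z => G a z - G' a z) x = dynkin G x - dynkin G' x.
Proof.
rewrite dynkinD; congr (_ + _); rewrite -scaleN1r -dynkinZ.
by apply: dynkin_eq => a z _ _; rewrite scaleN1r.
Qed.

Lemma dynkin_eq0 (G : T -> seq T -> M) x :
  (forall a z, (size z).+1 = size x -> (dg a + wdg z)%N = wdg x -> G a z = 0) ->
  dynkin G x = 0.
Proof.
move=> H; rewrite (dynkin_eq (G' := fun a z => (0 : k) *: G a z)) ?dynkinZ ?scale0r //.
by move=> a z Hs Hd; rewrite H // scale0r.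
Qed.

Definition snoc_arg (c : T) (G : T -> seq T -> M) : T -> seq T -> M :=
  fun a z => G a (rcons z c).

Lemma dynkin1 (G : T -> seq T -> M) a : dynkin G [:: a] = G a [::].
Proof. by rewrite /dynkin /= sg0 mulr1 scale1r addr0. Qed.

(** When [u a v] is the whole word, a shuffle of the reverse of [u] with [v] ends with the last
    letter of [v] or with the first letter of [u], hence with one of the two ends [c], [b] of the
    word; a marked end leaves only the other choice. *)
Lemma dynkin_ends (G : T -> seq T -> M) b x c : dynkin G (b :: rcons x c) =
  dynkin (snoc_arg c G) (b :: x) - sg [:: b] (rcons x c) *: dynkin (snoc_arg b G) (rcons x c).
Proof.
rewrite {1 2}/dynkin /= -[[:: b]]/(rcons [::] b) !mark_sum_shift /= !sg0 mulr1 !scale1r -!addrA.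
congr (_ + _); rewrite /dynkin !mark_sum_rcons scalerDr opprD addrA -scaleNr -mark_sumZ -mark_sumD.
congr (_ + _).
  apply: mark_sum_eq => r a y; rewrite catrevE /= => Ex.
  rewrite sh_rcons scalerDr addrC; congr (_ + _); rewrite !scalerA; congr (_ *: _).
  rewrite -Ex rho_rcons (sg_rcons b r) (sg_rconsr c y) (sg_rconsr c (rev r ++ a :: y)).
  rewrite sg_catr (sg_consr a y).
  have -> : sg [:: b] (rev r) = sg r [:: b].
    by rewrite sgC; apply: sg_eq; rewrite ?wE.
  by ring.
rewrite !sh0r rho_rcons sg_rcons (sg_rconsr c x) !scalerA -scaleNr; congr (_ *: _).
have -> : sg [:: b] x = sg (catrev x [::]) [:: b].
  by rewrite sgC; apply: sg_eq; rewrite // catrevE cats0 !wE.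
ring.
Qed.

Definition on_head (K : T -> seq T -> M) z : M := if z is a :: w then K a w else 0.
Definition on_last (K : T -> seq T -> M) z : M :=
  if z is a :: w then K (last a w) (belast a w) else 0.
Lemma on_last_rcons K z c : on_last K (rcons z c) = K c z.
Proof. by case: z => //= a z; rewrite last_rcons belast_rcons. Qed.

Lemma dynkin_peel (G : T -> seq T -> M) z : (1 < size z)%N ->
  dynkin G z = on_last (fun c => dynkin (snoc_arg c G)) z
            - on_head (fun b w => sg [:: b] w *: dynkin (snoc_arg b G) w) z.
Proof.
case: z => [|b z] //; case/lastP: z => [|z c] // _.
by rewrite dynkin_ends -rcons_cons on_last_rcons.
Qed.

(** Dual to the fact that Dynkin's bracketing produces Lie elements, to which shuffles are
    orthogonal. Peeling the last and the first letter gives shorter shuffles, which vanish by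
    induction unless one word was a single letter; the surviving terms of the two peelings
    cancel. *)
Lemma dynkin_shuffle (G : T -> seq T -> M) x y : (0 < size x)%N -> (0 < size y)%N ->
  sh x y (dynkin G) = 0.
Proof.
have [n] := ubnP (size x + size y); elim: n x y G => // n IHn x y G Hn Hx Hy.
pose K b w := sg [:: b] w *: dynkin (snoc_arg b G) w.
have -> : sh x y (dynkin G) =
    sh x y (fun z => on_last (fun c => dynkin (snoc_arg c G)) z - on_head K z).
  apply: sh_eq_size => z Hs _; apply: dynkin_peel.
  by rewrite Hs; case: (x) (y) Hx Hy => [|? ?] [|? ?] //= _ _; rewrite addnS.
rewrite shB; apply/eqP; rewrite subr_eq0; apply/eqP.
(* The last letter comes from [x] or from [y]; only a word reduced to that letter escapes the
   induction hypothesis. *)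
have Hl : sh x y (on_last (fun c => dynkin (snoc_arg c G))) =
    (if x is [:: a] then sg x y *: dynkin (snoc_arg a G) y else 0)
    + (if y is [:: b] then dynkin (snoc_arg b G) x else 0).
  case/lastP: x Hx Hn => // x a _; case/lastP: y Hy => // y b _.
  rewrite !size_rcons ltnS => Hn; rewrite sh_rcons; congr (_ + _).
    rewrite (sh_ext _ _ (on_last_rcons _ ^~ a)).
    case: x Hn => [//|c x] Hn; rewrite IHn ?size_rcons ?scaler0 //.
    by case: x {Hn}.
  rewrite (sh_ext _ _ (on_last_rcons _ ^~ b)).
  case: y Hn => [_|c y Hn]; first by rewrite sh0r.
  by rewrite IHn ?size_rcons ?addSn ?(leq_trans _ Hn) ?addnS //; case: y {Hn}.
rewrite Hl {Hl}; case: x Hx Hn => // a x _; case: y Hy => // b y _ Hn.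
(* The sign in [K] depends only on the size and the degree of the word, so it is constant over the
   shuffles. *)
have Hs u v c : sh u v (K c) = sg [:: c] (u ++ v) *: sh u v (dynkin (snoc_arg c G)).
  rewrite -shZ; apply: sh_eq_size => z Hs Hd; rewrite /K; congr (_ *: _).
  by apply: sg_eq; rewrite ?wE.
rewrite sh_cons !Hs scalerA; congr (_ + _).
  case: x Hn => [_|c x Hn]; first by [].
  by rewrite IHn ?scaler0.
case: y Hn => [_|c y Hn].
  rewrite sh0r cats0 [in sg [:: b] _]sgC sgK scale1r //.
by rewrite IHn ?scaler0 //= -addnS.
Qed.

End Shuffle.
Arguments sh : simpl never.

(** * The inner part of the bar differential *)

Section Merge.
Variables (k : fieldType) (T : Type) (dg : T -> nat) (M : lmodType k).
Variable mul : T -> T -> T.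
Hypothesis dgM : forall a b, dg (mul a b) = (dg a + dg b)%N.
Implicit Types (a b c e : T) (x y z r u w : seq T) (F : seq T -> M).
Implicit Types (G : T -> seq T -> M).
Local Notation sg := (sg k dg).
Local Notation wdg := (wdg dg).
Local Notation wE := (wE dg).
Local Notation sh := (sh dg).
Local Notation dynkin := (dynkin dg).

(* The bar differential without its end terms. *)
Fixpoint merge_sum x F : M :=
  if x is a :: x' then
    (if x' is b :: y then F (mul a b :: y) - merge_sum x' (fun z => F (a :: z)) else 0)
  else 0.

Lemma merge_sum2 a b y F : merge_sum (a :: b :: y) F =
  F (mul a b :: y) - merge_sum (b :: y) (fun z => F (a :: z)).
Proof. by []. Qed.

Lemma merge_sum_eq x F F' :
  (forall z, (size z).+1 = size x -> wdg z = wdg x -> F z = F' z) ->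
  merge_sum x F = merge_sum x F'.
Proof.
elim: x F F' => // a [|b y] // IH F F' H; rewrite !merge_sum2 H; last first.
- by rewrite !wE dgM addnA.
- by [].
congr (_ - _); apply: IH => z Hs Hd; apply: H; first by rewrite /= Hs.
by rewrite wdg_cons Hd.
Qed.
Lemma merge_sum_ext x F F' : F =1 F' -> merge_sum x F = merge_sum x F'.
Proof.
elim: x F F' => // a [|b y] // IH F F' H; rewrite !merge_sum2 H; congr (_ - _).
by apply: IH => z; apply: H.
Qed.
Lemma merge_sumD x F F' : merge_sum x (fun z => F z + F' z) = merge_sum x F + merge_sum x F'.
Proof.
elim: x F F' => [|a [|b y] IH] F F'; rewrite ?addr0 //.
by rewrite !merge_sum2 IH opprD addrACA.
Qed.
Lemma merge_sumZ x (c : k) F : merge_sum x (fun z => c *: F z) = c *: merge_sum x F.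
Proof.
elim: x F => [|a [|b y] IH] F; rewrite ?scaler0 //.
by rewrite !merge_sum2 IH scalerBr.
Qed.
Lemma merge_sumN x F : merge_sum x (fun z => - F z) = - merge_sum x F.
Proof.
by rewrite -scaleN1r -merge_sumZ; apply: merge_sum_ext => z; rewrite scaleN1r.
Qed.
Lemma merge_sumB x F F' : merge_sum x (fun z => F z - F' z) = merge_sum x F - merge_sum x F'.
Proof. by rewrite merge_sumD merge_sumN. Qed.
Lemma merge_sum_lin x (L : {linear M -> M}) F :
  merge_sum x (fun z => L (F z)) = L (merge_sum x F).
Proof.
elim: x F => [|a [|b y] IH] F; rewrite ?linear0 //.
by rewrite !merge_sum2 IH linearB.
Qed.
Lemma merge_sum_sum x (I : Type) (s : seq I) (H : I -> seq T -> M) :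
  merge_sum x (fun z => \sum_(i <- s) H i z) = \sum_(i <- s) merge_sum x (H i).
Proof.
elim: s => [|i s IHs].
  rewrite big_nil -[RHS](scale0r (merge_sum x (fun=> 0))) -merge_sumZ.
  by apply: merge_sum_ext => z; rewrite big_nil scaler0.
rewrite big_cons -IHs -merge_sumD.
by apply: merge_sum_ext => z; rewrite big_cons.
Qed.
Lemma merge_sum_rcons x e c F : merge_sum (rcons (rcons x e) c) F =
  merge_sum (rcons x e) (fun z => F (rcons z c))
  + (-1) ^+ size x *: F (rcons x (mul e c)).
Proof.
elim: x F => [|a x IHx] F; first by rewrite /= subr0 add0r scale1r.
case: x IHx => [|b x] IHx.
  rewrite /= !subr0 expr1 scaleN1r; congr (_ + _).
rewrite !rcons_cons !merge_sum2 -!rcons_cons IHx opprD -!addrA; congr (_ + _).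
by rewrite /= !exprS !mulN1r !scaleNr opprK.
Qed.

(** [G1 a c] is the half of [G (mul a c)] in which the operation of [G] falls on the factor [a]; the
    other half appears when [c] is the marked letter. *)
Definition nabla G (G1 : T -> T -> seq T -> M) : T -> seq T -> M := fun a z =>
  (if z is c :: z' then G1 a c z' else 0) - merge_sum z (G a).

Definition swaps F := forall u e c w, F (u ++ mul e c :: w) =
  (-1) ^+ (dg e * dg c) *: F (u ++ mul c e :: w).

Lemma snoc_arg_swap G a z (e c : T) : swaps (G a) ->
  snoc_arg (mul e c) G a z = (-1) ^+ (dg e * dg c) *: snoc_arg (mul c e) G a z.
Proof. by move=> H; rewrite /snoc_arg -!cats1 H. Qed.

Lemma nabla_snoc G (G1 : T -> T -> seq T -> M) c a e z :
  snoc_arg c (nabla G G1) a (rcons z e) =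
    nabla (snoc_arg c G) (fun a b z => G1 a b (rcons z c)) a (rcons z e)
    - (-1) ^+ size z *: snoc_arg (mul e c) G a z.
Proof.
rewrite /snoc_arg /nabla merge_sum_rcons opprD addrA; congr (_ - _ - _).
by case: z.
Qed.

(** Merging before the transposed bracketing equals merging after it. A product that contains the
    marked letter is divided by the derivation rule, and products at the ends of the word are
    matched by commutativity. The induction removes an end letter through [dynkin_ends]. *)
Lemma merge_sum_dynkin G (G1 : T -> T -> seq T -> M) x :
  (forall a b z, G (mul a b) z =
     G1 a b z + (-1) ^+ (dg a * dg b) *: G1 b a z) ->
  (forall a, swaps (G a)) ->
  merge_sum x (dynkin G) = dynkin (nabla G G1) x.
Proof.
have [n] := ubnP (size x); elim: n x G G1 => // n IHn x G G1.
case: x => [|b x] //; rewrite ltnS => Hn HG HC.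
case/lastP: x Hn => [|x c] Hn; first by rewrite dynkin1 /nabla /= subr0.
case: x Hn => [|b2 y] Hn.
  rewrite /= subr0 dynkin1 HG (dynkin_ends _ _ _ [::]) /= !dynkin1 /snoc_arg /nabla /= !subr0.
  by rewrite -scaleNr; congr (_ + _ *: _); rewrite sg11 opprK.
set x := b2 :: y.
have [x0 [e Ee]] : exists x0 e, x = rcons x0 e.
  by exists (belast b2 y), (last b2 y); rewrite /x lastI.
have sx0 : size x = (size x0).+1 by rewrite Ee size_rcons.
have sx : size x = (size y).+1 by [].
(* With the last argument fixed to [d] the induction hypothesis applies; what it misses is the
   merging of [d] with its neighbour, in turn expanded at both ends. *)
have ER d f v e' : size v = size y ->
    dynkin (snoc_arg d (nabla G G1)) (f :: rcons v e') =
    merge_sum (f :: rcons v e') (dynkin (snoc_arg d G))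
    - (-1) ^+ (size y) *: (dynkin (snoc_arg (mul e' d) G) (f :: v)
      - sg [:: f] (rcons v e') *: dynkin (snoc_arg (mul f d) G) (rcons v e')).
  move=> sv; pose G1d a b z := G1 a b (rcons z d).
  have -> : merge_sum (f :: rcons v e') (dynkin (snoc_arg d G))
            = dynkin (nabla (snoc_arg d G) G1d) (f :: rcons v e').
    apply: IHn.
  - by rewrite /= size_rcons sv; move: Hn; rewrite /= size_rcons.
  - by move=> a b' z; rewrite /snoc_arg HG.
  - by move=> a u e1 c1 w; rewrite /snoc_arg -!cats1 -!catA !cat_cons HC.
  pose L a z := on_last (fun e1 => snoc_arg (mul e1 d) G a) z.
  transitivity (dynkin (nabla (snoc_arg d G) G1d) (f :: rcons v e')
                - (-1) ^+ size y *: dynkin L (f :: rcons v e')).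
    rewrite -dynkinZ -dynkinB; apply: dynkin_eq => a z; case/lastP: z => [|z e1].
      by rewrite /= size_rcons.
    by rewrite /= !size_rcons => -[Hz] _; rewrite nabla_snoc /L on_last_rcons Hz sv.
  have HL g w : dynkin (snoc_arg g L) w = dynkin (snoc_arg (mul g d) G) w.
    by apply: dynkin_eq => a z _ _; rewrite /snoc_arg /L on_last_rcons.
  by rewrite (dynkin_ends _ L) !HL.
(* Peeling the merged word: merging the last pair makes [mul e c] the last letter, merging the first
   pair makes [mul b b2] the first one. *)
have EL : merge_sum (b :: rcons x c) (dynkin G) =
    merge_sum (b :: x) (dynkin (snoc_arg c G))
    + (-1) ^+ (size x) *: dynkin (snoc_arg (mul e c) G) (b :: x0)
    - sg [:: mul b b2] (rcons y c) *: dynkin (snoc_arg (mul b b2) G) (rcons y c)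
    - sg [:: b] (rcons x c) *: merge_sum (rcons x c) (dynkin (snoc_arg b G)).
  pose K b w := sg [:: b] w *: dynkin (snoc_arg b G) w.
  transitivity (merge_sum (b :: rcons x c) (on_last (fun c => dynkin (snoc_arg c G)))
                - merge_sum (b :: rcons x c) (on_head K)).
    rewrite -merge_sumB; apply: merge_sum_eq => z; rewrite /= size_rcons => -[Hz] _.
    by apply: dynkin_peel; rewrite Hz.
  rewrite -[RHS]addrA; congr (_ + _).
    rewrite Ee -!rcons_cons merge_sum_rcons on_last_rcons size_rcons.
    by congr (_ + _); apply: merge_sum_eq => z _ _; rewrite on_last_rcons.
  rewrite /x rcons_cons merge_sum2 opprB addrC; congr (_ + _).
  (* Merging removes one letter and keeps the degree, which changes the sign of passing [b]. *)
  rewrite -scaleNr -merge_sumZ; apply: merge_sum_eq => z Hz Hd; rewrite /= /K; congr (_ *: _).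
  exact: sgN_size.
have E1 : dynkin (snoc_arg (mul c b) G) x = (-1) ^+ (dg b * dg c) *: dynkin (snoc_arg (mul b c) G) x.
  by rewrite -dynkinZ mulnC; apply: dynkin_eq => a z _ _; apply: snoc_arg_swap.
have E2 z : dynkin (snoc_arg (mul b2 b) G) z = (-1) ^+ (dg b * dg b2) *: dynkin (snoc_arg (mul b b2) G) z.
  by rewrite -dynkinZ mulnC; apply: dynkin_eq => a z' _ _; apply: snoc_arg_swap.
have sy : size x0 = size y by move: sx0; rewrite sx => -[].
have := ER c b x0 e sy; rewrite -Ee => ERc.
have ERb := ER b b2 y c (erefl _); rewrite -rcons_cons -/x in ERb.
have S1 : sg [:: b] (rcons x c) = - (-1) ^+ (dg b * dg b2) * sg [:: b] (rcons y c).
  by rewrite rcons_cons sg_consr sg11.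
have S2 : sg [:: mul b b2] (rcons y c)
    = - (-1) ^+ size y * sg [:: b] (rcons y c) * sg [:: b2] (rcons y c).
  by rewrite /sg !wE /= dgM !addn0 !mul1n !mulNr; sign_parity.
have S3 : sg [:: b] (rcons x c) = - (-1) ^+ (dg b * dg c) * sg [:: b] x.
  by rewrite sg_rconsr sg11 mulrC.
have Q1 : (-1) ^+ (dg b * dg c) * (-1) ^+ (dg b * dg c) = 1 :> k.
  by rewrite -expr2 sqrr_sign.
have Q2 : (-1) ^+ (dg b * dg b2) * (-1) ^+ (dg b * dg b2) = 1 :> k.
  by rewrite -expr2 sqrr_sign.
(* The terms with end letter [mul e c], [mul b b2] or [mul b c] occur twice each and match, the last
   two after exchanging factors. *)
rewrite dynkin_ends EL ERc ERb E1 E2 sx exprS mulN1r; lincomb; try by ring.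
- by rewrite S1 S2; ring: Q2.
by rewrite S3; ring: Q1.
Qed.

(** Vanishing on the shuffle of [b :: r] with [a :: y] trades the shuffles beginning with [a] for
    those beginning with [b]; repeating this along [r] puts the letters back in their original
    order. *)
Lemma kills_first F r a y :
  (forall x y, (0 < size x)%N -> (0 < size y)%N -> sh x y F = 0) ->
  (rho k dg r * sg r [:: a]) *: sh r y (fun z => F (a :: z)) = F (catrev r (a :: y)).
Proof.
move=> HF; rewrite -scalerA; elim: r a y => [|b r IHr] a y.
  by rewrite /= sg0 !scale1r.
rewrite /= -IHr; have := HF (b :: r) (a :: y) isT isT.
rewrite sh_cons addrC => /eqP; rewrite addr_eq0 => /eqP ->.
by rewrite !scalerA sgC; lincomb; rewrite [sg r _]sgC; ring.
Qed.

End Merge.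

(** * Operators acting letter by letter *)

Section LetterOperator.
Variables (k : fieldType) (T : Type) (dg : T -> nat) (M : lmodType k).
Variable Th : T -> seq ({linear M -> M} * T).
Implicit Types (a b c e : T) (x y z r u w : seq T) (F : seq T -> M).
Local Notation sg := (sg k dg).
Local Notation wdg := (wdg dg).
Local Notation wE := (wE dg).
Local Notation sh := (sh dg).

(* Replaces each letter in turn by [Th] of it; the coefficient map, whose
   parity is that of the change of degree of the letter, is moved in front of
   the word, past prefixed letters of total degree [n]. *)
Fixpoint letop n x F : M :=
  if x is a :: y then
    \sum_(t <- Th a) (-1) ^+ ((dg t.2 + dg a) * n) *: t.1 (F (t.2 :: y))
    + letop (n + dg a) y (fun z => F (a :: z))
  else 0.

Lemma letop_cons n a y F : letop n (a :: y) F =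
  \sum_(t <- Th a) (-1) ^+ ((dg t.2 + dg a) * n) *: t.1 (F (t.2 :: y))
    + letop (n + dg a) y (fun z => F (a :: z)).
Proof. by []. Qed.

Lemma letop_eq n x F F' : (forall z, size z = size x -> F z = F' z) ->
  letop n x F = letop n x F'.
Proof.
elim: x n F F' => //= a x IHx n F F' H; congr (_ + _).
  by apply: eq_bigr => t _; rewrite H.
by apply: IHx => z Hz; rewrite H //= Hz.
Qed.
Lemma letopD n x F F' :
  letop n x (fun z => F z + F' z) = letop n x F + letop n x F'.
Proof.
elim: x n F F' => [|a x IHx] n F F' /=; first by rewrite addr0.
rewrite IHx addrACA -big_split; congr (_ + _).
by apply: eq_bigr => t _; rewrite linearD scalerDr.
Qed.
Lemma letopZ n x (e : k) F : letop n x (fun z => e *: F z) = e *: letop n x F.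
Proof.
elim: x n F => [|a x IHx] n F /=; first by rewrite scaler0.
rewrite IHx scalerDr scaler_sumr; congr (_ + _).
by apply: eq_bigr => t _; rewrite linearZ !scalerA mulrC.
Qed.
Lemma letopN n x F : letop n x (fun z => - F z) = - letop n x F.
Proof.
by rewrite -scaleN1r -letopZ; apply: letop_eq => z _; rewrite scaleN1r.
Qed.
Lemma letopB n x F F' :
  letop n x (fun z => F z - F' z) = letop n x F - letop n x F'.
Proof. by rewrite letopD letopN. Qed.

Lemma letop_0 n x : letop n x (fun=> 0) = 0.
Proof.
elim: x n => //= a x IHx n; rewrite IHx addr0 big1 // => t _.
by rewrite linear0 scaler0.
Qed.
Lemma letop_eq0 n x F : (forall z, size z = size x -> F z = 0) -> letop n x F = 0.
Proof. by move=> H; rewrite -(letop_0 n x); apply: letop_eq. Qed.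

Lemma letop_rcons n x c F : letop n (rcons x c) F =
  letop n x (fun z => F (rcons z c))
  + \sum_(t <- Th c) (-1) ^+ ((dg t.2 + dg c) * (n + wdg x)) *: t.1 (F (rcons x t.2)).
Proof.
elim: x n F => [|a x IHx] n F; first by rewrite /= addr0 add0r addn0.
by rewrite rcons_cons !letop_cons IHx addrA wdg_cons addnA.
Qed.

(** Replacing a letter changes the sign of passing [b] by the parity of its coefficient map; this is
    what [b], counted as a prefixed letter, contributes. *)
Lemma letop_sg n x b F :
  letop n x (fun z => sg z [:: b] *: F z) = sg x [:: b] *: letop (n + dg b) x F.
Proof.
elim: x n F => [|a x IHx] n F /=; first by rewrite scaler0.
rewrite scalerDr scaler_sumr; congr (_ + _).
  apply: eq_bigr => t _; rewrite linearZ !scalerA; congr (_ *: _).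
  by rewrite /sg !wE /=; sign_parity.
under letop_eq => z _ do rewrite sg_cons -scalerA.
by rewrite letopZ IHx scalerA -sg_cons addnAC.
Qed.

Lemma sh_letop_cons n a x y F :
  sh x y (fun z => letop n (a :: z) F) =
  \sum_(t <- Th a) (-1) ^+ ((dg t.2 + dg a) * n) *: t.1 (sh x y (fun z => F (t.2 :: z)))
  + sh x y (fun z => letop (n + dg a) z (fun w => F (a :: w))).
Proof.
rewrite shD sh_sum; congr (_ + _).
by apply: eq_bigr => t _; rewrite shZ sh_lin.
Qed.

(** The letter replaced in a shuffle comes from one of the two words. This is why letter operators
    preserve the vanishing on shuffles. *)
Lemma sh_letop n x y F : sh x y (fun z => letop n z F) =
  letop n x (fun x' => sh x' y F)
  + letop (n + wdg x) y (fun y' => sh x y' F).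
Proof.
elim: x n y F => [|a x IHx] n y F; first by rewrite add0r addn0.
elim: y n F => [|b y IHy] n F.
  by rewrite sh0r [X in _ + X]/= addr0; apply: letop_eq => z _; rewrite sh0r.
rewrite sh_cons !sh_letop_cons IHx IHy.
have E1 : letop n (a :: x) (fun x' => sh x' (b :: y) F) =
    letop n (a :: x) (on_head (fun c z => sh z (b :: y) (fun w => F (c :: w))))
    + sg (a :: x) [:: b] *:
        letop (n + dg b) (a :: x) (fun x' => sh x' y (fun w => F (b :: w))).
  rewrite -letop_sg -letopD; apply: letop_eq => z.
  by case: z => //= c z _; rewrite sh_cons.
have E2 : letop (n + wdg (a :: x)) (b :: y) (fun y' => sh (a :: x) y' F) =
    letop (n + wdg (a :: x)) (b :: y)
      (fun y' => sh x y' (fun w => F (a :: w)))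
    + letop (n + wdg (a :: x)) (b :: y) 
      (on_head (fun c z => sg (a :: x) [:: c] *: sh (a :: x) z (fun w => F (c :: w)))).
  by rewrite -letopD; apply: letop_eq => z; case: z.
rewrite E1 E2 !letop_cons [wdg (a :: x)]wdg_cons /= letopZ !scalerDr.
have -> : \sum_(t <- Th b) (-1) ^+ ((dg t.2 + dg b) * (n + (dg a + wdg x))) *: t.1
     (sg (a :: x) [:: t.2] *: sh (a :: x) y (fun w => F (t.2 :: w))) =
   sg (a :: x) [:: b] *: \sum_(t <- Th b) (-1) ^+ ((dg t.2 + dg b) * n) *:
      t.1 (sh (a :: x) y (fun z => F (t.2 :: z))).
  rewrite scaler_sumr; apply: eq_bigr => t _; rewrite linearZ !scalerA.
  by congr (_ *: _); rewrite /sg !wE /=; sign_parity.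
rewrite [(n + dg b + (_ + _))%N]addnAC [(n + dg b + dg a)%N]addnAC !addnA.
by lincomb.
Qed.

Variable mul : T -> T -> T.
Hypothesis dgM : forall a b, dg (mul a b) = (dg a + dg b)%N.

(** The Leibniz rule is asked only under [F]: the replacements form a list of letters, and only a
    function linear in the letter turns the list into a sum. *)
Definition letop_leibniz F := forall n u a b w,
  \sum_(t <- Th (mul a b)) (-1) ^+ ((dg t.2 + dg (mul a b)) * n) *: t.1 (F (u ++ t.2 :: w)) =
  \sum_(t <- Th a) (-1) ^+ ((dg t.2 + dg a) * n) *: t.1 (F (u ++ mul t.2 b :: w))
  + \sum_(t <- Th b) (-1) ^+ ((dg t.2 + dg b) * (n + dg a)) *:
      t.1 (F (u ++ mul a t.2 :: w)).

(** A derivation of the product, acting on each letter in turn, commutes with the merging of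
    neighbours; its two Leibniz terms are its actions on the two letters merged. *)
Lemma merge_sum_letop n x F : letop_leibniz F ->
  merge_sum mul x (fun z => letop n z F) = letop n x (fun z => merge_sum mul z F).
Proof.
elim: x n F => [|a [|b y] IH] n F HF //.
  rewrite /= addr0 big1 // => t _; first by rewrite linear0 scaler0.
have Ea m : letop m (b :: y) (fun z => merge_sum mul (a :: z) F) =
    letop m (b :: y) (on_head (fun c z => F (mul a c :: z)))
    - letop m (b :: y) (fun z => merge_sum mul z (fun w => F (a :: w))).
  by rewrite -letopB; apply: letop_eq => z; case: z.
rewrite merge_sum2 [RHS]letop_cons Ea -IH; last first.
  by move=> m u; apply: (HF m (a :: u)).
rewrite [letop _ (mul a b :: y) F]letop_cons (HF n [::]).
rewrite [letop (n + _) (b :: y) (on_head _)]letop_cons /on_head.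
have EL : merge_sum mul (b :: y) (fun z => letop n (a :: z) F) =
    \sum_(t <- Th a) (-1) ^+ ((dg t.2 + dg a) * n) *: t.1 (merge_sum mul (b :: y) (fun z => F (t.2 :: z)))
    + merge_sum mul (b :: y) (fun z => letop (n + dg a) z (fun w => F (a :: w))).
  rewrite merge_sumD merge_sum_sum; congr (_ + _).
  by apply: eq_bigr => t _; rewrite merge_sumZ merge_sum_lin.
have ER : \sum_(t <- Th a) (-1) ^+ ((dg t.2 + dg a) * n) *: t.1 (merge_sum mul (t.2 :: b :: y) F)
   = \sum_(t <- Th a) (-1) ^+ ((dg t.2 + dg a) * n) *: t.1 (F (mul t.2 b :: y))
   - \sum_(t <- Th a) (-1) ^+ ((dg t.2 + dg a) * n) *: t.1 (merge_sum mul (b :: y) (fun z => F (t.2 :: z))).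
  rewrite -sumrB; apply: eq_bigr => t _.
  by rewrite merge_sum2 linearB scalerBr.
rewrite EL ER dgM !addnA /=.
by lincomb.
Qed.

End LetterOperator.

(** * Homogeneous letters *)

Section Homog.
Variables (k : fieldType) (V : lmodType k) (g : grading V).

Lemma homog0 i : homog g i 0. Proof. by rewrite /homog linear0. Qed.
Lemma homogZ i (c : k) x : homog g i x -> homog g i (c *: x).
Proof. by rewrite /homog linearZ /= => ->. Qed.
Lemma homogD i x y : homog g i x -> homog g i y -> homog g i (x + y).
Proof. by rewrite /homog linearD /= => -> ->. Qed.
Lemma homog_sum i (I : Type) (s : seq I) (P : pred I) (F : I -> V) :
  (forall j, P j -> homog g i (F j)) -> homog g i (\sum_(j <- s | P j) F j).
Proof.
move=> H; apply: (big_ind (homog g i)) => //; first exact: homog0.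
by move=> x y; apply: homogD.
Qed.
Lemma homog_proj i v : homog g i (gproj g i v).
Proof. by rewrite /homog gproj_orth eqxx. Qed.
Lemma homog_projE i j v : homog g i v -> gproj g j v = if j == i then v else 0.
Proof. by move=> H; rewrite -{1}H gproj_orth H. Qed.
End Homog.

(** * Letters, linearity in a letter, and the splitting [delta] *)

Section Letters.
Variables (k : fieldType) (A : algType k) (g : grading A) (gcaA : is_gca g).

(** The degree is part of the data, since [0] is homogeneous of every degree; signs then become
    functions of words. *)
Record letter := Letter { hd : nat; hv : A; hP : homog g hd hv }.

Lemma letter_eq (a b : letter) : hd a = hd b -> hv a = hv b -> a = b.
Proof.
case: a b => [i a ha] [j b hb] /= ij ab; case: j / ij hb => hb.
by case: b / ab hb => hb; congr Letter; apply: Prop_irrelevance.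
Qed.

Definition lmul (a b : letter) : letter := Letter (gca_mul gcaA (hP a) (hP b)).

(** Letters can be added only within one degree, so linearity is phrased through the relation
    [c = e a + b] in a common degree. *)
Definition lcomb_of (e : k) (c a b : letter) :=
  [/\ hd a = hd c, hd b = hd c & hv c = e *: hv a + hv b].

Definition lin1 (W : lmodType k) (f : letter -> W) :=
  forall e c a b, lcomb_of e c a b -> f c = e *: f a + f b.
Definition lin2 (W : lmodType k) (f : letter -> letter -> W) :=
  (forall b, lin1 (f^~ b)) /\ (forall a, lin1 (f a)).
Definition multilinear (W : lmodType k) (F : seq letter -> W) :=
  forall u w, lin1 (fun a => F (u ++ a :: w)).

Lemma lmul_lin2 (a : letter) : 
  (forall e c x y, lcomb_of e c x y -> lcomb_of e (lmul a c) (lmul a x) (lmul a y)) /\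
  (forall e c x y, lcomb_of e c x y -> lcomb_of e (lmul c a) (lmul x a) (lmul y a)).
Proof.
split=> e c x y [h1 h2 h3]; split; rewrite /= ?h1 ?h2 // h3.
  by rewrite mulrDr scalerAr.
by rewrite mulrDl scalerAl.
Qed.

Lemma lin1_scale (W : lmodType k) (f : letter -> W) e a b :
  lin1 f -> hd a = hd b -> hv a = e *: hv b -> f a = e *: f b.
Proof.
move=> fL hd_ab hv_ab.
have f0 z : hv z = 0 -> f z = 0.
  move=> z0; have := fL (-1) z z z; rewrite /lcomb_of z0 scaler0 addr0 => -> //.
  by rewrite scaleN1r addNr.
pose z := Letter (homog0 g (hd b)).
have -> : f a = e *: f b + f z by apply: fL; split => //=; rewrite hv_ab addr0.
by rewrite (f0 z) // addr0.
Qed.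

Lemma lin1_0 (W : lmodType k) (f : letter -> W) a : lin1 f -> hv a = 0 -> f a = 0.
Proof.
by move=> fL a0; rewrite (@lin1_scale _ _ 0 a a) ?scale0r ?a0 ?scaler0.
Qed.

Lemma lin1_eq (W : lmodType k) (f f' : letter -> W) : f =1 f' -> lin1 f -> lin1 f'.
Proof. by move=> E H e c a b h; rewrite -!E; apply: H. Qed.

Lemma lin1D (W : lmodType k) (f f' : letter -> W) : lin1 f -> lin1 f' ->
  lin1 (fun a => f a + f' a).
Proof.
by move=> H H' e c a b h; rewrite (H _ _ _ _ h) (H' _ _ _ _ h) scalerDr addrACA.
Qed.
Lemma lin1_lin (W W' : lmodType k) (L : {linear W -> W'}) (f : letter -> W) :
  lin1 f -> lin1 (fun a => L (f a)).
Proof. by move=> H e c a b h; rewrite (H _ _ _ _ h) linearP. Qed.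
Lemma lin1Z (W : lmodType k) (s : nat -> k) (f : letter -> W) : lin1 f ->
  lin1 (fun a => s (hd a) *: f a).
Proof.
move=> H e c a b h; have [h1 h2 _] := h.
by rewrite (H _ _ _ _ h) h1 h2 scalerDr !scalerA mulrC.
Qed.
Lemma lin1_sum (W : lmodType k) (I : Type) (s : seq I) (f : I -> letter -> W) :
  (forall i, lin1 (f i)) -> lin1 (fun a => \sum_(i <- s) f i a).
Proof.
move=> H; elim: s => [|i s IHs].
  by move=> e c a b _; rewrite !big_nil scaler0 addr0.
by move=> e c a b h; rewrite !big_cons (IHs _ _ _ _ h) (H _ _ _ _ _ h) scalerDr addrACA.
Qed.

Lemma lmulC_lin (W : lmodType k) (f : letter -> W) a b : lin1 f ->
  f (lmul a b) = (-1) ^+ (hd a * hd b) *: f (lmul b a).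
Proof.
move=> fL; apply: (lin1_scale fL) => /=; first exact: addnC.
exact: (gca_comm gcaA (hP a) (hP b)).
Qed.

Lemma multilinear_swaps (W : lmodType k) (F : seq letter -> W) :
  multilinear F -> swaps hd lmul F.
Proof. by move=> FL u e c w; apply: (lmulC_lin e c (FL u w)). Qed.

Lemma multilinear_cons (W : lmodType k) (F : seq letter -> W) a :
  multilinear F -> multilinear (fun z => F (a :: z)).
Proof. by move=> FL u w; apply: (FL (a :: u)). Qed.

(** A tensor is a list of pairs, and lists are compared only through bilinear functions, which
    avoids tensor products. The factor [deg x_i] is included in the first component. That component
    has positive degree, so the second has smaller degree than [a]: this is the source of the
    triangularity. *)
Record delta_spec (del : letter -> seq (letter * letter)) : Prop := DeltaSpec {
  delta_deg : forall a,
    all (fun t => (0 < hd t.1)%N && (hd t.1 + hd t.2 == hd a)%N) (del a);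
  delta_lin : forall (W : lmodType k) (f : letter -> letter -> W), lin2 f ->
    lin1 (fun a => \sum_(t <- del a) f t.1 t.2);
  delta_mul : forall (W : lmodType k) (f : letter -> letter -> W) a b, lin2 f ->
    \sum_(t <- del (lmul a b)) f t.1 t.2 = \sum_(t <- del a) f t.1 (lmul t.2 b)
      + (-1) ^+ (hd a * hd b) *: \sum_(t <- del b) f t.1 (lmul t.2 a);
  delta_euler : forall (W : lmodType k) (f : letter -> W) a, lin1 f ->
    \sum_(t <- del a) f (lmul t.1 t.2) = (hd a)%:R *: f a
}.

End Letters.

(** * Harrison cochains on words of letters *)

Lemma big_all_eq (V : nmodType) (I : Type) (s : seq I) (P : pred I) (F F' : I -> V) :
  all P s -> (forall i, P i -> F i = F' i) -> \sum_(i <- s) F i = \sum_(i <- s) F' i.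
Proof.
by elim: s => [|i s IHs]; rewrite ?big_nil // !big_cons => /andP[Pi Ps] H; rewrite H ?IHs.
Qed.

Section Cochains.
Variables (k : fieldType) (A : algType k) (g : grading A) (gcaA : is_gca g).
Variables (M : lmodType k) (gM : grading M).
Local Notation T := (letter g).
Local Notation dg := (@hd k A g).
Local Notation mul := (lmul gcaA).
Implicit Types (a b c : T) (x y z r u w : seq T) (F : seq T -> M).
Local Notation sg := (sg k dg).
Local Notation wdg := (wdg dg).
Local Notation wE := (wE dg).
Local Notation sh := (sh dg).
Local Notation dynkin := (dynkin dg).

Lemma multilinearD F F' : multilinear F -> multilinear F' ->
  multilinear (fun x => F x + F' x).
Proof. by move=> H H' u w; apply: lin1D. Qed.
Lemma multilinear_wdg (s : nat -> k) F : multilinear F ->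
  multilinear (fun x => s (wdg x) *: F x).
Proof.
move=> H u w e c a b h; have [h1 h2 _] := h.
by rewrite !wE h1 h2 (H u w _ _ _ _ h) scalerDr !scalerA mulrC.
Qed.
Lemma multilinear_eq F F' : F =1 F' -> multilinear F -> multilinear F'.
Proof. by move=> E H u w; apply: lin1_eq (H u w) => a. Qed.

Lemma sg_subst u a b w y : hd a = hd b -> sg (u ++ a :: w) y = sg (u ++ b :: w) y.
Proof. by move=> E; rewrite /sg !wE /= E. Qed.

Lemma multilinear_shl y F : multilinear F -> multilinear (fun x => sh x y F).
Proof.
move=> FL u w e c a b h; elim: u y F FL => [|d u IHu] y F FL /=; last first.
  elim: y F FL => [|b' y IHy] F FL; first by rewrite !sh0r (FL (d :: u) w _ _ _ _ h).
  rewrite !sh_cons IHu; last exact: multilinear_cons.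
  rewrite (IHy (fun z => F (b' :: z))); last exact: multilinear_cons.
  have [h1 h2 _] := h.
  have E v : hd v = hd c -> sg (d :: u ++ v :: w) [:: b'] = sg (d :: u ++ c :: w) [:: b'].
    by move=> hv; apply: (sg_subst (d :: u)).
  by rewrite (E a) ?(E b) //; lincomb.
elim: y F FL => [|b' y IHy] F FL; first by rewrite !sh0r (FL [::] w _ _ _ _ h).
rewrite !sh_cons (IHy (fun z => F (b' :: z))); last exact: multilinear_cons.
have -> : sh w (b' :: y) (fun z => F (c :: z)) =
   sh w (b' :: y) (fun z => e *: F (a :: z) + F (b :: z)).
  by apply: sh_ext => z; apply: (FL [::] z _ _ _ _ h).
rewrite shD shZ.
have [h1 h2 _] := h.
have E v : hd v = hd c -> sg (v :: w) [:: b'] = sg (c :: w) [:: b'].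
  exact: (sg_subst [::]).
by rewrite (E a) ?(E b) //; lincomb.
Qed.

(** Commutativity of the signed shuffle product carries multilinearity in the first word over to the
    second. *)
Lemma shC x y F : sh x y F = sg x y *: sh y x F.
Proof.
elim: x y F => [|a x IHx] y F; first by rewrite sh0l sh0r sg0 scale1r.
elim: y F => [|b y IHy] F; first by rewrite sh0l sh0r sg0r scale1r.
rewrite !sh_cons IHx IHy.
have E : sg (a :: x) (b :: y) = sg (a :: x) [:: b] * sg (a :: x) y by rewrite sg_consr.
have E' : sg (a :: x) (b :: y) * sg (b :: y) [:: a] = sg x (b :: y).
  by rewrite sg_cons [sg (b :: y) _]sgC mulrAC sgK mul1r.
by rewrite scalerDr !scalerA E' E addrC.
Qed.

Lemma multilinear_shr x F : multilinear F -> multilinear (fun y => sh x y F).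
Proof.
move=> FL; apply: (@multilinear_eq (fun y => sg x y *: sh y x F)).
  by move=> y; rewrite -shC.
move=> u w; have := multilinear_shl x FL u w => H e c a b h; have [h1 h2 _] := h.
have E v : hd v = hd c -> sg x (u ++ v :: w) = sg x (u ++ c :: w).
  by move=> hv; rewrite !(sgC _ _ x); apply: sg_subst.
by rewrite (E a) ?(E b) // (H _ _ _ _ h); lincomb.
Qed.

(** The varying letter stands after the mark, at the mark or before it; in each case the signs
    depend only on its degree. *)
Lemma multilinear_dynkin (G : T -> seq T -> M) :
  (forall a, multilinear (G a)) -> (forall z, lin1 (G^~ z)) ->
  multilinear (dynkin G).
Proof.
move=> GL1 GL2 u w e c a b h; have [h1 h2 _] := h.
pose P r a y := (rho k dg r * sg r [:: a]) *: sh r y (G a).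
have DE v : dynkin G (u ++ v :: w) = mark_sum [::] u (fun r d y => P r d (y ++ v :: w))
    + (P (rev u) v w + mark_sum [::] w (fun r d y => P (r ++ v :: rev u) d y)).
  by rewrite /dynkin mark_sum_cat /= catrevE cats0 -[v :: rev u]/([::] ++ _) mark_sum_catl.
have rhoE r v q : hd v = hd c -> rho k dg (r ++ v :: q) = rho k dg (r ++ c :: q).
  move=> hv; elim: r => [|d r IHr] /=; last rewrite IHr.
    by rewrite (sg_subst [::] [::] q hv).
  by rewrite (sgC k dg [:: d]) (sg_subst r q _ hv) -(sgC k dg [:: d]).
have E1 : mark_sum [::] u (fun r d y => P r d (y ++ c :: w)) =
    e *: mark_sum [::] u (fun r d y => P r d (y ++ a :: w))
    + mark_sum [::] u (fun r d y => P r d (y ++ b :: w)).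
  rewrite -mark_sumZ -mark_sumD; apply: mark_sum_eq => r d y _; rewrite /P.
  by rewrite (multilinear_shr r (GL1 d) y w h); lincomb.
have E2 : P (rev u) c w = e *: P (rev u) a w + P (rev u) b w.
  have S v : hd v = hd c -> sg (rev u) [:: v] = sg (rev u) [:: c].
    by move=> hv; rewrite !(sgC k dg (rev u)); apply: (sg_subst [::] [::]).
  rewrite /P (S a) ?(S b) //.
  have -> : sh (rev u) w (G c) = sh (rev u) w (fun z => e *: G a z + G b z).
    by apply: sh_ext => z; apply: (GL2 z _ _ _ _ h).
  by rewrite shD shZ; lincomb.
have E3 : mark_sum [::] w (fun r d y => P (r ++ c :: rev u) d y) =
    e *: mark_sum [::] w (fun r d y => P (r ++ a :: rev u) d y)
    + mark_sum [::] w (fun r d y => P (r ++ b :: rev u) d y).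
  rewrite -mark_sumZ -mark_sumD; apply: mark_sum_eq => r d y _; rewrite /P.
  rewrite (multilinear_shl y (GL1 d) r (rev u) h).
  by rewrite !(rhoE _ a, rhoE _ b, sg_subst r _ _ h1, sg_subst r _ _ h2) //; lincomb.
by rewrite !DE E1 E2 E3; lincomb.
Qed.

Lemma homog_sh d x y F :
  (forall z, size z = (size x + size y)%N -> wdg z = (wdg x + wdg y)%N ->
     homog gM d (F z)) ->
  homog gM d (sh x y F).
Proof.
elim: x y F => [|a x IHx] y F H; first by rewrite sh0l; apply: H.
elim: y F H => [|b y IHy] F H; first by rewrite sh0r; apply: H; rewrite ?wE ?addn0.
rewrite sh_cons; apply: homogD; last apply: homogZ.
  by apply: IHx => z Hs Hd; apply: H; rewrite ?wdg_cons /= ?Hs ?Hd ?wdg_cons /=; ring.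
by apply: IHy => z Hs Hd; apply: H; rewrite ?wdg_cons /= ?Hs ?Hd ?wdg_cons /=; ring.
Qed.

Lemma homog_dynkin d (G : T -> seq T -> M) x :
  (forall a z, (size z).+1 = size x -> (dg a + wdg z)%N = wdg x ->
     homog gM d (G a z)) -> homog gM d (dynkin G x).
Proof.
move=> H; suff Hz r : 
    (forall a z, (size z).+1 = (size r + size x)%N ->
       (dg a + wdg z)%N = (wdg r + wdg x)%N -> homog gM d (G a z)) ->
    homog gM d (mark_sum r x (fun r a y => (rho k dg r * sg r [:: a]) *: sh r y (G a))).
  by apply: Hz.
elim: {H} x r => [|a x IHx] r H /=; first exact: homog0.
apply: homogD.
  apply/homogZ/homog_sh => z Hs Hd.
  by apply: H; rewrite ?Hs ?Hd ?wdg_cons /=; ring.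
by apply: IHx => b z Hs Hd; apply: H; rewrite ?Hs ?Hd ?wdg_cons /=; ring.
Qed.

Definition has_scalar x := has (fun a => dg a == 0%N) x.

(** Written as a weight, the presence of a scalar letter passes to all shuffles. *)
Lemma has_scalarE x : has_scalar x = (0 < wt (fun a => dg a == 0%N) x)%N.
Proof.
rewrite /has_scalar /wt; elim: x => //= a x ->.
by case: (dg a == 0%N).
Qed.

(** [is_Ch] on words of homogeneous letters, with the recursive [sh] in place of shuffle
    permutations; [lcochain_restr] and [is_Ch_extend] translate between the two. *)
Record lcochain (p m : nat) F : Prop := LCochain {
  lc_supp : forall x, size x != m -> F x = 0;
  lc_lin : multilinear F;
  lc_deg : forall x, homog gM (p + wdg x) (F x);
  lc_norm : forall x, has_scalar x -> F x = 0;
  lc_shuffle : forall x y, (0 < size x)%N -> (0 < size y)%N -> sh x y F = 0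
}.

Lemma lcochainD p m F F' : lcochain p m F -> lcochain p m F' ->
  lcochain p m (fun x => F x + F' x).
Proof.
move=> [f1 f2 f3 f4 f5] [g1 g2 g3 g4 g5]; split=> [x hx||x|x hx|x y hx hy].
- by rewrite f1 // g1 // addr0.
- exact: multilinearD.
- exact: homogD.
- by rewrite f4 // g4 // addr0.
by rewrite shD f5 // g5 // addr0.
Qed.

Lemma lcochain_wdg (s : nat -> k) p m F : lcochain p m F ->
  lcochain p m (fun x => s (wdg x) *: F x).
Proof.
move=> [f1 f2 f3 f4 f5]; split=> [x hx||x|x hx|x y hx hy].
- by rewrite f1 // scaler0.
- exact: multilinear_wdg.
- exact: homogZ.
- by rewrite f4 // scaler0.
have -> : sh x y (fun z => s (wdg z) *: F z) = s (wdg x + wdg y)%N *: sh x y F.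
  by rewrite -shZ; apply: sh_eq_size => z _ ->.
by rewrite f5 // scaler0.
Qed.

Lemma lcochain0 p m : lcochain p m (fun=> 0).
Proof.
split=> // [u w e c a b _|x|x y _ _]; first by rewrite scaler0 addr0.
  exact: homog0.
exact: sh_0.
Qed.

End Cochains.

(** * Letter operators on Harrison cochains *)

Section CochainOperator.
Variables (k : fieldType) (A : algType k) (g : grading A) (gcaA : is_gca g).
Variables (M : lmodType k) (gM : grading M).
Local Notation T := (letter g).
Local Notation dg := (@hd k A g).
Local Notation mul := (lmul gcaA).
Implicit Types (a b c : T) (x y z r u w : seq T) (F : seq T -> M).
Local Notation wdg := (wdg dg).
Local Notation wE := (wE dg).

Variable Th : T -> seq ({linear M -> M} * T).
Local Notation thsum n a f :=
  (\sum_(t <- Th a) (-1) ^+ ((dg t.2 + dg a) * n) *: t.1 (f t.2)).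
Variable s : nat.
Hypothesis Th_lin : forall n (f : T -> M), lin1 f -> lin1 (fun a => thsum n a f).
Hypothesis Th_deg : forall n a j (f : T -> M),
  (forall b, homog gM (j + dg b) (f b)) -> homog gM (j + s + dg a) (thsum n a f).
Hypothesis Th_norm : forall n a (f : T -> M), lin1 f ->
  dg a = 0%N -> (forall b, dg b = 0%N -> f b = 0) -> thsum n a f = 0.

Lemma multilinear_letop n F : multilinear F -> multilinear (fun x => letop dg Th n x F).
Proof.
move=> FL u w; elim: u n F FL => [|d u IHu] n F FL e c a b h; last first.
  rewrite /= (IHu _ (fun z => F (d :: z)) _ _ _ _ _ h); last exact: multilinear_cons.
  have -> : thsum n d (fun b => F (b :: u ++ c :: w)) =
     e *: thsum n d (fun b => F (b :: u ++ a :: w)) +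
     thsum n d (fun b' => F (b' :: u ++ b :: w)).
    rewrite scaler_sumr -big_split; apply: eq_bigr => t _ /=.
    by rewrite (FL (t.2 :: u) w _ _ _ _ h) linearP scalerDr !scalerA mulrC.
  by lincomb.
have [h1 h2 _] := h.
rewrite /= (Th_lin n (FL [::] w) h) /= h1 h2.
have -> : letop dg Th (n + dg c) w (fun z => F (c :: z)) =
    letop dg Th (n + dg c) w (fun z => e *: F (a :: z) + F (b :: z)).
  by apply: letop_eq => z _; apply: (FL [::] z _ _ _ _ h).
by rewrite letopD letopZ; lincomb.
Qed.

Lemma homog_letop n x F d :
  (forall z, size z = size x -> homog gM (d + wdg z) (F z)) ->
  homog gM (d + s + wdg x) (letop dg Th n x F).
Proof.
elim: x n F d => [|a x IHx] n F d H /=; first exact: homog0.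
apply: homogD.
  have -> : (d + s + wdg (a :: x) = d + wdg x + s + dg a)%N by rewrite wdg_cons; ring.
  apply: (@Th_deg n a (d + wdg x)%N (fun b => F (b :: x))) => b.
  have -> : (d + wdg x + dg b = d + wdg (b :: x))%N by rewrite wdg_cons; ring.
  exact: H.
have -> : (d + s + wdg (a :: x) = d + dg a + s + wdg x)%N by rewrite wdg_cons; ring.
apply: IHx => z Hz.
have -> : (d + dg a + wdg z = d + wdg (a :: z))%N by rewrite wdg_cons; ring.
by apply: H; rewrite /= Hz.
Qed.

Lemma letop_norm n x F : multilinear F ->
  (forall z, has_scalar z -> F z = 0) -> has_scalar x -> letop dg Th n x F = 0.
Proof.
elim: x n F => [|a x IHx] n F FL HF //= /orP[/eqP a0|hx].
  rewrite (Th_norm n (FL [::] x) a0); last first.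
    by move=> b /eqP b0; apply: HF; rewrite /has_scalar /= b0.
  rewrite add0r letop_eq0 // => z _.
  by rewrite HF // /has_scalar /= a0.
rewrite big1 => [|t _]; last by rewrite HF ?linear0 ?scaler0 // /has_scalar /= [has _ x]hx orbT.
rewrite add0r IHx //; first exact: multilinear_cons.
by move=> z hz; apply: HF; rewrite /has_scalar /= [has _ z]hz orbT.
Qed.

Lemma lcochain_letop p m F : lcochain gM p m F ->
  lcochain gM (p + s) m (fun x => letop dg Th 0 x F).
Proof.
move=> [f1 f2 f3 f4 f5]; split=> [x hx||x|x hx|x y hx hy].
- by apply: letop_eq0 => z Hz; apply: f1; rewrite Hz.
- exact: multilinear_letop.
- by apply: homog_letop => z _; apply: f3.
- exact: letop_norm.
rewrite sh_letop -[RHS](addr0 0); congr (_ + _).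
  by apply: letop_eq0 => z Hz; apply: f5; rewrite ?Hz.
by apply: letop_eq0 => z Hz; apply: f5; rewrite ?Hz.
Qed.

End CochainOperator.

(** * The contracting homotopy *)

Section Differential.
Variables (k : fieldType) (A : algType k) (g : grading A) (gcaA : is_gca g).
Variables (M : lmodType k) (gM : grading M).
Local Notation T := (letter g).
Local Notation dg := (@hd k A g).
Local Notation mul := (lmul gcaA).
Implicit Types (a b c : T) (x y z r u w : seq T) (F : seq T -> M).
Local Notation sg := (sg k dg).
Local Notation wdg := (wdg dg).
Local Notation wE := (wE dg).
Local Notation dynkin := (dynkin dg).
Local Notation sh := (sh dg).

Variable act : T -> {linear M -> M}.
Hypothesis act_lin : forall q, lin1 (fun a => act a q).
Hypothesis actM : forall a b q, act (mul a b) q = act a (act b q).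
Hypothesis act_deg : forall a j q, homog gM j q -> homog gM (j + dg a) (act a q).

Lemma actC a b q : act a (act b q) = (-1) ^+ (dg a * dg b) *: act b (act a q).
Proof. by rewrite -!actM (lmulC_lin gcaA a b (act_lin q)). Qed.

Definition alpha F := on_head (fun a y => act a (F y)).
Definition omega F := on_last (fun c y => sg y [:: c] *: act c (F y)).
(* For a symmetric bimodule the two end terms of the bar differential are the
   first and the last letter, each moved with its sign to the front. *)
Definition bar_diff F x := alpha F x - merge_sum mul x F - omega F x.

Lemma omega_rcons F x c : omega F (rcons x c) = sg x [:: c] *: act c (F x).
Proof. exact: on_last_rcons. Qed.

Lemma bar_diff_eq x F F' :
  (forall z, (size z).+1 = size x -> (wdg z <= wdg x)%N -> F z = F' z) ->
  bar_diff F x = bar_diff F' x.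
Proof.
move=> H; rewrite /bar_diff; congr (_ - _ - _).
- by case: x H => //= a x H; rewrite H // wdg_cons leq_addl.
- by apply: (merge_sum_eq (dg := dg)) => // z Hz Hd; apply: H; rewrite ?Hd.
case/lastP: x H => // x c H; rewrite !omega_rcons H ?size_rcons //.
by rewrite wdg_rcons leq_addr.
Qed.
Lemma bar_diffB x F F' : bar_diff (fun z => F z - F' z) x = bar_diff F x - bar_diff F' x.
Proof.
rewrite /bar_diff merge_sumB; case/lastP: x => [|x c]; first by rewrite /= !subr0.
rewrite !omega_rcons !linearB; case: x => [|a x] /=; rewrite !linearB.
all: by lincomb.
Qed.

Lemma bar_diffZ x (e : k) F : bar_diff (fun z => e *: F z) x = e *: bar_diff F x.
Proof.
rewrite /bar_diff merge_sumZ !scalerBr; congr (_ - _ - _).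
  by case: x => [|a x] /=; rewrite ?scaler0 // linearZ.
case/lastP: x => [|x c]; first by rewrite /= scaler0.
by rewrite !omega_rcons [act c (_ *: _)]linearZ /= !scalerA mulrC.
Qed.
Lemma bar_diff_eq0 x F :
  (forall z, (size z).+1 = size x -> (wdg z <= wdg x)%N -> F z = 0) ->
  bar_diff F x = 0.
Proof.
move=> H; rewrite (bar_diff_eq (F' := fun z => F z - F z)) ?bar_diffB ?subrr //.
by move=> z Hs Hd; rewrite !H // subrr.
Qed.

(** * The homotopy built from [delta] and the inversion of the Euler operator *)

Section Homotopy.
Hypothesis char0 : [pchar k] =i pred0.
Variable del : T -> seq (T * T).
Hypothesis delP : delta_spec gcaA del.

Definition delta_op a : seq ({linear M -> M} * T) := [seq (act t.1, t.2) | t <- del a].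

(** As the degrees of [t.1] and [t.2] add up to that of [a], the parity used by [letop] is the
    degree of [t.1]. *)
Lemma delta_opE n a (f : T -> M) :
  \sum_(t <- delta_op a) (-1) ^+ ((dg t.2 + dg a) * n) *: t.1 (f t.2) =
  \sum_(t <- del a) (-1) ^+ (dg t.1 * n) *: act t.1 (f t.2).
Proof.
rewrite /delta_op big_map; apply: big_all_eq (delta_deg delP a) _ => t /andP[_ /eqP <-].
by congr (_ *: _); sign_parity.
Qed.

Lemma lin2_act n (f : T -> M) : lin1 f ->
  lin2 (fun v b => (-1) ^+ (dg v * n) *: act v (f b)).
Proof.
move=> fL; split=> [b|v].
  by apply: (lin1Z (fun i => (-1) ^+ (i * n))); apply: act_lin.
move=> e c a b h; rewrite (fL _ _ _ _ h) linearP scalerDr !scalerA.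
by rewrite mulrC.
Qed.

Lemma delta_op_lin n (f : T -> M) : lin1 f ->
  lin1 (fun a => \sum_(t <- delta_op a) (-1) ^+ ((dg t.2 + dg a) * n) *: t.1 (f t.2)).
Proof.
move=> fL; apply: lin1_eq (delta_lin delP (lin2_act n fL)) => a.
by rewrite delta_opE.
Qed.

Lemma delta_op_deg n a j (f : T -> M) : (forall b, homog gM (j + dg b) (f b)) ->
  homog gM (j + 0 + dg a)
    (\sum_(t <- delta_op a) (-1) ^+ ((dg t.2 + dg a) * n) *: t.1 (f t.2)).
Proof.
move=> H; rewrite delta_opE.
have -> : \sum_(t <- del a) (-1) ^+ (dg t.1 * n) *: act t.1 (f t.2) =
   \sum_(t <- del a | (dg t.1 + dg t.2 == dg a)%N) (-1) ^+ (dg t.1 * n) *: act t.1 (f t.2).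
  rewrite [RHS]big_mkcond; apply: big_all_eq (delta_deg delP a) _ => t /andP[_ ->].
  by [].
apply: homog_sum => t /eqP <-; apply: homogZ.
have -> : (j + 0 + (dg t.1 + dg t.2) = j + dg t.2 + dg t.1)%N by ring.
exact: act_deg.
Qed.

Lemma del_nil a : dg a = 0%N -> del a = [::].
Proof.
move=> a0; have := delta_deg delP a; case: (del a) => //= t s /andP[/andP[h1 h2] _].
by move: h1 h2; rewrite a0 addn_eq0 => /lt0n_neq0 /negPf ->.
Qed.

Lemma delta_op_norm n a (f : T -> M) : lin1 f -> dg a = 0%N ->
  (forall b, dg b = 0%N -> f b = 0) ->
  \sum_(t <- delta_op a) (-1) ^+ ((dg t.2 + dg a) * n) *: t.1 (f t.2) = 0.
Proof. by move=> _ a0 _; rewrite delta_opE del_nil // big_nil. Qed.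

Lemma del_leibniz F : multilinear F -> letop_leibniz dg delta_op mul F.
Proof.
move=> FL n u a b w; have FL1 := FL u w.
rewrite (delta_opE n (mul a b) (fun c => F (u ++ c :: w))).
rewrite (delta_opE n a (fun c => F (u ++ mul c b :: w))).
rewrite (delta_opE (n + dg a) b (fun c => F (u ++ mul a c :: w))).
rewrite (delta_mul delP a b (lin2_act n FL1)); congr (_ + _).
rewrite scaler_sumr; apply: big_all_eq (delta_deg delP b) _ => t /andP[_ /eqP <-].
rewrite /= (lmulC_lin gcaA t.2 a FL1) [act _ _]linearZ !scalerA; congr (_ *: _).
by sign_parity.
Qed.

(** Commutativity moves [a] past the coefficients of the splitting, with the sign that [a] causes as
    a prefixed letter. *)
Lemma letop_act n a x F :
  letop dg delta_op (n + dg a) x (fun z => act a (F z)) = act a (letop dg delta_op n x F).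
Proof.
elim: x n F => [|b x IHx] n F; first by rewrite /= linear0.
rewrite !letop_cons addnAC IHx linearD linear_sum; congr (_ + _).
rewrite (delta_opE _ b (fun c => act a (F (c :: x)))).
transitivity (\sum_(t <- del b) (-1) ^+ (dg t.1 * n) *: act a (act t.1 (F (t.2 :: x)))).
  apply: eq_bigr => t _; rewrite actC scalerA; congr (_ *: _); by sign_parity.
rewrite /delta_op big_map; apply: big_all_eq (delta_deg delP b) _ => t /andP[_ /eqP <-] /=.
by rewrite [act _ (_ *: _)]linearZ; congr (_ *: _); sign_parity.
Qed.

Lemma euler_act a q : \sum_(t <- del a) act t.1 (act t.2 q) = (dg a)%:R *: act a q.
Proof.
rewrite -(delta_euler delP a (act_lin q)).
by apply: eq_bigr => t _; rewrite actM.
Qed.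

(** Splitting the acting letter itself returns its degree; this extra term accounts for the degree
    that the letter adds to the arguments. *)
Lemma letop_alpha a y F : letop dg delta_op 0 (a :: y) (alpha F) =
  (dg a)%:R *: act a (F y) + act a (letop dg delta_op 0 y F).
Proof.
rewrite letop_cons (delta_opE 0 a (fun c => alpha F (c :: y))) letop_act -euler_act.
by congr (_ + _); apply: eq_bigr => t _; rewrite muln0 scale1r.
Qed.

Lemma letop_omega y c F : letop dg delta_op 0 (rcons y c) (omega F) =
  sg y [:: c] *: ((dg c)%:R *: act c (F y) + act c (letop dg delta_op 0 y F)).
Proof.
rewrite letop_rcons (delta_opE _ c (fun b => omega F (rcons y b))) addrC scalerDr.
congr (_ + _).
  rewrite -euler_act scaler_sumr; apply: big_all_eq (delta_deg delP c) _ => t /andP[_ /eqP E].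
  rewrite omega_rcons [act _ _]linearZ scalerA; congr (_ *: _).
  by rewrite /sg !wE /= -E; sign_parity.
rewrite -letop_act -letop_sg; apply: letop_eq => z _.
by rewrite omega_rcons.
Qed.

(** The operator [P] of the overview. *)
Definition euler_op F x := (wdg x)%:R *: F x - letop dg delta_op 0 x F.

(** The inner terms commute because [delta] is a derivation; at the ends, the degree of the acting
    letter cancels against the term found in [letop_alpha] and [letop_omega]. *)
Lemma euler_op_bar_diff F x : multilinear F -> euler_op (bar_diff F) x = bar_diff (euler_op F) x.
Proof.
move=> FL; rewrite /euler_op [in LHS]/bar_diff !letopB.
have -> : letop dg delta_op 0 x (fun z => merge_sum mul z F)
    = merge_sum mul x (fun z => letop dg delta_op 0 z F).
  by rewrite -(merge_sum_letop (dg := dg)) //; apply: del_leibniz.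
rewrite [in RHS]/bar_diff merge_sumB.
have -> : merge_sum mul x (fun z => (wdg z)%:R *: F z) = (wdg x)%:R *: merge_sum mul x F.
  by rewrite -merge_sumZ; apply: (merge_sum_eq (dg := dg)) => // z _ ->.
have EA y : alpha (fun z => (wdg z)%:R *: F z - letop dg delta_op 0 z F) y =
    (wdg y)%:R *: alpha F y - letop dg delta_op 0 y (alpha F).
  case: y => [|a y]; first by rewrite /= scaler0 subr0.
  rewrite letop_alpha /= wdg_cons natrD [act a _]linearB [act a (_ *: _)]linearZ /=; by lincomb.
have EO y : omega (fun z => (wdg z)%:R *: F z - letop dg delta_op 0 z F) y =
    (wdg y)%:R *: omega F y - letop dg delta_op 0 y (omega F).
  case/lastP: y => [|y c]; first by rewrite /= scaler0 subr0.
  rewrite letop_omega !omega_rcons wdg_rcons natrD [act c _]linearB [act c (_ *: _)]linearZ /=; by lincomb.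
rewrite EA EO; lincomb.
Qed.

(** The operator [H] of the overview: the marked letter comes to the front already split in two, so
    the arity of the cochain drops by one. *)
Definition contraction F := dynkin (fun a z => \sum_(t <- del a) F (t.1 :: t.2 :: z)).

(** In [H del], the actions of the last letter rebuild the end terms of [del H], and the inner
    merges rebuild its inner part; what remains is the action of [t.1], and the merging of [t.1]
    with [t.2], which gives back the degree. *)
Lemma homotopy F x : multilinear F ->
  (forall x y, (0 < size x)%N -> (0 < size y)%N -> sh x y F = 0) ->
  (1 < size x)%N -> bar_diff (contraction F) x + contraction (bar_diff F) x = - euler_op F x.
Proof.
move=> FL FS Hx.
pose G a z := \sum_(t <- del a) F (t.1 :: t.2 :: z).
pose G1 a b z := \sum_(t <- del a) F (t.1 :: mul t.2 b :: z).
have FL2 z : lin2 (fun v b => F (v :: b :: z)).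
  split=> [b|a]; first exact: (FL [::] (b :: z)).
  exact: (FL [:: a] z).
have GM a b z : G (mul a b) z = G1 a b z + (-1) ^+ (dg a * dg b) *: G1 b a z.
  exact: (delta_mul delP a b (FL2 z)).
have GS a : swaps dg mul (G a).
  move=> u e c w; rewrite /G scaler_sumr; apply: eq_bigr => t _.
  exact: (multilinear_swaps gcaA FL (t.1 :: t.2 :: u)).
pose GA a z := \sum_(t <- del a) act t.1 (F (t.2 :: z)).
pose GO a z := on_last (fun c z' => sg (a :: z') [:: c] *: act c (G a z')) z.
(* The four groups: [t.1] acts, [t.1] merges with [t.2], a later pair merges, the last letter
   acts. *)
have E : contraction (bar_diff F) x = dynkin GA x - dynkin (fun a z => (dg a)%:R *: F (a :: z)) x
   + dynkin (nabla mul G G1) x + dynkin GO x.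
  rewrite -dynkinB -!dynkinD; apply: dynkin_eq => a z Hs _.
  case/lastP: z Hs => [|z c] Hs; first by move: Hx; rewrite -Hs.
  rewrite /GO on_last_rcons; set q := rcons z c.
  transitivity (\sum_(t <- del a) (act t.1 (F (t.2 :: q)) - F (mul t.1 t.2 :: q)
    + (on_head (fun d q' => F (t.1 :: mul t.2 d :: q')) q
       - merge_sum mul q (fun w => F (t.1 :: t.2 :: w)))
    + sg (a :: z) [:: c] *: act c (F (t.1 :: t.2 :: z)))).
    apply: big_all_eq (delta_deg delP a) _ => t /andP[_ /eqP Ht].
    (* Two letters stand in place of [a] with the same total degree; the additional letter produces
       the minus sign. *)
    have EOm : omega F (t.1 :: t.2 :: q) = - (sg (a :: z) [:: c] *: act c (F (t.1 :: t.2 :: z))).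
      rewrite /q -!rcons_cons omega_rcons -scaleNr; congr (_ *: _).
      by rewrite /sg !wE /= -Ht !addn0; sign_parity.
    rewrite /bar_diff EOm /=; case: (q) => [|d q'] /=; by lincomb.
  have Hb : merge_sum mul q (G a) = \sum_(t <- del a) merge_sum mul q (fun w => F (t.1 :: t.2 :: w)).
    exact: merge_sum_sum.
  rewrite /nabla Hb !big_split /= !sumrN -scaler_sumr -linear_sum; congr (_ - _ + _ + _).
    exact: (delta_euler delP a (FL [::] q)).
  congr (_ - _); rewrite /G1; case: (q) => //=.
  by rewrite big1.
(* By [kills_first] every mark contributes the degree of its letter times [F x]. *)
have EB : dynkin (fun a z => (dg a)%:R *: F (a :: z)) x = (wdg x)%:R *: F x.
  transitivity (mark_sum [::] x (fun r a y => (dg a)%:R *: F x)).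
    apply: mark_sum_eq => r a y /= Ex; rewrite shZ scalerA mulrC -scalerA.
    by rewrite (kills_first r a y FS) Ex.
  elim: (x) (F x) [::] => [|a y IHy] v r /=; first by rewrite scale0r.
  by rewrite IHy wdg_cons natrD scalerDl.
(* Here [kills_first] returns [t.2] to its place while [t.1] remains in front, with its Koszul
   sign. *)
have EA : dynkin GA x = letop dg delta_op 0 x F.
  transitivity (mark_sum [::] x (fun r a y => \sum_(t <- delta_op a)
      (-1) ^+ ((dg t.2 + dg a) * wdg r) *: t.1 (F (catrev r (t.2 :: y))))).
    apply: mark_sum_eq => r a y _; rewrite (delta_opE _ a (fun b => F (catrev r (b :: y)))).
    rewrite sh_sum scaler_sumr; apply: big_all_eq (delta_deg delP a) _ => t /andP[_ /eqP Ht].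
    rewrite sh_lin -(kills_first r t.2 y FS) [in RHS]linearZ /= !scalerA; congr (_ *: _).
    rewrite [RHS]mulrCA; congr (_ * _).
    by rewrite /sg !wE /= -Ht; sign_parity.
  have Hz y r : mark_sum r y (fun r a y => \sum_(t <- delta_op a)
      (-1) ^+ ((dg t.2 + dg a) * wdg r) *: t.1 (F (catrev r (t.2 :: y)))) =
      letop dg delta_op (wdg r) y (fun z => F (catrev r z)).
    elim: y r => //= a y IHy r; rewrite IHy; congr (_ + _).
    by rewrite wdg_cons addnC.
  by rewrite Hz.
(* By [dynkin_ends] the acting last letter is one of the two ends of [x]. *)
have EO : dynkin GO x = omega (contraction F) x - alpha (contraction F) x.
  case: x Hx {E EB EA} => // b x0; case/lastP: x0 => // x0 c _.
  have Gr_GO d y : dynkin (snoc_arg d GO) y = sg y [:: d] *: act d (contraction F y).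
    rewrite -dynkin_lin -dynkinZ; apply: dynkin_eq => a z Hs Hd.
    rewrite /snoc_arg /GO on_last_rcons; congr (_ *: _).
    by apply: sg_eq; rewrite // wdg_cons.
  rewrite dynkin_ends !Gr_GO -{1}rcons_cons omega_rcons; congr (_ - _); rewrite ?rcons_cons.
  by rewrite scalerA [sg (rcons _ _) _]sgC sgK scale1r.
rewrite E EB EA EO -(merge_sum_dynkin (mul := mul)) // /bar_diff /euler_op -/G.
by rewrite /contraction -/G; lincomb.
Qed.

(** The shuffle condition is [dynkin_shuffle], for any [F]. For normalization, a scalar letter is
    either marked, and then its splitting is empty, or left in the word, where [F] vanishes. *)
Lemma lcochain_contraction p m F : lcochain gM p m.+1 F -> lcochain gM p m (contraction F).
Proof.
move=> [f1 f2 f3 f4 f5]; split=> [x hx||x|x hx|x y hx hy].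
- apply: dynkin_eq0 => a z Hs _; rewrite big1 // => t _; rewrite f1 //=.
  by rewrite eqSS Hs.
- apply: multilinear_dynkin => [a|z].
    move=> u w; apply: (@lin1_sum k A g M _ _ (fun t d => F [:: t.1, t.2 & u ++ d :: w])) => t.
    exact: (f2 [:: t.1, t.2 & u] w).
  apply: (delta_lin delP (f := fun v b => F (v :: b :: z))); split=> [b|a].
    exact: (f2 [::] (b :: z)).
  exact: (f2 [:: a] z).
- apply: homog_dynkin => a z _ <-.
  have -> : \sum_(t <- del a) F [:: t.1, t.2 & z] =
     \sum_(t <- del a | (dg t.1 + dg t.2 == dg a)%N) F [:: t.1, t.2 & z].
    by rewrite [RHS]big_mkcond; apply: big_all_eq (delta_deg delP a) _ => t /andP[_ ->].
  apply: homog_sum => t /eqP <-; rewrite -addnA -!wdg_cons; exact: f3.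
- apply: mark_sum_eq0 => r a y Ex; case: (posnP (dg a)) => a0.
    rewrite sh_eq0 ?scaler0 // => z _; by rewrite del_nil // big_nil.
  rewrite sh_eq0 ?scaler0 // => z Hz; rewrite big1 // => t _.
  apply: f4; rewrite /has_scalar /= orbA orbC; apply/orP; left.
  rewrite -/(has_scalar z) has_scalarE /wt Hz; move: hx.
  rewrite has_scalarE /wt -[x]/(catrev [::] x) -Ex catrevE map_cat sumn_cat map_rev sumn_rev /=.
  by rewrite eqn0Ngt a0.
exact: dynkin_shuffle.
Qed.

(** The coefficient of a splitting has positive degree, so only words of smaller degree are
    evaluated. *)
Lemma letop_del_eq n x F F' :
  (forall z, size z = size x -> (wdg z < wdg x)%N -> F z = F' z) ->
  letop dg delta_op n x F = letop dg delta_op n x F'.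
Proof.
elim: x n F F' => // a x IHx n F F' H; rewrite !letop_cons; congr (_ + _).
  rewrite (delta_opE n a (fun b => F (b :: x))) (delta_opE n a (fun b => F' (b :: x))).
  apply: big_all_eq (delta_deg delP a) _ => t /andP[Ht /eqP Ht'].
  by rewrite H // !wdg_cons -Ht' -addnA -[X in (X < _)%N]add0n ltn_add2r.
by apply: IHx => z Hs Hd; apply: H; rewrite /= ?Hs // !wdg_cons ltn_add2l.
Qed.

(* Solves [euler_op g = h] by recursion on the total degree, bounded by [n]. *)
Fixpoint euler_inv_rec (h : seq T -> M) n x : M :=
  if n is n'.+1 then
    (wdg x)%:R^-1 *: (h x + letop dg delta_op 0 x (euler_inv_rec h n'))
  else 0.
Definition euler_inv h x := euler_inv_rec h (wdg x).+1 x.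

(** Each recursive call lowers the degree, so any bound above it gives the same value. *)
Lemma euler_inv_rec_stable h n n' x : (wdg x < n)%N -> (wdg x < n')%N ->
  euler_inv_rec h n x = euler_inv_rec h n' x.
Proof.
elim: n n' x => // n IHn [|n'] x //= Hn Hn'; congr (_ *: (_ + _)).
apply: letop_del_eq => z _ Hz; apply: IHn; exact: leq_trans Hz _.
Qed.

(** Characteristic zero makes every positive degree invertible; in degree 0 the operator is zero,
    whence the condition on [h]. *)
Lemma euler_invK h x : (wdg x = 0%N -> h x = 0) -> euler_op (euler_inv h) x = h x.
Proof.
move=> H0; rewrite /euler_op {1}/euler_inv /=.
have -> : letop dg delta_op 0 x (euler_inv_rec h (wdg x)) = letop dg delta_op 0 x (euler_inv h).
  by apply: letop_del_eq => z _ Hz; apply: euler_inv_rec_stable.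
case: (posnP (wdg x)) => [x0|x0].
  rewrite x0 scale0r sub0r H0 // (@letop_del_eq _ _ _ (fun=> 0)) ?letop_0 ?oppr0 //.
  by move=> z _; rewrite x0.
rewrite scalerA divff ?scale1r ?addrK //.
by move/pcharf0P: char0 => ->; rewrite -lt0n.
Qed.

Lemma lcochain_euler_inv p m h : lcochain gM p m h -> lcochain gM p m (euler_inv h).
Proof.
move=> hC; have recC n : lcochain gM p m (euler_inv_rec h n).
  elim: n => [|n IHn] /=; first exact: lcochain0.
  apply: (lcochain_wdg (fun d => d%:R^-1)); apply: lcochainD => //.
  rewrite -[p]addn0; apply: lcochain_letop => //.
  - exact: delta_op_lin.
  - exact: delta_op_deg.
  - exact: delta_op_norm.
(* The recursion bound depends on the word only through its degree, which linear combinations and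
   shuffles preserve, so one bound serves all words of an identity. *)
split=> [x hx|u w e c a b h3|x|x hx|x y hx hy].
- exact: (lc_supp (recC _)).
- have [h1 h2 _] := h3.
  have E v : dg v = dg c -> wdg (u ++ v :: w) = wdg (u ++ c :: w).
    by move=> hv; rewrite !wE hv.
  rewrite /euler_inv (E a) ?(E b) //.
  exact: (lc_lin (recC _) u w h3).
- exact: (lc_deg (recC _)).
- exact: (lc_norm (recC _)).
rewrite -[RHS](lc_shuffle (recC (wdg x + wdg y).+1) hx hy).
by apply: sh_eq_size => z _ Hz; rewrite /euler_inv Hz.
Qed.

(** The primitive is f = - P^(-1) H F. Then P del f = del P f = - del H F = P F, the term H del F
    being zero, so the defect del f - F lies in the kernel of P. *)
Theorem harrison_acyclic p m F : lcochain gM p m.+2 F ->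
  (forall x, bar_diff F x = 0) ->
  exists2 f, lcochain gM p m.+1 f & forall x, bar_diff f x = F x.
Proof.
move=> FC dF; have HC := lcochain_contraction FC.
pose h x := - contraction F x.
have hC : lcochain gM p m.+1 h.
  have := lcochain_wdg (fun=> -1) HC; congr lcochain.
  by apply: funext => x; rewrite scaleN1r.
have scal x : (0 < size x)%N -> wdg x = 0%N -> has_scalar x.
  by case: x => // a x _ /eqP; rewrite wdg_cons addn_eq0 /has_scalar /= => /andP[-> _].
have h0 x : wdg x = 0%N -> h x = 0.
  case: x => [_|a x x0]; first exact: (lc_supp hC).
  exact/(lc_norm hC)/scal.
exists (euler_inv h); first exact: lcochain_euler_inv.
have gC := lcochain_euler_inv hC; set f := euler_inv h in gC *.
move=> x; apply/eqP; rewrite -subr_eq0; apply/eqP.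
pose q x := bar_diff f x - F x; rewrite -/(q x).
have [hx|hx] := eqVneq (size x) m.+2; last first.
  rewrite /q (lc_supp FC) // bar_diff_eq0 ?subrr // => z Hz _.
  by apply: (lc_supp gC); apply: contra_neq hx => hz; rewrite -Hz hz.
(* On a word, P is multiplication by the degree up to words of smaller degree; hence the defect
   vanishes by induction on the degree. *)
have [n] := ubnP (wdg x); elim: n x hx => // n IHn x hx Hn.
have qP : euler_op q x = 0.
  have -> : euler_op q x = euler_op (bar_diff f) x - euler_op F x.
    by rewrite /euler_op /q letopB; lincomb.
  rewrite euler_op_bar_diff; last exact: lc_lin gC.
  have -> : bar_diff (euler_op f) x = - bar_diff (contraction F) x.
    transitivity (bar_diff (fun z => (fun=> 0) z - contraction F z) x).
      by apply: bar_diff_eq => z _ _; rewrite (euler_invK (h0 z)) /h sub0r.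
    by rewrite bar_diffB bar_diff_eq0 ?sub0r.
  rewrite -[euler_op F x]opprK -(homotopy (lc_lin FC) (lc_shuffle FC)) ?hx //.
  have -> : contraction (bar_diff F) x = 0.
    by apply: dynkin_eq0 => a z _ _; rewrite big1.
  by rewrite addr0 opprK addNr.
(* In degree 0 all letters are scalars and both cochains vanish by normalization. *)
have [x0|x0] := posnP (wdg x).
  rewrite /q (lc_norm FC) ?subr0; last by apply: scal; rewrite ?hx.
  apply: bar_diff_eq0 => z Hz; rewrite x0 leqn0 => /eqP z0.
  apply: (lc_norm gC); apply: scal => //.
  by move: Hz; rewrite hx => -[->].
move: qP; rewrite /euler_op (@letop_del_eq _ _ _ (fun=> 0)) ?letop_0 ?subr0.
  move/eqP; rewrite scaler_eq0; move/pcharf0P: char0 => ->.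
  by rewrite eqn0Ngt x0 => /eqP.
by move=> z Hz Hd; apply: IHn; rewrite ?Hz // (leq_trans Hd).
Qed.

End Homotopy.
End Differential.

(** * The derivation of a free algebra *)

Section Diagonal.
Variables (k : fieldType) (V : lmodType k) (g : grading V).

Lemma homog_ind (P : V -> Prop) : P 0 -> (forall u v, P u -> P v -> P (u + v)) ->
  (forall i v, homog g i v -> P v) -> forall v, P v.
Proof.
move=> P0 PD Ph v; have [N ->] := gproj_sum g v.
by apply: (big_ind P) => // i _; apply/(Ph i)/homog_proj.
Qed.

Lemma gproj_bound v : exists N, forall j, (N <= j)%N -> gproj g j v = 0.
Proof.
have [N vE] := gproj_sum g v; exists N => j le_j.
rewrite vE linear_sum big1 //= => i _; rewrite gproj_orth.
by case: eqP => // E; move: (ltn_ord i); rewrite -E ltnNge le_j.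
Qed.

(** A bound on the degrees present in [v], chosen classically; [diagE] and [extend_bound] replace it
    by any other bound. *)
Definition gbound v := xget 0%N [set N | forall j, (N <= j)%N -> gproj g j v = 0]%classic.
Lemma gboundP v j : (gbound v <= j)%N -> gproj g j v = 0.
Proof.
rewrite /gbound; case: xgetP => [N _ H|H]; first exact: H.
by have [N HN] := gproj_bound v; case: (H N).
Qed.

(** Koszul signs and the degree operator are both of this form, so linearity is proved once for
    all. *)
Definition diag (c : nat -> k) v := \sum_(i < gbound v) c i *: gproj g i v.

Lemma diagE c v N : (forall j, (N <= j)%N -> gproj g j v = 0) ->
  diag c v = \sum_(i < N) c i *: gproj g i v.
Proof.
move=> HN; rewrite /diag.
have aux n m : (n <= m)%N -> (forall j, (n <= j)%N -> gproj g j v = 0) ->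
    \sum_(i < n) c i *: gproj g i v = \sum_(i < m) c i *: gproj g i v.
  move=> le_nm H; rewrite (big_ord_widen m (fun i => c i *: gproj g i v)) //.
  rewrite [RHS](bigID (fun i : 'I_m => (i < n)%N)) /= [X in _ + X]big1 ?addr0 //.
  by move=> i; rewrite -leqNgt => /H ->; rewrite scaler0.
rewrite (aux (gbound v) (maxn (gbound v) N)) ?leq_maxl //; last exact: gboundP.
by rewrite -(aux N) ?leq_maxr.
Qed.

Lemma diag_linear c : linear (diag c).
Proof.
move=> e u v; pose N := maxn (gbound u) (gbound v).
rewrite !(@diagE _ _ N).
- rewrite scaler_sumr -big_split; apply: eq_bigr => i _ /=.
  by rewrite linearP scalerDr !scalerA mulrC.
- by move=> j; rewrite geq_max => /andP[_ /gboundP].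
- by move=> j; rewrite geq_max => /andP[/gboundP].
move=> j; rewrite geq_max linearP => /andP[/gboundP -> /gboundP ->].
by rewrite scaler0 addr0.
Qed.
HB.instance Definition _ c :=
  GRing.isLinear.Build k V V *:%R (diag c) (diag_linear c).

Lemma diag_homog c i v : homog g i v -> diag c v = c i *: v.
Proof.
move=> hv; rewrite (@diagE _ _ i.+1) => [|j lt_ij]; last first.
  by rewrite (homog_projE _ hv) gtn_eqF.
rewrite big_ord_recr /= hv big1 ?add0r // => j _.
by rewrite (homog_projE _ hv) ltn_eqF // scaler0.
Qed.

Lemma diag1 v : diag (fun=> 1) v = v.
Proof.
have [N vE] := gproj_sum g v; rewrite {2}vE (@diagE _ _ N).
  by apply: eq_bigr => i _; rewrite scale1r.
move=> j le_j; rewrite vE linear_sum big1 //= => i _; rewrite gproj_orth.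
by case: eqP => // E; move: (ltn_ord i); rewrite -E ltnNge le_j.
Qed.

Lemma ksignE p : ksign g p =1 diag (fun i => (-1) ^+ (p * i)).
Proof.
move=> v; rewrite /ksign /diag (fsbig_ord _ _ (fun i => (-1) ^+ (p * i) *: gproj g i v)).
apply/esym/fsbig_widen => // i [_ /negP]; rewrite /= -leqNgt => /gboundP ->.
exact: scaler0.
Qed.

End Diagonal.

(** * Sign and degree operators of a graded commutative algebra *)

Section Decomposition.
Variables (k : fieldType) (A : algType k) (g : grading A) (gcaA : is_gca g).

Definition psign p : A -> A := diag g (fun i => (-1) ^+ (p * i)).
HB.instance Definition _ p := GRing.Linear.on (psign p).
Definition gdeg : A -> A := diag g (fun i => i%:R).
HB.instance Definition _ := GRing.Linear.on gdeg.

Lemma psignM p a b : psign p (a * b) = psign p a * psign p b.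
Proof.
elim/(homog_ind (g := g)): a => [|a a' IH IH'|i a ha].
- by rewrite mul0r !linear0 mul0r.
- by rewrite mulrDl !linearD /= IH IH' mulrDl.
elim/(homog_ind (g := g)): b => [|b b' IH IH'|j b hb].
- by rewrite mulr0 !linear0 mulr0.
- by rewrite mulrDr !linearD /= IH IH' mulrDr.
rewrite /psign (diag_homog _ (gca_mul gcaA ha hb)) (diag_homog _ ha) (diag_homog _ hb).
by rewrite -scalerAl -scalerAr scalerA -exprD mulnDr.
Qed.

Lemma gdegM a b : gdeg (a * b) = gdeg a * b + a * gdeg b.
Proof.
elim/(homog_ind (g := g)): a => [|a a' IH IH'|i a ha].
- by rewrite !(mul0r, linear0, addr0).
- by rewrite mulrDl !linearD /= IH IH' !mulrDl addrACA.
elim/(homog_ind (g := g)): b => [|b b' IH IH'|j b hb].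
- by rewrite mulr0 !linear0 !mulr0 addr0.
- by rewrite mulrDr !linearD /= IH IH' !mulrDr addrACA.
rewrite /gdeg (diag_homog _ (gca_mul gcaA ha hb)) (diag_homog _ ha) (diag_homog _ hb).
by rewrite -scalerAl -scalerAr -scalerDl natrD.
Qed.

Lemma psign1 p : psign p 1 = 1.
Proof. by rewrite /psign (diag_homog _ (gca_one gcaA)) muln0 scale1r. Qed.

Lemma mul_psign i x a : homog g i x -> x * psign i a = a * x.
Proof.
move=> hx; elim/(homog_ind (g := g)): a => [|a a' IH IH'|j a ha].
- by rewrite linear0 mulr0 mul0r.
- by rewrite linearD /= mulrDr IH IH' mulrDl.
rewrite /psign (diag_homog _ ha) -scalerAr (gca_comm gcaA hx ha) scalerA.
by rewrite -expr2 sqrr_sign scale1r.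
Qed.

Lemma gprojM i n x a : homog g i x ->
  gproj g n (x * a) = if (i <= n)%N then x * gproj g (n - i) a else 0.
Proof.
move=> hx; elim/(homog_ind (g := g)): a => [|a a' IH IH'|j a ha].
- by rewrite mulr0 !linear0 mulr0 if_same.
- by rewrite mulrDr !linearD /= IH IH' mulrDr; case: ifP; rewrite ?addr0.
rewrite (homog_projE _ (gca_mul gcaA hx ha)) (homog_projE _ ha).
have [le_in|lt_ni] := leqP i n.
  by rewrite -(eqn_add2l i (n - i)) subnKC //; case: ifP; rewrite ?mulr0.
by rewrite ltn_eqF // (leq_trans lt_ni) // leq_addr.
Qed.

Lemma gproj_gdeg n a : gproj g n (gdeg a) = gdeg (gproj g n a).
Proof.
elim/(homog_ind (g := g)): a => [|a a' IH IH'|j a ha].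
- by rewrite !linear0.
- by rewrite !linearD /= IH IH'.
rewrite /gdeg (diag_homog _ ha) linearZ /= !(homog_projE _ ha).
by case: eqP => _; rewrite ?scaler0 ?linear0 // (diag_homog _ ha).
Qed.

End Decomposition.

(** * The square zero extension that carries the partial derivatives *)

Section Extension.
Variables (k : fieldType) (A : algType k) (g : grading A) (gcaA : is_gca g).
Variables (I : Type) (deg : I -> nat) (x : I -> A).
Hypothesis homx : forall i, homog g (deg i) (x i).
Local Notation cI := {classic I}.
Implicit Types (h : I -> A) (s : seq cI).

(** Finite support is witnessed by a list, over the classical choice type of [I] so that membership
    can be decided; sums over different witnesses agree by [cover_sum]. *)
Definition covers s h := forall i : cI, i \notin s -> h i = 0.
Definition euler s h := \sum_(i <- s) (deg i)%:R *: (x i * h i).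

Lemma covers_sub s s' h : {subset s <= s'} -> covers s h -> covers s' h.
Proof. by move=> ss' H i ns'; apply: H; apply: contra ns' => /ss'. Qed.

(** Both sums reduce to the common part of the two lists. *)
Lemma cover_sum (V : nmodType) (F : I -> V) s s' : uniq s -> uniq s' ->
  (forall i : cI, i \notin s -> F i = 0) -> (forall i : cI, i \notin s' -> F i = 0) ->
  \sum_(i <- s) F i = \sum_(i <- s') F i.
Proof.
move=> us us' Hs Hs'.
have aux (r r' : seq cI) : uniq r -> (forall i : cI, i \notin r' -> F i = 0) ->
   \sum_(i <- r) F i = \sum_(i <- [seq i <- r | i \in r']) F i.
  move=> ur H; rewrite big_filter [LHS](bigID (mem r')) /=.
  by rewrite [X in _ + X]big1 ?addr0 // => i /H.
rewrite (aux s s') // [RHS](aux s' s) //.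
apply: perm_big; apply: uniq_perm; rewrite ?filter_uniq // => i.
by rewrite !mem_filter andbC.
Qed.

Lemma euler_covers s s' h : uniq s -> uniq s' -> covers s h -> covers s' h ->
  euler s h = euler s' h.
Proof.
move=> us us' cs cs'; apply: (@cover_sum _ (fun i => (deg i)%:R *: (x i * h i))) => // i ni.
  by rewrite cs // mulr0 scaler0.
by rewrite cs' // mulr0 scaler0.
Qed.

(* A pair [(a, h)] stands for [a + \sum_i x_i (x) h_i] in the square zero
   extension of [A] by [V (x) A], [V] being spanned by the [x_i]; the product
   of [V (x) A] to [A] is required to send [\sum_i deg x_i x_i (x) h_i] to
   [deg a a]. *)
Definition ext_set (p : A * (I -> A)) : Prop :=
  exists s, [/\ uniq s, covers s p.2 & euler s p.2 = gdeg g p.1].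

Lemma ext_cover p s : ext_set p -> uniq s -> covers s p.2 -> euler s p.2 = gdeg g p.1.
Proof. by move=> [s' [us' cs' <-]] us cs; apply: euler_covers. Qed.

Lemma ext_common p q : ext_set p -> ext_set q ->
  exists s, [/\ uniq s, covers s p.2 & covers s q.2].
Proof.
move=> [s [us cs _]] [s' [us' cs' _]]; exists (undup (s ++ s')); split.
- exact: undup_uniq.
- by apply: covers_sub cs => i si; rewrite mem_undup mem_cat si.
by apply: covers_sub cs' => i si; rewrite mem_undup mem_cat si orbT.
Qed.

Lemma ext_set0 : ext_set 0.
Proof.
exists [::]; split => //.
by rewrite /euler big_nil /= linear0.
Qed.
Lemma ext_setP (c : k) p q : ext_set p -> ext_set q -> ext_set (c *: p + q).
Proof.
move=> ep eq; have [s [us cp cq]] := ext_common ep eq.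
have cpq : covers s (c *: p + q).2.
  by move=> i si; rewrite /= !fctE cp // cq // scaler0 addr0.
exists s; split=> //.
rewrite /= linearP /= -(ext_cover ep us cp) -(ext_cover eq us cq) /euler.
rewrite scaler_sumr -big_split; apply: eq_bigr => i _ /=.
by rewrite !fctE mulrDr scalerDr -scalerAr !scalerA mulrC.
Qed.
Definition ext_submod := Submodule ext_set0 ext_setP.

(** The two proofs are parameters of the type because the algebra structure depends on them and must
    be found from the type. *)
Definition sqz_of of is_gca g & (forall i, homog g (deg i) (x i)) := subZ ext_submod.
Local Notation sqz := (sqz_of gcaA homx).
HB.instance Definition _ := GRing.Lmodule.on sqz.

Lemma sqzP (p : sqz) : ext_set (subZ_val p).
Proof. by apply/asboolP; apply: (subZ_prop p). Qed.
Lemma ext_mem p : ext_set p -> p \in submod_pred ext_submod.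
Proof. by move=> ep; rewrite unfold_in; apply/asboolP. Qed.
Definition mk_sqz p (ep : ext_set p) : sqz := SubZ (ext_mem ep).

Lemma sqz_eq (p q : sqz) : subZ_val p = subZ_val q -> p = q.
Proof. exact: val_inj. Qed.

(** To reach the coefficient of [x_i] from the left, an element passes [x_i], hence [psign]; the
    product of two elements of V ⊗ A is zero. *)
Definition mul_raw (p q : A * (I -> A)) : A * (I -> A) :=
  (p.1 * q.1, fun i => p.2 i * q.1 + psign g (deg i) p.1 * q.2 i).

(** The degree operator is a derivation, and graded commutativity turns [x_i psign(a)] into [a x_i];
    so the Euler relation passes to products. *)
Lemma mul_rawP p q : ext_set p -> ext_set q -> ext_set (mul_raw p q).
Proof.
move=> ep eq; have [s [us cp cq]] := ext_common ep eq; exists s; split => //.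
  by move=> i si; rewrite /= cp // cq // mul0r mulr0 addr0.
rewrite /= gdegM // -(ext_cover ep us cp) -(ext_cover eq us cq) /euler.
rewrite mulr_suml mulr_sumr -big_split; apply: eq_bigr => i _ /=.
rewrite mulrDr scalerDr mulrA scalerAl; congr (_ + _).
by rewrite mulrA (mul_psign gcaA _ (homx i)) -scalerAr mulrA.
Qed.
Lemma one_rawP : ext_set (1, fun=> 0).
Proof.
exists [::]; split=> //; rewrite /euler big_nil /=.
by rewrite /gdeg (diag_homog _ (gca_one gcaA)) scale0r.
Qed.

Definition sqz_mul (p q : sqz) : sqz := mk_sqz (mul_rawP (sqzP p) (sqzP q)).
Definition sqz_one : sqz := mk_sqz one_rawP.

Lemma sqz_mulA : associative sqz_mul.
Proof.
move=> p q r; apply: sqz_eq; congr pair => /=; first exact: mulrA.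
by apply: funext => i /=; rewrite !psignM // mulrDl mulrDr !mulrA addrA.
Qed.
Lemma sqz_mul1 : left_id sqz_one sqz_mul.
Proof.
move=> p; apply: sqz_eq; case: p => -[a h] ep; congr pair => /=; first exact: mul1r.
by apply: funext => i /=; rewrite psign1 // mul0r mul1r add0r.
Qed.
Lemma sqz_mulr1 : right_id sqz_one sqz_mul.
Proof.
move=> p; apply: sqz_eq; case: p => -[a h] ep; congr pair => /=; first exact: mulr1.
by apply: funext => i /=; rewrite mulr1 mulr0 addr0.
Qed.
Lemma sqz_mulDl : left_distributive sqz_mul +%R.
Proof.
move=> p q r; apply: sqz_eq; congr pair => /=; first exact: mulrDl.
by apply: funext => i /=; rewrite !fctE linearD /= !mulrDl addrACA.
Qed.
Lemma sqz_mulDr : right_distributive sqz_mul +%R.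
Proof.
move=> p q r; apply: sqz_eq; congr pair => /=; first exact: mulrDr.
by apply: funext => i /=; rewrite !fctE !mulrDr addrACA.
Qed.
Lemma sqz_one_neq0 : sqz_one != 0.
Proof.
by apply/eqP => /(congr1 (fun p : sqz => (subZ_val p).1)) /eqP; rewrite oner_eq0.
Qed.
HB.instance Definition _ := GRing.Zmodule_isNzRing.Build sqz
  sqz_mulA sqz_mul1 sqz_mulr1 sqz_mulDl sqz_mulDr sqz_one_neq0.

Lemma sqz_scaleAl (c : k) (p q : sqz) : c *: (p * q) = (c *: p) * q.
Proof.
apply: sqz_eq; congr pair => /=; first exact: scalerAl.
by apply: funext => i /=; rewrite !fctE linearZ /= scalerDr !scalerAl.
Qed.
HB.instance Definition _ := GRing.Lmodule_isLalgebra.Build k sqz sqz_scaleAl.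
Lemma sqz_scaleAr (c : k) (p q : sqz) : c *: (p * q) = p * (c *: q).
Proof.
apply: sqz_eq; congr pair => /=; first exact: scalerAr.
by apply: funext => i /=; rewrite !fctE scalerDr !scalerAr.
Qed.
HB.instance Definition _ := GRing.Lalgebra_isAlgebra.Build k sqz sqz_scaleAr.

(** [x_i] counts with its own degree, so its coefficient is taken in degree [n - deg i]; the test
    excludes truncated subtraction. *)
Definition proj_raw n (p : A * (I -> A)) : A * (I -> A) :=
  (gproj g n p.1, fun i => if (deg i <= n)%N then gproj g (n - deg i) (p.2 i) else 0).
Lemma proj_rawP n p : ext_set p -> ext_set (proj_raw n p).
Proof.
move=> ep; have [s [us cp ecp]] := ep; exists s; split=> //.
  by move=> i si; rewrite /= cp // linear0 if_same.
rewrite /= -gproj_gdeg // -ecp /euler linear_sum; apply: eq_bigr => i _ /=.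
rewrite linearZ /= (gprojM gcaA _ _ (homx i)).
by case: ifP => _; rewrite ?mulr0.
Qed.
Definition sqz_proj n (p : sqz) : sqz := mk_sqz (proj_rawP n (sqzP p)).
Lemma sqz_proj_linear n : linear (sqz_proj n).
Proof.
move=> c p q; apply: sqz_eq; congr pair => /=; first exact: linearP.
apply: funext => i /=; rewrite !fctE.
by case: ifP => _; rewrite ?linearP // scaler0 addr0.
Qed.
HB.instance Definition _ n :=
  GRing.isLinear.Build k sqz sqz *:%R (sqz_proj n) (sqz_proj_linear n).

Lemma sqz_proj_orth i j v : sqz_proj i (sqz_proj j v) = if i == j then sqz_proj j v else 0.
Proof.
apply: sqz_eq; have -> : subZ_val (if i == j then sqz_proj j v else 0) =
   if i == j then proj_raw j (subZ_val v) else 0 by case: eqP.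
rewrite /= /proj_raw /= gproj_orth; case: eqP => [->|ij].
  congr pair; apply: funext => l; case: ifP => // lj.
  by rewrite lj gproj_orth eqxx.
congr pair; apply: funext => l; rewrite /=; case: ifP => // li.
case: ifP => lj; last by rewrite linear0.
by rewrite gproj_orth; case: eqP => // E; case: ij; rewrite -(subnK li) E subnK.
Qed.

Lemma sqz_projE n p : subZ_val (sqz_proj n p) = proj_raw n (subZ_val p).
Proof. by []. Qed.
Lemma sqz_val_sum (J : Type) (r : seq J) (F : J -> sqz) :
  subZ_val (\sum_(j <- r) F j) =
  (\sum_(j <- r) (subZ_val (F j)).1, fun i => \sum_(j <- r) (subZ_val (F j)).2 i).
Proof.
elim: r => [|j r IHr].
  by rewrite big_nil; congr pair; rewrite ?big_nil //; apply: funext => i; rewrite big_nil.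
rewrite big_cons /= [X in _ + X]IHr; congr pair; rewrite ?big_cons //.
by apply: funext => i; rewrite big_cons.
Qed.

Lemma sqz_proj_sum v : exists N, v = \sum_(i < N) sqz_proj i v.
Proof.
have [s [us cs _]] := sqzP v; case: v cs => -[a h] ep /= cs.
(* A crude common bound for the degrees of [a] and of the finitely many terms x_i ⊗ h_i. *)
pose N := (gbound g a + \sum_(i <- s) (deg i + gbound g (h i)))%N.
exists N; apply: sqz_eq; rewrite sqz_val_sum /=; congr pair.
  rewrite -[LHS](diag1 g) (@diagE _ _ _ _ _ N).
    by apply: eq_bigr => i _; rewrite scale1r.
  by move=> j Hj; apply: gboundP; apply: leq_trans Hj; apply: leq_addr.
apply: funext => i; have [si|si] := boolP ((i : cI) \in s); last first.
  by rewrite cs // big1 // => j _; rewrite linear0 if_same.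
have HN : (deg i + gbound g (h i) <= N)%N.
  by rewrite /N (big_rem _ si) /= addnCA leq_addr.
rewrite -(big_mkord xpredT (fun j => if (deg i <= j)%N then gproj g (j - deg i) (h i) else 0)).
rewrite (big_cat_nat (n := deg i)) ?leq0n ?(leq_trans _ HN) ?leq_addr //=.
rewrite big_nat big1 ?add0r => [|j /andP[_ lt_j]]; last by rewrite leqNgt lt_j.
rewrite -[in LHS](diag1 g (h i)) (@diagE _ _ _ _ _ (N - deg i)); last first.
  by move=> j Hj; apply: gboundP; apply: leq_trans Hj; rewrite leq_subRL // (leq_trans _ HN) ?leq_addr.
have -> (F : nat -> A) : \sum_(deg i <= j < N) F j = \sum_(j < N - deg i) F (j + deg i)%N.
  by rewrite -{1}[deg i]add0n big_addn big_mkord.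
by apply: eq_bigr => j _; rewrite scale1r leq_addl addnK.
Qed.

Definition sqz_grading : grading sqz := Grading sqz_proj_orth sqz_proj_sum.

Lemma sqz_homogP n (p : sqz) : homog sqz_grading n p <->
  homog g n (subZ_val p).1 /\
  forall i, if (deg i <= n)%N then homog g (n - deg i) ((subZ_val p).2 i)
            else (subZ_val p).2 i = 0.
Proof.
split=> [hp|[h1 h2]].
  have E : proj_raw n (subZ_val p) = subZ_val p by rewrite -sqz_projE; congr subZ_val.
  split=> [|i]; first by rewrite /homog -{2}E.
  by rewrite -E /=; case: (leqP (deg i) n) => Hi //; apply: homog_proj.
rewrite /homog; apply: sqz_eq; rewrite [LHS]/= /proj_raw; case: p h1 h2 => -[a h] ep /= h1 h2.
by congr pair => //; apply: funext => i; have := h2 i; case: ifP => // _ ->.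
Qed.

Lemma sqz_gca : is_gca sqz_grading.
Proof.
split.
- apply/sqz_homogP; split; first exact: (gca_one gcaA).
  by move=> i /=; case: ifP => // _; exact: homog0.
- move=> m n p q /sqz_homogP[p1 p2] /sqz_homogP[q1 q2]; apply/sqz_homogP.
  split=> [|i /=]; first exact: (gca_mul gcaA).
  have := p2 i; have := q2 i; rewrite /psign (diag_homog _ p1).
  have [li|li] := leqP (deg i) n; have [lj|lj] := leqP (deg i) m => hq hp;
    rewrite ?hp ?hq ?mulr0 ?mul0r ?addr0 ?add0r.
  + rewrite (leq_trans lj) ?leq_addr //; apply: homogD.
      by rewrite -addnBAC //; apply: (gca_mul gcaA).
    by rewrite -addnBA // -scalerAl; apply/homogZ/(gca_mul gcaA).
  + rewrite (leq_trans li) ?leq_addl //.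
    by rewrite -addnBA // -scalerAl; apply/homogZ/(gca_mul gcaA).
  + rewrite (leq_trans lj) ?leq_addr //.
    by rewrite -addnBAC //; apply: (gca_mul gcaA).
  by case: ifP => // _; exact: homog0.
move=> m n p q /sqz_homogP[p1 p2] /sqz_homogP[q1 q2]; apply: sqz_eq.
congr pair => /=; first exact: (gca_comm gcaA).
apply: funext => i /=; rewrite fctE.
rewrite /psign (diag_homog _ p1) (diag_homog _ q1) addrC scalerDr.
have := p2 i; have := q2 i.
move=> hq hp; congr (_ + _).
  case: leqP hq => [li hq|_ ->]; last by rewrite mulr0 mul0r scaler0.
  rewrite -scalerAl (gca_comm gcaA p1 hq) scalerA; congr (_ *: _).
  by rewrite -[in RHS](subnK li) mulnDr addnC; sign_parity.
case: leqP hp => [li hp|_ ->]; last by rewrite mulr0 mul0r scaler0.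
rewrite (gca_comm gcaA hp q1) -scalerAl scalerA; congr (_ *: _).
by rewrite -[in RHS](subnK li); sign_parity.
Qed.

(** The lift x_i + x_i ⊗ 1 of a generator makes its partial derivatives the Kronecker symbol. *)
Lemma gen_rawP i : ext_set (x i, fun j : I => if (j : cI) == i then 1 else 0).
Proof.
exists [:: i : cI]; split => // [j|]; first by rewrite inE /= => /negPf ->.
by rewrite /euler big_seq1 /= eqxx mulr1 /gdeg (diag_homog _ (homx i)).
Qed.
Definition sqz_gen i : sqz := mk_sqz (gen_rawP i).

Lemma homog_gen i : homog sqz_grading (deg i) (sqz_gen i).
Proof.
apply/sqz_homogP; split=> [|j]; first exact: homx.
rewrite /=; case: eqP => [->|_]; last by case: ifP => // _; exact: homog0.
by rewrite leqnn subnn; exact: (gca_one gcaA).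
Qed.

Definition sqz_fst (p : sqz) : A := (subZ_val p).1.
Lemma sqz_fst_linear : linear sqz_fst. Proof. by []. Qed.
HB.instance Definition _ := GRing.isLinear.Build k sqz A *:%R sqz_fst sqz_fst_linear.
Lemma sqz_fst_mul : monoid_morphism sqz_fst. Proof. by []. Qed.
HB.instance Definition _ := GRing.isMonoidMorphism.Build sqz A sqz_fst sqz_fst_mul.

End Extension.

(** * Partial derivatives and [delta] from the universal property *)

Section Delta.
Variables (k : fieldType) (A : algType k) (g : grading A) (gcaA : is_gca g).

(** The lifts of the generators extend to a morphism into the square zero extension; its second
    component is the family of partial derivatives, and membership in the extension is the Euler
    relation. *)
Lemma free_derivation : free_gca g -> exists (I : Type) (deg : I -> nat) (x : I -> A),
  (forall i, homog g (deg i) (x i)) /\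
  exists D : A -> I -> A,
   [/\ linear D,
     forall a, ext_set g deg x (a, D a),
     forall a b i, D (a * b) i = D a i * b + psign g (deg i) a * D b i &
     forall n a i, homog g n a ->
       if (deg i <= n)%N then homog g (n - deg i) (D a i) else D a i = 0].
Proof.
move=> [I [deg [x [homx univ]]]]; exists I, deg, x; split => //.
have [phi [phi_deg phi_gen _]] := univ _ _ (sqz_gca gcaA homx) _ (homog_gen gcaA homx).
(* Uniqueness for maps from [A] to itself: the first component of [phi] fixes the generators, so it
   is the identity. *)
have [phi0 [_ _ phi0_uniq]] := univ _ _ gcaA _ homx.
have fstE a : (subZ_val (phi a)).1 = a.
  pose psi : {lrmorphism A -> A} := sqz_fst (gcaA := gcaA) (homx := homx) \o phi.
  pose idA : {lrmorphism A -> A} := idfun.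
  have -> : (subZ_val (phi a)).1 = psi a by [].
  rewrite (phi0_uniq psi); first rewrite -(phi0_uniq idA) //.
    by move=> i v hv; have /sqz_homogP[] := phi_deg _ _ hv.
  by move=> i; rewrite /= /sqz_fst phi_gen.
exists (fun a => (subZ_val (phi a)).2); split.
- by move=> c a b; rewrite linearP.
- by move=> a; rewrite -{1}(fstE a) -surjective_pairing; apply: sqzP.
- by move=> a b i; rewrite rmorphM /= !fstE.
move=> n a i ha; have /sqz_homogP[_] := phi_deg _ _ ha; exact.
Qed.

Definition hcomp n v : letter g := Letter (homog_proj g n v).

Lemma hcomp_lin (W : lmodType k) (f : letter g -> W) n e v w : lin1 f ->
  f (hcomp n (e *: v + w)) = e *: f (hcomp n v) + f (hcomp n w).
Proof. by move=> fL; apply: fL; split => //=; rewrite linearP. Qed.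

Lemma hcomp_id a : hcomp (hd a) (hv a) = a.
Proof. by apply: letter_eq => //=; apply: hP. Qed.

Theorem free_delta : free_gca g -> exists del, delta_spec gcaA del.
Proof.
case/free_derivation => I [deg [x [homx [D [D_lin D_ext D_mul D_deg]]]]].
pose X i : letter g := Letter (homogZ (deg i)%:R (homx i)).
have sup a : {s : seq {classic I} | uniq s /\ covers s (D a)}.
  by apply: cid; have [s [us cs _]] := D_ext a; exists s.
(* The indices removed by the filter contribute nothing to a bilinear function: [X i] is 0 if
   [deg i = 0], and the derivative is 0 if [deg i] exceeds the degree of [a]. *)
pose del (a : letter g) := [seq (X i, hcomp (hd a - deg i) (D (hv a) i))
   | i <- [seq i <- sval (sup (hv a)) | (0 < deg i <= hd a)%N]].
(* The sum may be taken over any covering list, so that several letters can share one list. *)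
have ev (W : lmodType k) (f : letter g -> letter g -> W) a (s : seq {classic I}) :
    lin2 f -> uniq s -> covers s (D (hv a)) ->
    \sum_(t <- del a) f t.1 t.2 = \sum_(i <- s) f (X i) (hcomp (hd a - deg i) (D (hv a) i)).
  move=> [fL1 fL2] us cs; rewrite /del big_map big_filter.
  case: (sup (hv a)) => s' [us' cs'] /=.
  transitivity (\sum_(i <- s') f (X i) (hcomp (hd a - deg i) (D (hv a) i))).
    rewrite [RHS](bigID (fun i : {classic I} => (0 < deg i <= hd a)%N)) /=.
    rewrite [X in _ + X]big1 ?addr0 // => i; rewrite negb_and -eqn0Ngt -ltnNge.
    case/orP => [/eqP i0|lti].
      by apply: (lin1_0 (fL1 _)); rewrite /= i0 scale0r.
    apply: (lin1_0 (fL2 _)) => /=; have := D_deg _ _ i (hP a).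
    by rewrite leqNgt lti /= => ->; rewrite linear0.
  apply: (@cover_sum I W (fun i => f (X i) (hcomp (hd a - deg i) (D (hv a) i)))) => // i ni.
    by apply: (lin1_0 (fL2 _)); rewrite /= cs' // linear0.
  by apply: (lin1_0 (fL2 _)); rewrite /= cs // linear0.
have common a b : exists s : seq {classic I}, [/\ uniq s, covers s (D a) & covers s (D b)].
  by have [s] := ext_common (D_ext a) (D_ext b); exists s.
exists del; split.
- move=> a; rewrite all_map all_filter; apply: (sub_all _ (all_predT _)) => i _ /=; apply/implyP => /andP[-> le_i] /=.
  by rewrite subnKC.
- move=> W f fL e c a b [h1 h2 h3].
  have [s [us ca cb]] := common (hv a) (hv b).
  have cc : covers s (D (hv c)) by move=> i si; rewrite h3 D_lin !fctE ca // cb // scaler0 addr0.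
  rewrite !(ev _ _ _ s) // scaler_sumr -big_split; apply: eq_bigr => i _ /=.
  by rewrite h1 h2 h3 D_lin !fctE (hcomp_lin _ _ _ _ (fL.2 _)).
- move=> W f a b fL; have [fL1 fL2] := fL.
  have [s [us ca cb]] := common (hv a) (hv b).
  have cab : covers s (D (hv a * hv b)).
    by move=> i si; rewrite D_mul ca // cb // mul0r mulr0 addr0.
  have fLa (d : letter g) : lin2 (fun v w => f v (lmul gcaA w d)).
    split=> [w|v] e c u1 u2 h; first exact: fL1.
    exact/fL2/(lmul_lin2 gcaA d).2.
  rewrite (ev _ _ _ s) // (ev _ _ a s (fLa b)) // (ev _ _ b s (fLa a)) //.
  rewrite scaler_sumr -big_split; apply: eq_bigr => i _ /=.
  rewrite D_mul -[D (hv a) i * _]scale1r (hcomp_lin _ _ _ _ (fL2 _)) scale1r.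
  have Da := D_deg _ _ i (hP a); have Db := D_deg _ _ i (hP b).
  congr (_ + _).
    case: leqP Da => [le_i Da|_ D0]; last first.
      by rewrite !(lin1_0 (fL2 _)) //= D0 ?linear0 mul0r ?linear0.
    congr (f _); apply: letter_eq => /=; first by rewrite addnBAC.
    by rewrite Da -addnBAC //; apply: (gca_mul gcaA) => //; apply: hP.
  case: leqP Db => [le_i Db|_ D0]; last first.
    by rewrite !(lin1_0 (fL2 _)) ?scaler0 //= D0 ?linear0 ?mul0r ?mulr0 ?linear0.
  (* The Leibniz term is [(-1)^(deg i |a|) a D_i b]; commuting [a] past [D_i b] brings the sign to
     [(-1)^(|a| |b|)]. *)
  apply: (lin1_scale (fL2 _)) => /=; first by rewrite -addnBA // addnC.
  rewrite Db /psign (diag_homog _ (hP a)) -scalerAl linearZ /= -addnBA //.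
  rewrite (gca_mul gcaA (hP a) Db) (gca_comm gcaA (hP a) Db) scalerA; congr (_ *: _).
  by rewrite -[in RHS](subnK le_i); sign_parity.
move=> W f a fL.
have [s [us ca eu]] := D_ext (hv a).
have fL2 : lin2 (fun v w => f (lmul gcaA v w)).
  split=> [w|v] e c u1 u2 h; apply: fL; first exact: (lmul_lin2 gcaA w).2.
  exact: (lmul_lin2 gcaA v).1.
rewrite (ev _ _ a s fL2) //.
have E i : f (lmul gcaA (X i) (hcomp (hd a - deg i) (D (hv a) i))) =
   f (hcomp (hd a) ((deg i)%:R *: (x i * D (hv a) i))).
  have := D_deg _ _ i (hP a); case: leqP => [le_i Da|_ D0]; last first.
    by rewrite !(lin1_0 fL) //= D0 ?linear0 mulr0 ?scaler0 ?linear0.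
  congr f; apply: letter_eq => /=; first by rewrite subnKC.
  rewrite Da -scalerAl linearZ /=; congr (_ *: _).
  by rewrite -{1}(subnKC le_i); apply/esym/(gca_mul gcaA).
transitivity (f (hcomp (hd a) (gdeg g (hv a)))); last first.
  rewrite /gdeg (diag_homog _ (hP a)); apply: (lin1_scale fL) => //=.
  by rewrite linearZ /= (hP a).
rewrite -eu /euler; elim: (s) => [|i s' IHs].
  by rewrite !big_nil (lin1_0 fL) //= linear0.
by rewrite !big_cons -[_ *: _]scale1r (hcomp_lin _ _ _ _ fL) scale1r E IHs.
Qed.

End Delta.

(** * Shuffle permutations *)

Lemma lift_perm_inj n (i j : 'I_n.+1) : injective (lift_perm i j).
Proof.
move=> s t E; apply/permP => l; apply: (@lift_inj _ j).
by rewrite -!(lift_perm_lift i) E.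
Qed.

Lemma lift_perm_surj n (i : 'I_n.+1) (s : 'S_n.+1) :
  exists t, lift_perm i (s i) t = s.
Proof.
have sP l : {l' | s (lift i l) = lift (s i) l'}.
  case: (unliftP (s i) (s (lift i l))) => [l' ->|/perm_inj E]; first by exists l'.
  by have := neq_lift i l; rewrite E eqxx.
have inj : injective (fun l => sval (sP l)).
  move=> l l' E; apply: (@lift_inj _ i); apply: (@perm_inj _ s).
  by rewrite (svalP (sP l)) (svalP (sP l')) E.
exists (perm inj); apply/permP => l; case: (unliftP i l) => [l'|] ->.
  by rewrite lift_perm_lift permE -(svalP (sP l')).
by rewrite lift_perm_id.
Qed.

Lemma sum_lift_perm (V : nmodType) n (i0 j0 : 'I_n.+1) (P : pred 'S_n.+1)
    (F : 'S_n.+1 -> V) :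
  \sum_(s : 'S_n.+1 | P s && (s i0 == j0)) F s =
  \sum_(s : 'S_n | P (lift_perm i0 j0 s)) F (lift_perm i0 j0 s).
Proof.
rewrite (reindex (lift_perm i0 j0)) /=.
  by apply: eq_bigl => s; rewrite lift_perm_id eqxx andbT.
exists (fun s => odflt 1%g [pick t | lift_perm i0 j0 t == s]) => s.
  by move=> _; case: pickP => [t /eqP/lift_perm_inj //|/(_ s)]; rewrite eqxx.
move=> /andP[_ /eqP <-]; case: pickP => [t /eqP //|H].
by have [t /eqP] := lift_perm_surj i0 s; rewrite H.
Qed.

Section ShufflePerm.
Variables (k : fieldType) (T : Type) (dg : T -> nat) (M : lmodType k) (x0 : T).
Implicit Types (x y : seq T) (F : seq T -> M).
Local Notation sg := (sg k dg).
Local Notation wE := (wE dg).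
Local Notation sh := (sh dg).

Definition pword m (s : 'S_m) x := [seq nth x0 x ((s^-1)%g i) | i : 'I_m].
Definition psg m (s : 'S_m) x : k := (-1) ^+ odd_perm s * koszul k (map dg x) s.

Definition skip j x := take j x ++ drop j.+1 x.
Lemma nth_skip j x i : (j < size x)%N -> nth x0 (skip j x) i = nth x0 x (bump j i).
Proof.
move=> lt_j; rewrite /skip nth_cat size_take lt_j /bump; case: ltnP => [lt_ij|le_ji].
  by rewrite nth_take // add0n.
rewrite nth_drop; congr nth; lia.
Qed.

(** Only the first letter of a block, at [0] or [r], can come first in a shuffle; removing it
    shortens its block. *)
Lemma is_shuffle_lift m r (j : 'I_m.+1) (s : 'S_m) :
  is_shuffle r (lift_perm j ord0 s) =
  ((j == 0%N :> nat) || (j == r :> nat)) && is_shuffle (if (j < r)%N then r.-1 else r) s.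
Proof.
set r' := if _ then _ else _.
have r'E b : (bump j b < r)%N = (b < r')%N by rewrite /r' /bump; case: ifP; lia.
have lE (b : 'I_m) : nat_of_ord (lift j b) = bump j b by [].
have l0E (b : 'I_m) : nat_of_ord (lift ord0 b) = b.+1 by [].
apply/idP/andP=> [H|[Hj H]].
  have /forallP H' := H; split.
    have [j0|j0] := posnP j; first by rewrite j0.
    have [jr|rj|jr] := ltngtP j r; last by rewrite ?jr ?eqxx ?orbT.
      have /forallP/(_ j) := H' ord0; rewrite j0 jr /= lift_perm_id.
      by rewrite ltn0.
    have lt_r : (r < m.+1)%N by apply: ltn_trans rj (ltn_ord j).
    have /forallP/(_ j) := H' (Ordinal lt_r).
    by rewrite rj /= leqnn orbT /= lift_perm_id ltn0.
  apply/forallP => a; apply/forallP => b; apply/implyP => /andP[ab Hab].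
  have /forallP/(_ (lift j b)) := H' (lift j a); rewrite !lift_perm_lift !lE !l0E.
  rewrite r'E [(r <= _)%N]leqNgt r'E -leqNgt Hab andbT => /implyP.
  by rewrite ltnS; apply; move: ab; rewrite /bump; lia.
apply/forallP => a; apply/forallP => b; apply/implyP.
case: (unliftP j a) => [a'|] ->; case: (unliftP j b) => [b'|] ->; rewrite ?lift_perm_id ?lift_perm_lift.
- rewrite !lE r'E [(r <= _)%N]leqNgt r'E -leqNgt => /andP[ab Hab].
  have /forallP/(_ a')/forallP/(_ b') := H; rewrite Hab andbT => /implyP Hs.
  by rewrite !l0E ltnS; apply: Hs; move: ab; rewrite /bump; lia.
- by move: Hj; rewrite lE /bump; lia.
- by [].
by rewrite ltnn.
Qed.

Lemma pword_lift m (j : 'I_m.+1) (s : 'S_m) x : size x = m.+1 ->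
  pword (lift_perm j ord0 s) x = nth x0 x j :: pword s (skip j x).
Proof.
move=> sx; rewrite /pword /image_mem lift_permV.
rewrite [enum 'I_m.+1](enum_ordSl m) /= lift_perm_id; congr cons.
rewrite -map_comp; apply: eq_map => i /=.
by rewrite lift_perm_lift nth_skip //= sx.
Qed.

Lemma nth_map_dg x i : (i < size x)%N -> nth 0%N (map dg x) i = dg (nth x0 x i).
Proof. exact: nth_map. Qed.

(** The inversions involving [j] pair it with the letters before it, whence [sg (take j x)]; the
    others are those of [s] on the remaining letters. *)
Lemma psg_lift m (j : 'I_m.+1) (s : 'S_m) x : size x = m.+1 ->
  psg (lift_perm j ord0 s) x = sg (take j x) [:: nth x0 x j] * psg s (skip j x).
Proof.
move=> sx; have jx : (j < size x)%N by rewrite sx.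
have ssx : size (skip j x) = m.
  by rewrite size_cat size_take size_drop jx sx; move: (ltn_ord j); lia.
have nthE a : nth 0%N (map dg (skip j x)) a = nth 0%N (map dg x) (bump j a).
  have [lt_a|ge_a] := ltnP a m.
    by rewrite !nth_map_dg ?nth_skip // ?ssx // sx /bump; lia.
  by rewrite !nth_default // size_map ?ssx // sx /bump; move: (ltn_ord j); lia.
rewrite /psg /koszul odd_lift_perm addbF signr_addb signr_odd.
rewrite (bigD1_ord j) //= [X in _ * (X * _)]big1; last first.
  by move=> b; rewrite lift_perm_id ltn0 andbF.
rewrite mul1r.
have inner (a : 'I_m) :
   \prod_(b < m.+1 | (lift j a < b)%N && (lift_perm j ord0 s b < lift_perm j ord0 s (lift j a))%N)
      (-1) ^+ (nth 0%N (map dg x) (lift j a) * nth 0%N (map dg x) b) =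
   (if (a < j)%N then (-1) ^+ (nth 0%N (map dg x) a * nth 0%N (map dg x) j) else 1) *
   \prod_(b < m | (a < b)%N && (s b < s a)%N)
      (-1) ^+ (nth 0%N (map dg (skip j x)) a * nth 0%N (map dg (skip j x)) b) :> k.
  have rest : \prod_(b < m | (lift j a < lift j b)%N && (lift_perm j ord0 s (lift j b) < lift_perm j ord0 s (lift j a))%N)
      (-1) ^+ (nth 0%N (map dg x) (lift j a) * nth 0%N (map dg x) (lift j b)) =
     \prod_(b < m | (a < b)%N && (s b < s a)%N)
      (-1) ^+ (nth 0%N (map dg (skip j x)) a * nth 0%N (map dg (skip j x)) b) :> k.
    apply: eq_big => [b|b _]; last by rewrite !nthE.
    by rewrite !lift_perm_lift /= /bump; lia.
  case: ifP => aj.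
    rewrite (bigD1_ord j); last first.
      by rewrite lift_perm_id lift_perm_lift /= /bump; move: aj; lia.
    rewrite rest; congr (_ * _); congr (_ ^+ (nth _ _ _ * _)).
    by rewrite /= /bump; move: aj; lia.
  rewrite mul1r -rest big_mkcond [RHS]big_mkcond (bigD1_ord j) //=.
  rewrite ifF ?mul1r //; apply/negP => /andP[].
  by rewrite /bump; move: aj; lia.
under eq_bigr do rewrite inner.
rewrite big_split /= -big_mkcond /=.
have -> : \prod_(i < m | (i < j)%N) (-1) ^+ (nth 0%N (map dg x) i * nth 0%N (map dg x) j)
    = (-1) ^+ (wdg dg (take j x) * dg (nth x0 x j)) :> k.
  rewrite prodrXr -big_distrl /= nth_map_dg //; congr (_ ^+ (_ * _)).
  rewrite -(big_ord_widen m (nth 0%N (map dg x))); last by rewrite -ltnS.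
  rewrite /wdg map_take sumnE (big_nth 0%N) big_mkord size_take size_map jx.
  by apply: eq_bigr => i _; rewrite nth_take.
rewrite /sg size_take jx /= muln1 wdg_cons addn0 exprD.
by rewrite mulrACA.
Qed.

(** Sorting the permutations by the letter they put first reproduces the recursion defining [sh]. *)
Lemma shuffle_sum m r x F : size x = m -> (r <= m)%N ->
  \sum_(s : 'S_m | is_shuffle r s) psg s x *: F (pword s x) = sh (take r x) (drop r x) F.
Proof.
elim: m r x F => [|m IHm] r x F sx le_r.
  move: le_r; rewrite leqn0 => /eqP ->; case: x sx => // _.
  rewrite (big_pred1 1%g); last first.
    move=> s; have -> : s = 1%g by apply/permP => -[].
    by rewrite /= eqxx; apply/forallP => -[].
  rewrite /psg odd_perm1 /koszul big_ord0 mulr1 scale1r /pword /image_mem.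
  by congr F; apply: size0nil; rewrite size_map size_enum_ord.
rewrite (partition_big (fun s : 'S_m.+1 => (s^-1)%g ord0) xpredT) //=.
pose r' j := if (j < r)%N then r.-1 else r.
have E (j : 'I_m.+1) : \sum_(s : 'S_m.+1 | is_shuffle r s && ((s^-1)%g ord0 == j))
     psg s x *: F (pword s x) =
   if (j == 0%N :> nat) || (j == r :> nat) then
     sg (take j x) [:: nth x0 x j] *:
       sh (take (r' j) (skip j x)) (drop (r' j) (skip j x)) (fun z => F (nth x0 x j :: z))
   else 0.
  rewrite (eq_bigl (fun s : 'S_m.+1 => is_shuffle r s && (s j == ord0))); last first.
    move=> s; congr (_ && _).
    by rewrite -(inj_eq (@perm_inj _ s)) permKV eq_sym.
  rewrite sum_lift_perm (eq_bigl _ _ (is_shuffle_lift r j)).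
  have [Hj|/negPf Hj] := boolP ((j == 0%N :> nat) || (j == r :> nat)); last first.
    exact: big_pred0.
  have lt_j := ltn_ord j.
  have hr : (r' j <= m)%N by rewrite /r'; case: ifP; move: lt_j le_r; lia.
  have hs : size (skip j x) = m by rewrite size_cat size_take size_drop sx lt_j; lia.
  rewrite -IHm //= -/(r' j).
  rewrite scaler_sumr; apply: eq_bigr => s _.
  by rewrite psg_lift // pword_lift // scalerA.
under eq_bigr do rewrite E.
rewrite -big_mkcond /=.
case: x sx {E} => // a x [sx].
have [r0|r_gt0] := posnP r.
  rewrite (big_pred1 ord0) => [|j]; last by rewrite r0 orbb.
  by rewrite /r' r0 /skip /= !take0 !drop0 sg0 scale1r.
rewrite (bigD1 ord0) //= {1}/r' r_gt0 /skip /= ?take0 ?drop0 sg0 scale1r.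
have Er : r = r.-1.+1 by rewrite prednK.
(* If the second block is empty, only the first block can provide the leading letter. *)
have [r_max|r_lt] := eqVneq r m.+1.
  rewrite [X in _ + X]big_pred0; last first.
    by move=> j; move: (ltn_ord j) r_max; rewrite -val_eqE /=; lia.
  by rewrite addr0 Er /r' r_gt0 !take_oversize ?drop_oversize ?sh0r //= ?sx; lia.
have r_ord : (r < m.+1)%N by rewrite ltn_neqAle r_lt.
rewrite (big_pred1 (Ordinal r_ord)); last first.
  move=> j; rewrite /= -val_eqE /=.
  by have -> : (j == Ordinal r_ord) = (j == r :> nat) by []; move: r_gt0; lia.
have sr : size (take r (a :: x)) = r by rewrite size_takel //= sx.
have -> : r' (Ordinal r_ord) = r by rewrite /r' /= ltnn.
have -> : r' 0%N = r.-1 by rewrite /r' r_gt0.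
have tE : take r (a :: x) = a :: take r.-1 x by rewrite {1}Er.
have dE : drop r (a :: x) = nth x0 (a :: x) r :: drop r x.
  by rewrite (drop_nth x0) //= sx.
rewrite [nat_of_ord _]/= take_size_cat // drop_size_cat // dE tE sh_cons -tE -dE.
by rewrite [in X in sh _ X _ + _]Er.
Qed.

End ShufflePerm.

(** * Extension by multilinearity *)

Section LetterCochains.
Variables (k : fieldType) (A : cdga k) (M : dgBimodule A).
Local Notation gA := (cdga_gr A).
Local Notation gM := (bim_gr M).
Local Notation T := (letter gA).
Local Notation dg := (@hd k A gA).
Local Notation wdg := (wdg dg).
Local Notation sh := (sh dg).
Implicit Types (f : seq A -> M) (F : seq T -> M) (x y : seq T).

Definition restr f x := f (map (@hv _ _ _) x).

(** Inverse of [restr]: each argument is decomposed into its homogeneous components. *)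
Fixpoint extend F (s : seq A) : M :=
  if s is a :: s' then \sum_(i < gbound gA a) extend (fun w => F (hcomp gA i a :: w)) s'
  else F [::].

Definition mlin f := forall s1 s2 (c : k) a b,
  f (s1 ++ (c *: a + b) :: s2) = c *: f (s1 ++ a :: s2) + f (s1 ++ b :: s2).

Lemma mlin_cons f a : mlin f -> mlin (fun s => f (a :: s)).
Proof. by move=> H s1 s2 c u v; apply: (H (a :: s1)). Qed.
Lemma mlinZ f s1 s2 c a : mlin f -> f (s1 ++ (c *: a) :: s2) = c *: f (s1 ++ a :: s2).
Proof.
move=> H; have f0 : f (s1 ++ 0 :: s2) = 0.
  by have := H s1 s2 (-1) 0 0; rewrite scaler0 addr0 scaleN1r addNr.
by have := H s1 s2 c a 0; rewrite !addr0 f0 addr0.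
Qed.

(** Homogeneous elements span [A]; the induction on an arbitrary suffix keeps a homogeneous prefix
    and enlarges it by one letter at a time. *)
Lemma mlin_eq f f' : mlin f -> mlin f' -> (forall x, restr f x = restr f' x) -> f = f'.
Proof.
move=> fL fL' E; apply: funext => s.
have : forall x, f (map (@hv _ _ _) x ++ s) = f' (map (@hv _ _ _) x ++ s).
  elim: s => [|a s IHs] x; first by rewrite cats0; apply: E.
  elim/(homog_ind (g := gA)): a => [|a b IH1 IH2|i a ha].
  - have := IHs (rcons x (Letter (homog0 gA 0))).
    by rewrite map_rcons cat_rcons.
  - by have := fL (map (@hv _ _ _) x) s 1 a b; have := fL' (map (@hv _ _ _) x) s 1 a b;
      rewrite !scale1r => -> ->; rewrite IH1 IH2.
  by have := IHs (rcons x (Letter ha)); rewrite map_rcons cat_rcons.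
by move/(_ [::]).
Qed.

Lemma multilinear_restr f : mlin f -> multilinear (restr f).
Proof.
move=> H u w e c a b [_ _ E]; rewrite /restr !map_cat /= E; exact: H.
Qed.

Lemma extend_lin F F' (c : k) s : extend (fun w => c *: F w + F' w) s = c *: extend F s + extend F' s.
Proof.
elim: s F F' => //= a s IHs F F'; rewrite scaler_sumr -big_split.
by apply: eq_bigr => i _; rewrite IHs.
Qed.
Lemma extend_eq F F' s : F =1 F' -> extend F s = extend F' s.
Proof. by move=> /funext ->. Qed.
Lemma extend_0 s : extend (fun=> 0) s = 0.
Proof. by elim: s => //= a s IHs; rewrite big1. Qed.
Lemma extend_eq0 F s : (forall x, F x = 0) -> extend F s = 0.
Proof. by move=> H; rewrite -(extend_0 s); apply: extend_eq. Qed.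

Lemma extend_bound F N a s : multilinear F ->
  (forall j, (N <= j)%N -> gproj gA j a = 0) ->
  extend F (a :: s) = \sum_(i < N) extend (fun w => F (hcomp gA i a :: w)) s.
Proof.
move=> FL HN /=; pose G i := extend (fun w => F (hcomp gA i a :: w)) s.
have G0 i : gproj gA i a = 0 -> G i = 0.
  move=> i0; apply: extend_eq0 => w; exact: (lin1_0 (FL [::] w)).
have aux n m : (n <= m)%N -> (forall j, (n <= j)%N -> gproj gA j a = 0) ->
    \sum_(i < n) G i = \sum_(i < m) G i.
  move=> le_nm H; rewrite (big_ord_widen m G) //.
  rewrite [RHS](bigID (fun i : 'I_m => (i < n)%N)) /= [X in _ + X]big1 ?addr0 //.
  by move=> i; rewrite -leqNgt => /H /G0.
rewrite -/(G _) (aux (gbound gA a) (maxn (gbound gA a) N)) ?leq_maxl //; last exact: gboundP.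
by rewrite -(aux N) ?leq_maxr.
Qed.

Lemma mlin_extend F : multilinear F -> mlin (extend F).
Proof.
move=> FL s1 s2 c a b; elim: s1 F FL => [|d s1 IH] F FL; last first.
  rewrite /= scaler_sumr -big_split; apply: eq_bigr => i _.
  by rewrite IH //; apply: multilinear_cons.
pose N := maxn (gbound gA a) (gbound gA b).
rewrite !(@extend_bound F N) //.
- rewrite scaler_sumr -big_split; apply: eq_bigr => i _ /=; rewrite -extend_lin.
  by apply: extend_eq => w; rewrite (hcomp_lin _ _ _ _ (FL [::] w)).
- by move=> j; rewrite geq_max => /andP[_ /gboundP].
- by move=> j; rewrite geq_max => /andP[/gboundP].
move=> j; rewrite geq_max linearP => /andP[/gboundP -> /gboundP ->].
by rewrite scaler0 addr0.
Qed.

Lemma extend_restr F x : multilinear F -> restr (extend F) x = F x.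
Proof.
elim: x F => [|a x IHx] F FL //; rewrite /restr [map _ _]/=.
rewrite (@extend_bound F (dg a).+1) //; last first.
  by move=> j lt_j; rewrite (homog_projE _ (hP a)) gtn_eqF.
rewrite big_ord_recr /= big1 ?add0r => [|i _]; last first.
  apply: extend_eq0 => w; apply: (lin1_0 (FL [::] w)) => /=.
  by rewrite (homog_projE _ (hP a)) ltn_eqF.
by rewrite hcomp_id; apply: (IHx (fun w => F (a :: w))); apply: multilinear_cons.
Qed.

Lemma homogsP ds s : homogs ds s -> exists x, ds = map dg x /\ s = map (@hv _ _ _) x.
Proof.
elim: s ds => [|a s IHs] [|i ds] [] // sz H; first by exists [::].
have [|x [-> ->]] := IHs ds; first split.
- by case: sz.
- by move=> j lt_j; apply: (H j.+1).
by exists (Letter (H 0%N isT) :: x).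
Qed.
Lemma homogs_letters x : homogs (map dg x) (map (@hv _ _ _) x).
Proof.
split=> [|i]; first by rewrite !size_map.
rewrite size_map; elim: x i => // a x IHx [|i] lt_i /=; [exact: hP|exact: IHx].
Qed.

Lemma perm_act_letters m (s : 'S_m) x (x0 : T) : size x = m ->
  perm_act s (map (@hv _ _ _) x) = map (@hv _ _ _) (pword x0 s x).
Proof.
move=> sx; rewrite /perm_act /pword /image_mem -map_comp; apply: eq_map => i /=.
by rewrite (nth_map x0) // sx.
Qed.

Lemma lcochain_restr p m f : is_Ch p m f -> lcochain gM p m (restr f).
Proof.
move=> [f1 f2 f3 f4 f5]; split=> [x sx||x|x hx|x y hx hy].
- by apply: f1; rewrite size_map.
- exact: multilinear_restr.
- exact: f3 (homogs_letters x).
- have [a [ax a0]] : exists a, a \in map (@hv _ _ _) x /\ homog gA 0 a.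
    elim: x hx => //= a x IHx /orP[/eqP a0|/IHx[b [bx b0]]].
      by exists (hv a); rewrite mem_head -a0; split => //; apply: hP.
    by exists b; rewrite inE bx orbT.
  exact: f4 ax a0.
have [sm|sm] := eqVneq (size x + size y)%N m; last first.
  rewrite (sh_eq_size (G := fun=> 0)) ?sh_0 // => z Hz _.
  by apply: f1; rewrite size_map Hz.
have x0 : T by case: (x) hx.
have hr : (0 < size x < m)%N by rewrite hx -sm -addn1 leq_add2l.
have sz : size (x ++ y) = m by rewrite size_cat.
have := f5 (size x) _ _ hr _ (homogs_letters (x ++ y)); rewrite size_map sz => /(_ erefl).
have le_r : (size x <= m)%N by rewrite -sm leq_addr.
have -> : sh x y (restr f) =
    sh (take (size x) (x ++ y)) (drop (size x) (x ++ y)) (restr f).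
  by rewrite take_size_cat // drop_size_cat.
rewrite -(shuffle_sum dg x0 (restr f) sz le_r) => E.
rewrite -[RHS]E; apply: eq_bigr => s _.
by rewrite (perm_act_letters _ x0).
Qed.

Lemma is_Ch_extend p m F : lcochain gM p m F -> is_Ch p m (extend F).
Proof.
move=> [f1 f2 f3 f4 f5]; split.
- move=> s; elim: s m F f1 {f2 f3 f4 f5} => [|a s IHs] m F H /=; first exact: (H [::]).
  case: m H => [|m] H sm; rewrite big1 // => i _.
    by apply: extend_eq0 => w; apply: H.
  by apply: IHs sm => w sw; apply: H.
- exact: mlin_extend.
- move=> ds s /homogsP[x [-> ->]]; have := extend_restr x f2; rewrite /restr => ->.
  exact: f3.
- move=> s a; elim: s F f2 f4 {f1 f3 f5} => // b s IHs F FL H; rewrite inE => /orP[/eqP <-|as_] a0.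
    rewrite /= big1 // => i _; apply: extend_eq0 => w.
    (* The component in degree 0 is a scalar letter; the other components of an element of degree 0
       are zero. *)
    have [i0|i0] := posnP i; first by apply: H; rewrite /has_scalar /= i0.
    apply: (lin1_0 (FL [::] w)) => /=.
    by rewrite (homog_projE _ a0) gtn_eqF.
  rewrite /= big1 // => i _; apply: IHs => // [|w hw]; first exact: multilinear_cons.
  by apply: H; rewrite /has_scalar /= [has _ w]hw orbT.
move=> r ds s /andP[r0 rm] sm /homogsP[x [-> Es]]; move: sm; rewrite Es size_map => sx.
have x0 : T by case: x sx {Es} rm => [<-|//]; rewrite ltn0.
transitivity (sh (take r x) (drop r x) F); last first.
  by apply: f5; rewrite ?size_takel ?size_drop ?subn_gt0 ?sx // ltnW.
rewrite -(shuffle_sum dg x0 F sx (ltnW rm)); apply: eq_bigr => s' _.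
rewrite (perm_act_letters s' x0 sx) -[X in _ = _ *: X](extend_restr _ f2) //.
Qed.

End LetterCochains.

(** * The total differential and the staircase *)

Section LetterDifferentials.
Variables (k : fieldType) (A : cdga k) (M : dgBimodule A).
Local Notation gA := (cdga_gr A).
Local Notation gM := (bim_gr M).
Local Notation gcaA := (cdga_gca A).
Local Notation T := (letter gA).
Local Notation dg := (@hd k A gA).
Local Notation mul := (lmul gcaA).
Local Notation wdg := (wdg dg).
Local Notation sg := (sg k dg).
Local Notation sh := (sh dg).
Implicit Types (f : seq A -> M) (F : seq T -> M) (x y : seq T) (a b c : T) (q : M).

(** The sign is that of 1 ⊗ f for [f] of degree [p]; being multiplicative in [a], it still yields an
    action of the algebra. *)
Definition act_fun p a q : M := (-1) ^+ (p * dg a) *: lact M (hv a) q.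
Lemma act_fun_linear p a : linear (act_fun p a).
Proof.
move=> e u v; rewrite /act_fun linearPr scalerDr !scalerA.
by rewrite [e * _]mulrC.
Qed.
HB.instance Definition _ p a := GRing.isLinear.Build k M M *:%R (act_fun p a) (act_fun_linear p a).
Definition act p a : {linear M -> M} := act_fun p a.

Lemma actE p a q : act p a q = (-1) ^+ (p * dg a) *: lact M (hv a) q.
Proof. by []. Qed.

Lemma act_lin p q : lin1 (fun a => act p a q).
Proof.
move=> e c a b [h1 h2 h3]; rewrite !actE h1 h2 h3 linearPl scalerDr !scalerA.
by rewrite mulrC.
Qed.
Lemma actM p a b q : act p (mul a b) q = act p a (act p b q).
Proof.
rewrite !actE lact_mul linearZr_LR /= scalerA; congr (_ *: _); by sign_parity.
Qed.
Lemma act_deg p a j q : homog gM j q -> homog gM (j + dg a) (act p a q).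
Proof.
move=> hq; rewrite actE; apply: homogZ; rewrite addnC.
exact: lact_deg (hP a) hq.
Qed.

Definition dlet a : T := Letter (cdga_d_deg (hP a)).
Definition d_op a : seq ({linear M -> M} * T) := [:: ((idfun : {linear M -> M}), dlet a)].
Lemma d_opE n a (f : T -> M) :
  \sum_(t <- d_op a) (-1) ^+ ((dg t.2 + dg a) * n) *: t.1 (f t.2) = (-1) ^+ n *: f (dlet a).
Proof. by rewrite big_seq1 /=; congr (_ *: _); sign_parity. Qed.

Lemma dlet_lin (f : T -> M) : lin1 f -> lin1 (fun a => f (dlet a)).
Proof.
move=> fL e c a b [h1 h2 h3]; apply: fL; split => /=; rewrite ?h1 ?h2 //.
by rewrite h3 linearP.
Qed.

Definition letter_d F x := letop dg d_op 0 x F.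
Definition dB p F x := (-1) ^+ p *: letter_d F x - bim_d M (F x).

Lemma letop_d_op n x F : letop dg d_op n x F = (-1) ^+ n *: letter_d F x.
Proof.
rewrite /letter_d; elim: x n F => [|a x IHx] n F; first by rewrite /= scaler0.
rewrite !letop_cons (d_opE n a (fun b => F (b :: x))) (d_opE 0 a (fun b => F (b :: x))).
rewrite IHx [letop _ _ (0 + _) _ _]IHx scale1r scalerDr scalerA; congr (_ + _ *: _).
by sign_parity.
Qed.
Lemma letter_d_cons a x F :
  letter_d F (a :: x) = F (dlet a :: x) + (-1) ^+ dg a *: letter_d (fun z => F (a :: z)) x.
Proof. by rewrite /letter_d letop_cons (d_opE 0 a (fun b => F (b :: x))) letop_d_op scale1r. Qed.
Lemma letter_d_rcons x c F : letter_d F (rcons x c) =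
  letter_d (fun z => F (rcons z c)) x + (-1) ^+ wdg x *: F (rcons x (dlet c)).
Proof. by rewrite /letter_d letop_rcons (d_opE _ c (fun b => F (rcons x b))) add0n. Qed.

Lemma letter_d_lin x (L : {linear M -> M}) F : letter_d (fun z => L (F z)) x = L (letter_d F x).
Proof.
elim: x F => [|a x IHx] F; first by rewrite /letter_d /= linear0.
by rewrite !letter_d_cons IHx linearD linearZ.
Qed.
Lemma letter_dD x F F' : letter_d (fun z => F z + F' z) x = letter_d F x + letter_d F' x.
Proof. exact: letopD. Qed.
Lemma letter_dZ x (c : k) F : letter_d (fun z => c *: F z) x = c *: letter_d F x.
Proof. exact: letopZ. Qed.
Lemma letter_dB x F F' : letter_d (fun z => F z - F' z) x = letter_d F x - letter_d F' x.
Proof. exact: letopB. Qed.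

Lemma letter_d_leibniz F : multilinear F -> letop_leibniz dg d_op mul F.
Proof.
move=> FL n u a b w.
rewrite (d_opE n (mul a b) (fun c => F (u ++ c :: w))).
rewrite (d_opE n a (fun c => F (u ++ mul c b :: w))).
rewrite (d_opE (n + dg a) b (fun c => F (u ++ mul a c :: w))).
have -> : F (u ++ dlet (mul a b) :: w) =
   (-1) ^+ dg a *: F (u ++ mul a (dlet b) :: w) + F (u ++ mul (dlet a) b :: w).
  apply: FL; split => /=; try ring.
  by rewrite (cdga_leibniz _ (hP a)) addrC.
by rewrite scalerDr scalerA -exprD addrC.
Qed.

Lemma letter_d_dT F x : multilinear F -> letter_d (letter_d F) x = 0.
Proof.
elim: x F => [|a x IHx] F FL //; rewrite !letter_d_cons.
have -> : letter_d (fun z => letter_d F (a :: z)) x =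
    letter_d (fun z => F (dlet a :: z) + (-1) ^+ dg a *: letter_d (fun w => F (a :: w)) z) x.
  by congr letter_d; apply: funext => z; rewrite letter_d_cons.
rewrite letter_dD letter_dZ IHx ?scaler0 ?addr0; last exact: multilinear_cons.
rewrite [F (dlet (dlet a) :: x)](_ : _ = 0); last first.
  by apply: (lin1_0 (FL [::] x)); apply: cdga_dd.
by rewrite add0r /= add1n exprS mulN1r; lincomb.
Qed.

Lemma dB_dB p F x : multilinear F -> dB p.+1 (dB p F) x = 0.
Proof.
move=> FL; rewrite /dB letter_dB letter_dZ letter_d_dT // letter_d_lin [bim_d M (_ - _)]linearB [bim_d M (_ *: _)]linearZ /= bim_dd.
rewrite exprS mulN1r. by lincomb.
Qed.

Lemma bim_d_act p a q : bim_d M (act p a q) =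
  (-1) ^+ p *: act p (dlet a) q + (-1) ^+ dg a *: act p a (bim_d M q).
Proof.
rewrite !actE linearZ /= (bim_d_lact _ (hP a)) scalerDr !scalerA.
by congr (_ *: _ + _ *: _); rewrite ?mulnS; sign_parity.
Qed.

Lemma act_succ p a q : act p.+1 a q = (-1) ^+ dg a *: act p a q.
Proof. by rewrite !actE scalerA -exprD mulSn. Qed.

(** [dB] raises the degree of the cochain, so the twist of the action passes from [p] to [p.+1];
    with that change the two differentials commute, and the sign in [D_B] makes the total
    differential square to zero. *)
Lemma dB_bar_diff p F x : multilinear F ->
  dB p (bar_diff gcaA (act p) F) x = bar_diff gcaA (act p.+1) (dB p F) x.
Proof.
move=> FL; rewrite {1}/dB /bar_diff !letter_dB 2![bim_d M (_ - _)]linearB.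
have EB : merge_sum mul x (dB p F) =
    (-1) ^+ p *: letter_d (fun z => merge_sum mul z F) x - bim_d M (merge_sum mul x F).
  rewrite merge_sumB merge_sumZ merge_sum_lin; congr (_ *: _ - _).
  by rewrite /letter_d -(merge_sum_letop (dg := dg)) //; apply: letter_d_leibniz.
have EA : alpha (act p.+1) (dB p F) x =
    (-1) ^+ p *: letter_d (alpha (act p) F) x - bim_d M (alpha (act p) F x).
  case: x {EB} => [|a x]; first by rewrite [alpha _ _ _]/= [letter_d _ _]/= scaler0 linear0 subrr.
  rewrite letter_d_cons /= bim_d_act act_succ /dB linearB linearZ /= letter_d_lin.
  by rewrite !scalerDr ; lincomb.
have EO : omega (act p.+1) (dB p F) x =
    (-1) ^+ p *: letter_d (omega (act p) F) x - bim_d M (omega (act p) F x).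
  case/lastP: x {EB EA} => [|x c]; first by rewrite [omega _ _ _]/= [letter_d _ _]/= scaler0 linear0 subrr.
  rewrite letter_d_rcons !omega_rcons.
  have -> : letter_d (fun z => omega (act p) F (rcons z c)) x =
      sg x [:: c] *: ((-1) ^+ dg c *: act p c (letter_d F x)).
    have := letop_sg dg d_op 0 x c (fun z => act p c (F z)).
    rewrite add0n -/(letter_d _ x) (letop_d_op (dg c)) (letter_d_lin x (act p c) F) => <-; apply: letop_eq => z _.
    by rewrite omega_rcons.
  have S : (-1) ^+ wdg x * sg x [:: dlet c] = sg x [:: c].
    by rewrite /sg !wE /=; sign_parity.
  rewrite act_succ /dB [act p c (_ - _)]linearB [act p c (_ *: _)]linearZ /=.
  rewrite [bim_d M (_ *: _)]linearZ /= bim_d_act.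
  by rewrite -S; lincomb.
by rewrite EA EB EO; lincomb.
Qed.

Lemma lcochain_bim_d p m F : lcochain gM p m F ->
  lcochain gM p.+1 m (fun x => bim_d M (F x)).
Proof.
move=> [f1 f2 f3 f4 f5]; split=> [x sx||x|x hx|x y hx hy].
- by rewrite f1 // linear0.
- by move=> u w; apply: lin1_lin; apply: f2.
- by have := bim_d_deg (f3 x); rewrite addSn -add1n.
- by rewrite f4 // linear0.
by rewrite sh_lin f5 // linear0.
Qed.

Hypothesis A_connected : connected_grading gA.

Lemma scalar_letter a : dg a = 0%N -> exists e : k, hv a = e *: 1.
Proof.
(* Connectedness provides some vector [e] spanning degree 0; the unit is a nonzero multiple of
   it. *)
move=> a0; have [e [e0 he H]] := A_connected.
have [c1 E1] := H _ (gca_one gcaA).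
have [u Ea] : exists u : k, hv a = u *: e by apply: H; have := hP a; rewrite a0.
have c1_neq0 : c1 != 0.
  by apply/eqP => c0; have := oner_eq0 A; rewrite E1 c0 scale0r eqxx.
by exists (u / c1); rewrite E1 scalerA divfK.
Qed.

Lemma cdga_d1 : cdga_d A 1 = 0.
Proof.
have := cdga_leibniz 1 (gca_one gcaA); rewrite mulr1 scale1r mul1r mulr1.
by rewrite -{1}[cdga_d A 1]addr0 => /addrI <-.
Qed.

(** Normalization survives because a letter of degree 0 is a multiple of 1, which [d] kills. *)
Lemma lcochain_letter_d p m F : lcochain gM p m F -> lcochain gM p.+1 m (letter_d F).
Proof.
move=> FC; rewrite -addn1; apply: lcochain_letop => //.
- move=> n f fL; apply: lin1_eq => [a|]; first exact/esym/d_opE.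
  by apply: (lin1Z (fun=> (-1) ^+ n)); apply: dlet_lin.
- move=> n a j f H; rewrite d_opE; apply: homogZ.
  by have := H (dlet a); rewrite /= addnA addn1.
move=> n a f fL a0 _; rewrite d_opE (lin1_0 fL) ?scaler0 //=.
by have [e ->] := scalar_letter a0; rewrite linearZ /= cdga_d1 scaler0.
Qed.

Lemma lcochain_dB p m F : lcochain gM p m F -> lcochain gM p.+1 m (dB p F).
Proof.
move=> FC; have C1 := lcochain_wdg (fun=> (-1) ^+ p) (lcochain_letter_d FC).
have C2 := lcochain_wdg (fun=> -1) (lcochain_bim_d FC).
have := lcochainD C1 C2; congr lcochain; apply: funext => x.
by rewrite scaleN1r.
Qed.

(** * Solving the cocycle equation by increasing internal degree *)

Section Staircase.
Hypothesis char0 : [pchar k] =i pred0.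
Variable del : T -> seq (T * T).
Hypothesis delP : delta_spec gcaA del.

Definition dprev (G : nat -> seq T -> M) p x : M :=
  if p is q.+1 then dB q (G q) x else 0.
Definition letter_D (G : nat -> seq T -> M) p x : M :=
  dprev G p x - (-1) ^+ p *: bar_diff gcaA (act p) (G p) x.

(** Apply [dB] to the equation solved at [j - 1] and compare with the cocycle equation at [j]: since
    [dB] squares to zero and commutes with [bar_diff], what is left of [F j] is a cocycle for
    [bar_diff]. *)
Lemma remainder N j (F G : nat -> seq T -> M) : (j <= N)%N ->
  (forall p, (p <= N)%N -> lcochain gM p (N.+1 - p) (F p)) ->
  (forall p x, (p <= N)%N -> letter_D F p x = 0) ->
  (forall p, (p < j)%N -> lcochain gM p (N - p) (G p)) ->
  (forall p x, (p < j)%N -> F p x = letter_D G p x) ->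
  lcochain gM j (N.+1 - j) (fun x => F j x - dprev G j x) /\
  forall x, bar_diff gcaA (act j) (fun x => F j x - dprev G j x) x = 0.
Proof.
move=> le_j FC DF GC FG; split.
  case: j le_j FG GC => [|q] le_j FG GC.
    by have := FC 0%N le_j; congr lcochain; apply: funext => x; rewrite subr0.
  have C1 := lcochain_wdg (fun=> -1) (lcochain_dB (GC q (ltnSn q))).
  have := lcochainD (FC _ le_j) C1; rewrite subSS; congr lcochain.
  by apply: funext => x; rewrite scaleN1r.
move=> x; rewrite bar_diffB; case: j le_j FG GC => [|q] le_j FG GC.
  have := DF 0%N x le_j; rewrite /letter_D /= sub0r scale1r => /eqP; rewrite oppr_eq0 => /eqP ->.
  by rewrite bar_diff_eq0 ?subr0.
have GL := lc_lin (GC q (ltnSn q)).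
have Fq : F q = letter_D G q by apply: funext => z; apply: FG.
have := DF q.+1 x le_j; rewrite {1}/letter_D [dprev F q.+1 x]/= Fq.
have -> : dB q (letter_D G q) x = - (-1) ^+ q *: bar_diff gcaA (act q.+1) (dB q (G q)) x.
  rewrite -dB_bar_diff //.
  have EB : dB q (letter_D G q) x = dB q (dprev G q) x
     - (-1) ^+ q *: dB q (bar_diff gcaA (act q) (G q)) x.
    rewrite /dB /letter_D letter_dB letter_dZ [bim_d M (_ - _)]linearB [bim_d M (_ *: _)]linearZ /=.
    by lincomb.
  have Z : dB q (dprev G q) x = 0.
    case: q {EB Fq le_j FG} GC GL => [|r] GC GL.
      by rewrite /dB /dprev /letter_d letop_0 scaler0 linear0 subrr.
    by apply: dB_dB; apply: (lc_lin (GC r _)).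
  by rewrite EB Z; lincomb.
rewrite exprS mulN1r => /eqP; rewrite subr_eq0 => /eqP /(congr1 ( *:%R (- (-1) ^+ q))).
rewrite !scalerA mulrNN -expr2 sqrr_sign !scale1r => ->.
by rewrite subrr.
Qed.

Lemma staircase N (F : nat -> seq T -> M) :
  (forall p, (p <= N)%N -> lcochain gM p (N.+1 - p) (F p)) ->
  (forall p x, (p <= N)%N -> letter_D F p x = 0) ->
  exists G : nat -> seq T -> M, [/\
    forall p, (p < N)%N -> lcochain gM p (N - p) (G p),
    forall p x, (N <= p)%N -> G p x = 0 &
    forall p x, (p < N)%N -> F p x = letter_D G p x].
Proof.
move=> FC DF; suff H j : (j <= N)%N -> exists G : nat -> seq T -> M, [/\
    forall p, (p < j)%N -> lcochain gM p (N - p) (G p),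
    forall p x, (j <= p)%N -> G p x = 0 &
    forall p x, (p < j)%N -> F p x = letter_D G p x] by exact: H.
elim: j => [|j IHj] le_j; first by exists (fun _ _ => 0).
have [G [GC G0 FG]] := IHj (ltnW le_j).
have [RC dR] := remainder (ltnW le_j) FC DF GC FG.
(* As [j < N], the remainder has arity at least 2, where acyclicity applies. *)
have EN : (N.+1 - j = (N - j).-1.+2)%N by lia.
move: RC; rewrite EN => RC.
have [f fC df] := harrison_acyclic (@act_lin j) (@actM j) (@act_deg j) char0 delP RC dR.
(* The factor cancels the sign in front of [bar_diff] in [letter_D]. *)
pose G' p x := if p == j then - (-1) ^+ j *: f x else G p x.
exists G'; split.
- move=> p; rewrite ltnS leq_eqVlt /G'; case: eqP => [->|_] /= lt_p; last exact: GC.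
  by have := lcochain_wdg (fun=> - (-1) ^+ j) fC; congr (lcochain _ _ _); lia.
- move=> p x lt_p; rewrite /G' gtn_eqF //; apply: G0; exact: ltnW.
move=> p x; rewrite ltnS leq_eqVlt => /orP[/eqP ->|lt_p].
  have EP : forall q : nat, (q < j)%N -> G' q = G q.
    by move=> q lt_q; apply: funext => z; rewrite /G' ltn_eqF.
  have -> : letter_D G' j x = dprev G j x - (-1) ^+ j *: bar_diff gcaA (act j) (fun z => - (-1) ^+ j *: f z) x.
    congr (_ - _ *: _); last by apply: bar_diff_eq => z _ _; rewrite /G' eqxx.
    by move: EP; rewrite /dprev; case: (j) => // q ->.
  have -> : bar_diff gcaA (act j) (fun z => - (-1) ^+ j *: f z) x = - (-1) ^+ j *: (F j x - dprev G j x).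
    by rewrite -df bar_diffZ.
  by rewrite scalerA mulrN -expr2 sqrr_sign scaleN1r opprK addrC subrK.
have EP (q : nat) : (q <= p)%N -> G' q = G q.
  by move=> le_q; apply: funext => z; rewrite /G' ltn_eqF // (leq_ltn_trans le_q).
rewrite FG //; congr (_ - _ *: _).
  by move: EP; rewrite /dprev; case: (p) => // q ->.
by apply: bar_diff_eq => z _ _; rewrite /G' ltn_eqF.
Qed.
End Staircase.

End LetterDifferentials.

(** * Isomorphisms of subquotients *)

Section SubquotIso.
Local Open Scope quotient_scope.
Variables (k : fieldType) (V V' : lmodType k).
Variables (Z B : submodule V) (Z' B' : submodule V').

Lemma submodE (W : lmodType k) (S : submodule W) x : (x \in submod_pred S) <-> S x.
Proof. by split; rewrite unfold_in => /asboolP. Qed.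

Lemma pi_subquotP (x y : subZ Z) :
  \pi_(subquot Z B) x = \pi_(subquot Z B) y <-> B (subZ_val x - subZ_val y).
Proof.
rewrite -submodE; split=> [/eqP|] H; last first.
  by apply/eqP; rewrite -Quotient.idealrBE.
by move: H; rewrite -Quotient.idealrBE.
Qed.
End SubquotIso.

Section SubquotMap.
Local Open Scope quotient_scope.
Variables (k : fieldType) (V V' : lmodType k).
Variables (Z B : submodule V) (Z' B' : submodule V').

(** Injectivity and surjectivity are checked modulo boundaries on representatives; the inverse is
    then obtained by choice. *)
Lemma subquot_iso (h : {linear V -> V'}) :
  (forall x, Z x -> Z' (h x)) -> (forall x, B x -> B' (h x)) ->
  (forall x, Z x -> B' (h x) -> B x) ->
  (forall z', Z' z' -> exists2 z, Z z & B' (z' - h z)) ->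
  exists G : {linear subquot Z B -> subquot Z' B'}, bijective G.
Proof.
move=> hZ hB hinj hsurj.
have zP (x : subZ Z) : Z (subZ_val x) by apply/submodE; apply: subZ_prop.
have z'P (x : subZ Z') : Z' (subZ_val x) by apply/submodE; apply: subZ_prop.
pose gam (x : subZ Z) : subZ Z' := SubZ ((submodE Z' _).2 (hZ _ (zP x))).
pose G (q : subquot Z B) : subquot Z' B' := \pi_(subquot Z' B') (gam (repr q)).
have Gpi x : G (\pi_(subquot Z B) x) = \pi_(subquot Z' B') (gam x).
  rewrite /G; apply/pi_subquotP; rewrite /= -linearB; apply: hB.
  by apply/pi_subquotP; rewrite reprK.
have Glin : linear G.
  move=> c p q; rewrite -[p]reprK -[q]reprK.
  rewrite -[c *: _](pi_subquot_scale B c) -pi_subquotD !Gpi.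
  rewrite -[c *: \pi_(subquot Z' B') _](pi_subquot_scale B' c) -pi_subquotD; congr (\pi _).
  by apply: val_inj => /=; rewrite linearP.
pose mx := GRing.isLinear.Build k (subquot Z B) (subquot Z' B') *:%R G Glin.
pose GL : {linear subquot Z B -> subquot Z' B'} := HB.pack G mx.
exists GL; rewrite -[GRing.Linear.sort GL]/G.
have Ginj : injective G.
  move=> p q; rewrite -[p]reprK -[q]reprK !Gpi => /pi_subquotP /= E.
  apply/pi_subquotP; apply: hinj; last by rewrite linearB.
  have := submodP (-1) (zP (repr q)) (zP (repr p)).
  by rewrite scaleN1r addrC.
have Gsurj q' : exists q, G q = q'.
  have [z Zz Bz] := hsurj _ (z'P (repr q')).
  exists (\pi_(subquot Z B) (SubZ ((submodE Z z).2 Zz))).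
  rewrite Gpi -[q']reprK; apply/pi_subquotP => /=.
  have := submodP (-1) Bz (submod0 B').
  by rewrite addr0 scaleN1r opprB.
pose Gi q' := sval (cid (Gsurj q')).
have GiK : cancel Gi G by move=> q'; exact: (svalP (cid (Gsurj q'))).
by exists Gi => // q; apply: Ginj; rewrite GiK.
Qed.
End SubquotMap.

(** * The differentials of Harrison cochains *)

Section Bridge.
Variables (k : fieldType) (A : cdga k) (M : dgBimodule A).
Hypothesis M_symmetric : symmetric_bimodule M.
Local Notation gA := (cdga_gr A).
Local Notation gM := (bim_gr M).
Local Notation gcaA := (cdga_gca A).
Local Notation T := (letter gA).
Local Notation dg := (@hd k A gA).
Local Notation mul := (lmul gcaA).
Local Notation wdg := (wdg dg).
Local Notation sg := (sg k dg).
Implicit Types (f : seq A -> M) (F : seq T -> M) (x y : seq T) (s : seq A).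

Lemma ksign_linear p : linear (ksign gA p).
Proof. by move=> c a b; rewrite !ksignE linearP. Qed.
Lemma ksign_homog p i (a : A) : homog gA i a -> ksign gA p a = (-1) ^+ (p * i) *: a.
Proof. by move=> ha; rewrite ksignE (diag_homog _ ha). Qed.

(** [Ch_delB] in recursive form, shaped like [bar_diff]. *)
Definition rdelB p f s : M :=
  on_head (fun a w => lact M (ksign gA p a) (f w)) s - merge_sum *%R s f
  + on_last (fun c w => (-1) ^+ (size w).+1 *: ract M (f w) c) s.

Lemma Ch_delBE p f s : Ch_delB p f s = rdelB p f s.
Proof.
rewrite /Ch_delB /rdelB; case: s => [|a s].
  (* On the empty sequence the default letter 0 annihilates both end terms. *)
  have -> : ksign gA p [::]`_0 = 0 by rewrite ksignE linear0.
  by rewrite big_ord0 linear0l linear0r scaler0 subrr addr0.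
congr (_ - _ + _); last first.
  by rewrite /= size_belast lastI -cats1 take_size_cat ?size_belast // last_cat.
rewrite [size _]/= [_.-1]/=.
elim: s a f => [|b s IHs] a f; first by rewrite big_ord0.
rewrite big_ord_recl merge_sum2 expr0 scale1r; congr (_ + _); first by rewrite /= drop0.
rewrite -(IHs b (fun z => f (a :: z))) -sumrN; apply: eq_bigr => i _.
by rewrite /= /bump add1n exprS mulN1r scaleNr.
Qed.

Fixpoint rd f s : M :=
  if s is a :: s' then f (cdga_d A a :: s') + rd (fun w => f (ksign gA 1 a :: w)) s'
  else 0.
Lemma Ch_dBE p f s : Ch_dB p f s = (-1) ^+ p *: rd f s - bim_d M (f s).
Proof.
rewrite /Ch_dB; congr (_ *: _ - _); elim: s f => [|a s IHs] f.
  by rewrite big_ord0.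
by rewrite /= big_ord_recl /= drop0 -IHs.
Qed.

Lemma mlin_eqf f f' : f =1 f' -> mlin f -> mlin f'.
Proof. by move=> /funext ->. Qed.
Lemma mlinD f f' : mlin f -> mlin f' -> mlin (fun s => f s + f' s).
Proof. by move=> H H' s1 s2 c a b; rewrite H H' scalerDr addrACA. Qed.
Lemma mlinS (e : k) f : mlin f -> mlin (fun s => e *: f s).
Proof. by move=> H s1 s2 c a b; rewrite H scalerDr !scalerA mulrC. Qed.
Lemma mlin0 : mlin (fun=> 0 : M).
Proof. by move=> s1 s2 c a b; rewrite scaler0 addr0. Qed.

Lemma mlin_merge_sum f : mlin f -> mlin (fun s => merge_sum *%R s f).
Proof.
move=> fL s1 s2 c a b; elim: s1 f fL => [|d s1 IHs] f fL.
  case: s2 => [|e s2]; first by rewrite /= scaler0 addr0.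
  rewrite !cat0s !merge_sum2 mulrDl -scalerAl (fL [::]).
  have -> : merge_sum *%R (e :: s2) (fun z => f (c *: a + b :: z)) =
      merge_sum *%R (e :: s2) (fun z => c *: f (a :: z) + f (b :: z)).
    by apply: merge_sum_ext => z; rewrite (fL [::]).
  by rewrite merge_sumD merge_sumZ; lincomb.
have IH := IHs _ (mlin_cons d fL).
case: s1 {IHs} IH => [|e s1] IH; rewrite ?cat0s ?cat_cons.
  rewrite !merge_sum2 IH mulrDr -scalerAr (fL [::]); by lincomb.
rewrite !merge_sum2 -!cat_cons IH (fL (d * e :: s1)); by lincomb.
Qed.

Lemma mlin_delB p f : mlin f -> mlin (Ch_delB p f).
Proof.
move=> fL; apply: (@mlin_eqf (rdelB p f)); first by move=> s; rewrite Ch_delBE.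
apply: mlinD; first apply: mlinD.
- move=> [|d s1] s2 c a b /=; first by rewrite ksign_linear linearPl.
  by rewrite fL linearPr.
- by move=> s1 s2 c a b; rewrite (mlin_merge_sum fL) opprD scalerN.
move=> s1 s2 c a b; case/lastP: s2 => [|s2 e].
  rewrite !cats1 !on_last_rcons linearPr /= scalerDr !scalerA; congr (_ *: _ + _).
  exact: mulrC.
rewrite -!rcons_cons -!rcons_cat !on_last_rcons fL linearPl /= !size_cat /=.
by rewrite scalerDr !scalerA mulrC.
Qed.

Lemma mlin_rd f : mlin f -> mlin (rd f).
Proof.
move=> fL s1 s2 c a b; elim: s1 f fL => [|d s1 IHs] f fL /=.
  rewrite linearP (fL [::]).
  have aux (f1 f2 f3 : seq A -> M) w : (forall z, f1 z = c *: f2 z + f3 z) ->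
      rd f1 w = c *: rd f2 w + rd f3 w.
    elim: w f1 f2 f3 => [|e w IHw] f1 f2 f3 E /=; first by rewrite scaler0 addr0.
    rewrite E (IHw _ (fun w => f2 (ksign gA 1 e :: w)) (fun w => f3 (ksign gA 1 e :: w))) //.
    by lincomb.
  rewrite (aux _ (fun w => f (ksign gA 1 a :: w)) (fun w => f (ksign gA 1 b :: w))).
    by lincomb.
  by move=> z; rewrite ksign_linear (fL [::]).
rewrite (fL (cdga_d A d :: s1)) IHs; last exact: mlin_cons.
by lincomb.
Qed.

Lemma mlin_dB p f : mlin f -> mlin (Ch_dB p f).
Proof.
move=> fL; apply: (@mlin_eqf (fun s => (-1) ^+ p *: rd f s + - bim_d M (f s))).
  by move=> s; rewrite Ch_dBE.
apply: mlinD; first exact/mlinS/mlin_rd.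
by move=> s1 s2 c a b; rewrite fL linearP opprD scalerN.
Qed.

(** Symmetry turns the right action of the last letter into a left one; of the resulting sign,
    [act p] takes the part due to [p] and [omega] the part due to the letters passed. *)
Lemma restr_delB p f x : mlin f -> (forall y, homog gM (p + wdg y) (restr f y)) ->
  restr (Ch_delB p f) x = bar_diff gcaA (act M p) (restr f) x.
Proof.
move=> fL fH; rewrite /restr Ch_delBE /rdelB /bar_diff; congr (_ - _ + _).
- case: x => [|a x] //=; rewrite actE (ksign_homog _ (hP a)).
  by rewrite linearZl_LR.
- elim: x f {fL fH} => [|a [|b x] IH] f //; rewrite [in RHS]merge_sum2.
  by rewrite -[X in _ = _ - X](IH (fun s => f (hv a :: s))).
case/lastP: x => [|x c]; first by rewrite /= oppr0.
rewrite map_rcons on_last_rcons omega_rcons actE (M_symmetric (fH x) (hP c)).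
rewrite !scalerA -scaleNr size_map; congr (_ *: _).
by rewrite /sg !wE /=; sign_parity.
Qed.

Lemma rd_letters f x : mlin f -> rd f (map (@hv _ _ _) x) = letter_d (restr f) x.
Proof.
elim: x f => [|a x IHx] f fL //; rewrite letter_d_cons [map _ _]/= [rd _ _]/=.
congr (_ + _); rewrite (ksign_homog _ (hP a)) mul1n IHx.
  rewrite -letter_dZ; congr letter_d; apply: funext => z.
  exact: (mlinZ [::]).
exact: mlin_cons.
Qed.

Lemma restr_dB p f x : mlin f -> restr (Ch_dB p f) x = dB p (restr f) x.
Proof. by move=> fL; rewrite /restr Ch_dBE rd_letters. Qed.

End Bridge.

(** * Comparison with derivations *)

Section Comparison.
Variables (k : fieldType) (A : cdga k) (M : dgBimodule A).
Hypothesis char0 : [pchar k] =i pred0.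
Hypothesis A_connected : connected_grading (cdga_gr A).
Hypothesis A_free : free_gca (cdga_gr A).
Hypothesis M_symmetric : symmetric_bimodule M.
Local Notation gA := (cdga_gr A).
Local Notation gM := (bim_gr M).
Local Notation gcaA := (cdga_gca A).
Local Notation T := (letter gA).
Local Notation dg := (@hd k A gA).
Local Notation wdg := (wdg dg).
Implicit Types (g : nat -> seq A -> M) (theta : A -> M) (f : seq A -> M) (F : seq T -> M) (x : seq T) (s : seq A).

Definition cochain1 (theta : A -> M) s : M := if s is [:: a] then theta a else 0.

Lemma Der_one p theta : is_derivation p theta -> theta 1 = 0.
Proof.
move=> [_ _ tL]; have := tL 0%N 1 1 (gca_one gcaA).
rewrite mulr1 muln0 scale1r ract_one lact_one.
by rewrite -{1}[theta 1]addr0 => /addrI <-.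
Qed.

Lemma Der_scalar p theta a : is_derivation p theta -> homog gA 0 a -> theta a = 0.
Proof.
move=> tD a0; have [tl _ _] := tD.
have [c /= ->] := scalar_letter A_connected (erefl : dg (Letter a0) = 0%N).
have := tl c 1 0; rewrite addr0 (Der_one tD) => ->.
have := tl (-1) 0 0; rewrite scaler0 addr0 scaleN1r addNr => ->.
by rewrite scaler0 addr0.
Qed.

Lemma mlin_cochain1 theta : linear theta -> mlin (cochain1 theta).
Proof.
move=> tl s1 s2 c a b; have [/eqP|n1] := eqVneq (size s1 + size s2)%N 0%N.
  by rewrite addn_eq0 !size_eq0 => /andP[/eqP -> /eqP ->] /=; apply: tl.
have Z u : cochain1 theta (s1 ++ u :: s2) = 0.
  by case: s1 n1 => [|d s1]; [case: s2|case: s1].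
by rewrite !Z scaler0 addr0.
Qed.

Lemma is_Ch_cochain1 p theta : is_derivation p theta -> is_Ch p 1 (cochain1 theta).
Proof.
move=> tD; have [tl td _] := tD; split.
- by move=> [|a [|b s]].
- exact: mlin_cochain1.
- move=> ds [|a [|b s]] [] sz H; try exact: homog0.
  case: ds sz H => [|i [|j ds]] // _ H.
  by rewrite /= addn0; apply: td; apply: (H 0%N).
- move=> [|a [|b s]] // a'; rewrite inE => /eqP -> a0.
  exact: Der_scalar tD a0.
by move=> r ds s; case: r.
Qed.

(** On two letters the differential is the defect of the Leibniz rule; on words of any other length
    each of its terms vanishes. *)
Lemma Der_delB p theta : is_derivation p theta -> Ch_delB p (cochain1 theta) = 0.
Proof.
move=> tD; have fC := is_Ch_cochain1 tD; have [tl td tL] := tD.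
apply: (@mlin_eq _ _ _ _ (fun=> 0)); [exact/mlin_delB/mlin_cochain1|exact: mlin0|move=> x].
rewrite /restr Ch_delBE; case: x => [|a [|b [|c x]]].
- by rewrite /rdelB /= subr0 addr0.
- by rewrite /rdelB /= linear0l linear0r scaler0 !subr0 addr0.
- rewrite /rdelB /= subr0 (ksign_homog _ (hP a)) (tL _ _ _ (hP a)) linearZl_LR /=.
  by rewrite expr2 mulrNN mulr1 scale1r; lincomb.
have big (y : seq A) : (1 < size y)%N -> cochain1 theta y = 0 by case: y => [|? []].
rewrite /rdelB; have -> : merge_sum *%R (map (@hv _ _ _) [:: a, b, c & x]) (cochain1 theta) = 0.
  rewrite (@merge_sum_eq k A (fun=> 0%N) M *%R _ _ _ (fun=> 0)) //; last first.
    by move=> z [Hz] _; apply: big; rewrite Hz.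
  by elim: (map _ _) => // d [|e w] //= ->; rewrite subr0.
rewrite subr0 [map _ _]/= /on_head /on_last (big (hv b :: _)) // big //= ?size_belast //.
by rewrite linear0r linear0l scaler0 addr0.
Qed.

Lemma Der_dB p theta : Ch_dB p (cochain1 theta) = cochain1 (der_d p theta).
Proof.
apply: funext => -[|a [|b s]]; rewrite Ch_dBE.
- by rewrite /= scaler0 linear0 subr0.
- by rewrite /= addr0.
have rd0 (f : seq A -> M) (w : seq A) : (forall z, size z = size w -> f z = 0) -> rd f w = 0.
  elim: w f => // d w IHw f H /=; rewrite H // IHw ?addr0 // => z Hz.
  by apply: H; rewrite /= Hz.
have -> : rd (cochain1 theta) [:: a, b & s] = 0 by apply: rd0 => -[|? [|? ?]].
by rewrite scaler0 /= linear0 subr0.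
Qed.

Lemma Ch1_derivation p f : is_Ch p 1 f -> Ch_delB p f = 0 ->
  is_derivation p (fun a => f [:: a]) /\ f = cochain1 (fun a => f [:: a]).
Proof.
move=> [f1 f2 f3 _ _] df; split; last first.
  by apply: funext => -[|a [|b s]] //=; apply: f1.
split.
- by move=> c a b; apply: (f2 [::] [::]).
- move=> i a ha; have := f3 [:: i] [:: a]; rewrite /= addn0; apply; split => //.
  by move=> [|j].
move=> i a b ha; have := congr1 (fun h => h [:: a; b]) df.
rewrite /= Ch_delBE /rdelB /= subr0 (ksign_homog _ ha) linearZl_LR /=.
rewrite expr2 mulrNN mulr1 scale1r => /eqP.
rewrite addrAC subr_eq0 eq_sym => /eqP ->.
by rewrite addrC.
Qed.

(** A derivation of degree [n] is a cochain of arity 1, hence of total degree [n + 1]: this is the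
    shift of degree in the theorem. *)
Definition inject n (theta : A -> M) : nat -> seq A -> M :=
  fun p => if p == n then cochain1 theta else 0.
Lemma inject_linear n : linear (inject n).
Proof.
move=> c t u; apply: funext => p; apply: funext => s; rewrite /inject !fctE.
case: eqP => _; rewrite ?fctE ?scaler0 ?addr0 //.
by case: s => [|a [|b s]] /=; rewrite ?fctE ?scaler0 ?addr0.
Qed.
HB.instance Definition _ n := GRing.isLinear.Build k (A -> M) (nat -> seq A -> M) *:%R
  (inject n) (inject_linear n).

Lemma delB0 p : Ch_delB p (0 : seq A -> M) = 0.
Proof.
have := Ch_delB_linear p (-1) (0 : seq A -> M) 0.
by rewrite scaler0 addr0 scaleN1r addNr.
Qed.
Lemma dB0 p : Ch_dB p (0 : seq A -> M) = 0.
Proof.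
have := Ch_dB_linear p (-1) (0 : seq A -> M) 0.
by rewrite scaler0 addr0 scaleN1r addNr.
Qed.

Lemma Harr_D_inject n theta : is_derivation n theta ->
  Harr_D (inject n theta) = inject n.+1 (der_d n theta).
Proof.
move=> tD; apply: funext => p; rewrite /Harr_D /inject.
have -> : Ch_delB p (if p == n then cochain1 theta else 0) = 0.
  by case: eqP => [->|_]; [exact: Der_delB|exact: delB0].
rewrite scaler0 subr0; case: p => [|q] //; rewrite eqSS.
by case: eqP => [->|_]; [exact: Der_dB|exact: dB0].
Qed.

Lemma totCh_inject n theta : is_derivation n theta -> is_totCh n.+1 (inject n theta).
Proof.
move=> tD p; rewrite /inject; case: (ltngtP p n) => [lt|gt|->].
- by rewrite ltnS (ltnW lt); exact: submod0.
- by rewrite ltnNge gt.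
by rewrite ltnS leqnn subSnn; apply: is_Ch_cochain1.
Qed.

Lemma totCh_mlin n g p : is_totCh n g -> mlin (g p : seq A -> M).
Proof.
move=> /(_ p); case: ifP => _; first by case.
by move=> ->; exact: mlin0.
Qed.
Lemma totCh_homog n g p x : is_totCh n g -> homog gM (p + wdg x) (restr (g p : seq A -> M) x).
Proof.
move=> /(_ p); case: ifP => _; first by case=> _ _ H _ _; apply: (H _ _ (homogs_letters x)).
by move=> ->; exact: homog0.
Qed.

Lemma mlin_Harr_D n g p : is_totCh n g -> mlin (Harr_D g p : seq A -> M).
Proof.
move=> gC; apply: (@mlin_eqf _ _ _ (fun s => (if p is q.+1 then Ch_dB q (g q) else 0) s
    + (- (-1) ^+ p) *: Ch_delB p (g p) s)).
  by move=> s; rewrite /Harr_D !fctE scaleNr.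
apply: mlinD; last exact/mlinS/mlin_delB/(totCh_mlin _ gC).
by case: p => [|q]; [exact: mlin0|exact/mlin_dB/(totCh_mlin _ gC)].
Qed.

Lemma restr_Harr_D n g p x : is_totCh n g ->
  restr (Harr_D g p) x = letter_D (fun q => restr (g q)) p x.
Proof.
move=> gC; rewrite /letter_D -(restr_delB M_symmetric); last first.
- by move=> y; apply: totCh_homog gC.
- exact: totCh_mlin gC.
rewrite /restr /Harr_D !fctE; congr (_ - _); case: p => [|q] //=.
by rewrite -restr_dB //; apply: totCh_mlin gC.
Qed.

Lemma restr_extend F : multilinear F -> restr (extend F) = F.
Proof. by move=> FL; apply: funext => x; apply: extend_restr. Qed.

(** Modulo a boundary, [g] is concentrated in arity 1. The component [N + 1] of its differential is
    left free: it is zero for a cocycle and [theta] when [g] bounds [inject theta], so the lemma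
    serves both surjectivity and injectivity. *)
Lemma descend N g : is_totCh N.+1 g -> (forall p, (p <= N)%N -> Harr_D g p = 0) ->
  exists u h, [/\ is_Ch N 1 u, Ch_delB N u = 0, is_totCh N h,
    forall p, g p = (if p == N then u else 0) + Harr_D h p &
    Ch_dB N u = Ch_dB N (g N) :> (seq A -> M)].
Proof.
move=> gC Dg; have [del delP] := free_delta gcaA A_free.
pose F p := restr (g p).
have FC p : (p <= N)%N -> lcochain gM p (N.+1 - p) (F p).
  by move=> le_p; apply: lcochain_restr; have := gC p; rewrite ltnS le_p.
have DF p x : (p <= N)%N -> letter_D F p x = 0.
  by move=> le_p; rewrite -(restr_Harr_D _ _ gC) Dg.
have [G [GC G0 FG]] := staircase A_connected char0 delP FC DF.
have [UC dU] := remainder A_connected (leqnn N) FC DF GC FG.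
pose U x := F N x - dprev G N x; rewrite -/U in UC dU.
have {}UC : lcochain gM N 1 U by move: UC; rewrite subSnn.
have UL := lc_lin UC.
pose h p := if (p < N)%N then extend (G p) else 0.
have hC : is_totCh N h.
  move=> p; rewrite /h; case: ifP => lt_p; rewrite lt_p //; exact: (is_Ch_extend (GC p lt_p)).
have hG p : restr (h p) = G p.
  rewrite /h; case: ltnP => [lt_p|le_p]; first exact/restr_extend/(lc_lin (GC _ lt_p)).
  by apply: funext => x; rewrite G0.
have hGE : (fun q => restr (h q)) = G by apply: funext.
have uC : is_Ch N 1 (extend U) by apply: is_Ch_extend.
exists (extend U), h; split => //.
- apply: (@mlin_eq _ _ _ _ (fun=> 0)); [exact/mlin_delB/mlin_extend|exact: mlin0|].
  move=> x; rewrite (restr_delB M_symmetric) ?restr_extend //; first exact: mlin_extend.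
  by move=> y; apply: (lc_deg UC).
- move=> p; apply: mlin_eq; first exact: totCh_mlin gC.
    apply: mlinD; last exact: mlin_Harr_D hC.
    by case: eqP => _; [exact: mlin_extend|exact: mlin0].
  move=> x; have -> : restr ((if p == N then extend U else 0) + Harr_D h p) x =
      restr (if p == N then extend U else 0) x + restr (Harr_D h p) x by [].
  rewrite (restr_Harr_D _ _ hC) hGE -/(F p x).
  case: (ltngtP p N) => [lt_p|gt_p|->].
  + by rewrite add0r FG.
  + have -> : F p x = 0 by have := gC p; rewrite ltnS leqNgt gt_p /F => ->.
    rewrite add0r /letter_D bar_diff_eq0 ?scaler0 ?subr0; last by move=> z _ _; apply/G0/ltnW.
    case: p gt_p => [//|q] le_q; rewrite /= /dB /letter_d letop_eq0; last by move=> z _; apply: G0.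
    by rewrite G0 // scaler0 linear0 subrr.
  rewrite restr_extend // /letter_D bar_diff_eq0 ?scaler0 ?subr0; last by move=> z _ _; apply: G0.
  by rewrite /U subrK.
apply: mlin_eq; [exact/mlin_dB/mlin_extend|exact/mlin_dB/(totCh_mlin _ gC)|move=> x].
rewrite !restr_dB ?restr_extend //; [|exact: totCh_mlin gC|exact: mlin_extend].
rewrite /dB letter_dB [bim_d M (_ - _)]linearB /=.
(* [U] differs from the last component of [g] by an image of [dB], which [dB] annihilates. *)
have Z : dB N (dprev G N) x = 0.
  case: N {gC Dg FC DF G0 FG UC dU UL hC uC U h hG hGE F} GC => [|r] GC.
    by rewrite /dB /dprev /letter_d letop_0 scaler0 linear0 subrr.
  by apply: dB_dB; apply: (lc_lin (GC r _)).
by move: Z; rewrite /dB => /eqP; rewrite subr_eq0 => /eqP E; rewrite scalerBr E; lincomb.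
Qed.

Lemma harr_iso m : exists G : {linear cohomology (DerComplex M) (Posz m) -> Harr M (Posz m.+1)},
  bijective G.
Proof.
apply: (subquot_iso (h := inject m)) => [theta|theta|theta|g].
- move=> [tD dt]; split; first exact: totCh_inject.
  rewrite /= Harr_D_inject // [der_d m theta]dt.
  exact: (linear0 (inject m.+1)).
- case: m => [->|m [t tD ->]]; first by exists 0; [exact: submod0|rewrite !linear0].
  exists (inject m t); first exact: totCh_inject.
  by rewrite /= Harr_D_inject.
- move=> [tD dt] [g gC E]; case: m tD dt E gC => [|N] tD dt E gC.
    have g0 : g = 0 by apply: funext => p; have := gC p.
    move: E; rewrite g0 linear0 => E; apply: funext => a.
    by have := congr1 (fun h => h 0%N [:: a]) E.
  (* The injected derivation sits in component [N + 1], so the differential of [g] vanishes below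
     it. *)
  have Dg p : (p <= N)%N -> Harr_D g p = 0.
    by move=> le_p; rewrite -[Harr_D g]E /= /inject ltn_eqF.
  have [u [h [uC du _ _ Eu]]] := descend gC Dg.
  have [uD uE] := Ch1_derivation uC du.
  (* Component [N + 1] of [E] reads theta = d_B u. *)
  exists (fun a => u [:: a]) => //; apply: funext => a.
  have := congr1 (fun h => h N.+1 [:: a]) E.
  have gN : g N.+1 = 0 by have := gC N.+1; rewrite ltnn.
  rewrite /= /inject eqxx /= /Harr_D gN delB0 scaler0 subr0 -Eu => ->.
  by rewrite uE Der_dB.
move=> [gC Dg].
have Dg' p : (p <= m)%N -> Harr_D g p = 0 by rewrite [Harr_D g]Dg.
have [u [h [uC du hC gE Eu]]] := descend gC Dg'.
have [uD uE] := Ch1_derivation uC du.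
(* Component [m + 1] of the cocycle equation says that d_B u = 0, and [h] bounds the difference
   between [g] and [inject m u]. *)
exists (fun a => u [:: a]).
  split => //; apply: funext => a; have := congr1 (fun h => h m.+1 [:: a]) Dg.
  have gm : g m.+1 = 0 by have := gC m.+1; rewrite ltnn.
  rewrite /= /Harr_D gm delB0 scaler0 subr0 -Eu uE Der_dB.
  exact.
exists h => //; apply: funext => p.
transitivity (g p - inject m (fun a => u [:: a]) p) => //.
by rewrite gE /inject -uE addrAC subrr add0r.
Qed.

(** For n ≤ 0 both sides are zero: cochains have arity at least 1, and the complex of derivations
    begins in degree 0. The variable [n'] allows the case analysis on [n] to replace [n - 1]. *)
Lemma harr_iso_int (n n' : int) : n' = n - 1 ->
  exists G : {linear cohomology (DerComplex M) n' -> Harr M n}, bijective G.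
Proof.
have zero (Z B : submodule (A -> M)) (Z' B' : submodule (nat -> seq A -> M)) :
    (forall v, Z v -> v = 0) -> (forall v, B v -> v = 0) -> (forall v, Z' v -> v = 0) ->
    exists G : {linear subquot Z B -> subquot Z' B'}, bijective G.
  move=> Z0 B0 Z0'; apply: (subquot_iso (h := inject 0)).
  - by move=> x /Z0 ->; rewrite linear0; exact: submod0.
  - by move=> x /B0 ->; rewrite linear0; exact: submod0.
  - by move=> x /Z0 -> _; exact: submod0.
  move=> z /Z0' ->; exists 0; first exact: submod0.
  by rewrite linear0 subr0; exact: submod0.
case: n => [[|m]|m] ->.
- apply: zero => // f [fC _]; apply: funext => p; exact: fC p.
- have -> : Posz m.+1 - 1 = Posz m by rewrite -addn1 PoszD addrK.
  exact: harr_iso.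
by apply: zero.
Qed.

End Comparison.

Theorem theorem2 (k : fieldType) (char0 : [pchar k] =i pred0)
    (A : cdga k) (A_connected : connected_grading (cdga_gr A))
    (A_free : free_gca (cdga_gr A))
    (M : dgBimodule A) (M_connected : connected_grading (bim_gr M))
    (M_symmetric : symmetric_bimodule M) :
  exists Gamma : forall n : int,
      {linear cohomology (DerComplex M) (n - 1) -> Harr M n},
    forall n : int, bijective (Gamma n).
Proof.
have H n := harr_iso_int char0 A_connected A_free M_symmetric (erefl (n - 1)).
exists (fun n => sval (cid (H n))) => n.
exact: svalP (cid (H n)).
Qed.
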